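(* Let $f\in L\log L(G\times G)$ and $0<p\le 2$. Then for almost every $(x,y)\in G\times G$, $$\left(\frac{1}{n}\sum_{m=0}^{n-1}\left|S_{m,m}(x,y,f)-f(x,y)\right|^{p}\right)^{1/p}\to 0\quad\text{as } n\to\infty,$$ where $S_{m,m}(x,y,f)$ are the quadratic partial sums of the two-dimensional Walsh-Fourier series of $f$.
   Context: $\mathbb{N}=\{0,1,2,\dots\}$. $\mathbb{Z}_2=\{0,1\}$ is the discrete cyclic group of order 2 with addition modulo 2, every subset open, and Haar measure giving each singleton measure $1/2$. The Walsh group $G$ is the complete direct product of countably infinitely many copies of $\mathbb{Z}_2$; its elements are sequences $x=(x_0,x_1,\dots)$ with $x_k\in\{0,1\}$, with coordinatewise addition, product topology and product measure $\mu$ (so $\mu(G)=1$). The product measure on $G\times G$ is also denoted by $\mu$, and ''almost every'' refers to it. Rademacher functions: $r_k(x):=(-1)^{x_k}$ for $x\in G$, $k\in\mathbb{N}$. Writing $n\in\mathbb{N}$ in base 2 as $n=\sum_{i=0}^{\infty}n_i2^i$ with $n_i\in\{0,1\}$, the Walsh-Paley functions are $w_n(x):=\prod_{k=0}^{\infty}(r_k(x))^{n_k}$, with $w_0:=1$. For an integrable function $f$ on $G\times G$, the Walsh-Fourier coefficients are $\widehat{f}(i,j):=\int_{G\times G}f(x,y)w_i(x)w_j(y)\,d\mu(x,y)$, and the rectangular partial sums are $$S_{M,N}(x,y,f):=\sum_{i=0}^{M-1}\sum_{j=0}^{N-1}\widehat{f}(i,j)w_i(x)w_j(y)$$ (an empty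 sum is $0$). $L\log L(G\times G)$ is the class of measurable functions $f$ on $G\times G$ with $\int_{G\times G}|f|\log^{+}|f|\,d\mu<\infty$, where $\log^{+}u:=\log u$ if $u>1$ and $\log^{+}u:=0$ otherwise. *)

(* Defs.v *)
From HB Require Import structures.
From mathcomp Require Import all_boot all_order all_algebra.
From mathcomp Require Import all_classical all_reals all_analysis.

Set Implicit Arguments.
Unset Strict Implicit.
Unset Printing Implicit Defensive.
Import Order.TTheory GRing.Theory Num.Theory.
Import numFieldNormedType.Exports.

Local Open Scope classical_set_scope.
Local Open Scope ring_scope.

(* The underlying set of the Walsh group: Z_2 is represented by bool (its sum
   being addb), whose sigma-algebra is discrete, and the sequences carry the
   product sigma-algebra. The latter is also the Borel sigma-algebra of the
   product topology, there being only countably many factors. *)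
Definition coord_preimages : set (set (nat -> bool)) :=
  \bigcup_k preimage_set_system setT (fun x : nat -> bool => x k) measurable.

Definition walsh_group := g_sigma_algebraType coord_preimages.

Definition haarZ2 (R : realType) : probability bool R :=
  bernoulli_prob (2^-1 : R).

Lemma haarZ2E (R : realType) (A : set bool) :
  haarZ2 R A = ((2^-1 : R) * ((true \in A)%:R + (false \in A)%:R))%:E.
Proof.
have h : 0 <= (2^-1 : R) <= 1 by rewrite invr_ge0 ler0n invf_le1// ler1n.
have h2 : mathcomp.classical.unstable.onem (2^-1 : R) = 2^-1.
  by apply: (addIr 2^-1); rewrite /unstable.onem subrK -div1r -splitr.
by rewrite /haarZ2 /= bernoulli_probE// !diracE h2 mulrDr EFinD !EFinM.
Qed.

Lemma haarZ2_set1 (R : realType) (b : bool) :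
  haarZ2 R [set b] = (2^-1 : R)%:E.
Proof.
rewrite haarZ2E; congr (_%:E); case: b.
- by rewrite (@mem_set _ _ true)// (@memNset _ _ false)// addr0 mulr1.
- by rewrite (@mem_set _ _ false)// (@memNset _ _ true)// add0r mulr1.
Qed.

Definition walsh_box (A : nat -> set bool) (n : nat) : set walsh_group :=
  [set x | forall k, (k < n)%N -> A k (x k)].

(* The product measure, given by its values on the boxes constraining finitely
   many coordinates; product_haarZ2_exists and is_product_haarZ2_unique show
   that it exists and is unique. *)
Definition is_product_haarZ2 (R : realType) (mu : probability walsh_group R) :=
  forall (A : nat -> set bool) (n : nat),
    mu (walsh_box A n) = (\prod_(k < n) haarZ2 R (A k))%E.

Lemma measurable_walsh_coord (k : nat) :
  measurable_fun [set: walsh_group] (fun x : walsh_group => x k).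
Proof.
move=> _ B mB; apply: sub_sigma_algebra; exists k => //.
by exists B.
Qed.

Lemma measurable_walsh_box A n : measurable (walsh_box A n).
Proof.
have -> : walsh_box A n =
    \bigcap_(k < n) ((fun x : walsh_group => x k) @^-1` A k) by [].
apply: bigcap_measurableType => k _; rewrite -[X in measurable X]setTI.
exact: measurable_walsh_coord.
Qed.

Lemma walsh_boxI : setI_closed [set walsh_box A n | A in setT & n in setT].
Proof.
move=> _ _ [A _ [n _ <-]] [B _ [m _ <-]].
exists (fun k => [set b | ((k < n)%N -> A k b) /\ ((k < m)%N -> B k b)]) => //.
exists (maxn n m) => //; apply/seteqP; split=> x /=.
  move=> h; split=> k kn.
  - by apply: (h k _).1 => //; rewrite leq_max kn.
  - by apply: (h k _).2 => //; rewrite leq_max kn orbT.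
by move=> [hA hB] k _; split=> ?; [exact: hA|exact: hB].
Qed.

Lemma measurable_walsh_boxE :
  @measurable _ walsh_group =
  <<s [set walsh_box A n | A in setT & n in setT] >>.
Proof.
apply/seteqP; split; apply: smallest_sub.
- exact: smallest_sigma_algebra.
- move=> _ [k _ [B mB <-]]; apply: sub_sigma_algebra.
  exists (fun j => if j == k then B else setT) => //; exists k.+1 => //.
  apply/seteqP; split=> x /=.
    by move=> /(_ k (ltnSn k)); rewrite eqxx.
  by move=> [_ Bx] j _; case: eqP => // ->.
- exact: sigma_algebra_measurable.
- by move=> _ [A _ [n _ <-]]; exact: measurable_walsh_box.
Qed.

Lemma is_product_haarZ2_unique (R : realType)
    (mu nu : probability walsh_group R) :
  is_product_haarZ2 mu -> is_product_haarZ2 nu ->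
  forall A, measurable A -> mu A = nu A.
Proof.
move=> hmu hnu A mA.
apply: (measure_unique [set walsh_box A n | A in setT & n in setT]
  (fun=> setT)) => //.
- exact: measurable_walsh_boxE.
- exact: walsh_boxI.
- move=> _; exists (fun=> setT) => //; exists 0%N => //.
  exact/seteqP.
- by rewrite bigcup_const//; exists 0%N.
- move=> _ [B _ [n _ <-]] /=; exact: etrans (hmu B n) (esym (hnu B n)).
- by move=> _; rewrite [X in (X < _)%E]probability_setT ltry.
Qed.

Section existence.
Variable R : realType.
Local Notation lambda := (@lebesgue_measure R).

Let bit (l : nat) (x : R) : bool := odd (Num.truncn (2 ^+ l.+1 * x)).

Let dyadic (l i : nat) : set R := `[i%:R / 2 ^+ l, i.+1%:R / 2 ^+ l[.

Let two_gt0 l : 0 < 2 ^+ l :> R. Proof. by rewrite exprn_gt0. Qed.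

Let dyadicP l i x : dyadic l i x <-> i%:R <= 2 ^+ l * x < i.+1%:R.
Proof. by rewrite /dyadic /= in_itv /= ler_pdivrMr// ltr_pdivlMr// mulrC. Qed.

Let bit_dyadic l i x : dyadic l.+1 i x -> bit l x = odd i.
Proof. by move=> /dyadicP h; rewrite /bit (truncn_def h). Qed.

Let dyadic_split l i : dyadic l i = dyadic l.+1 i.*2 `|` dyadic l.+1 i.*2.+1.
Proof.
have e x : 2 ^+ l.+1 * x = 2 * (2 ^+ l * x) by rewrite exprS mulrA.
have d j : (j.*2)%:R = 2 * j%:R :> R by rewrite -mul2n natrM.
apply/seteqP; split=> x.
- move=> /dyadicP /andP[h1 h2].
  have [h|h] := ltP (2 ^+ l.+1 * x) i.*2.+1%:R; [left|right];
    apply/dyadicP; rewrite ?h ?andbT/=.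
    by rewrite e d ler_pM2l.
  by rewrite -doubleS d e ltr_pM2l.
- case=> /dyadicP /andP[h1 h2]; apply/dyadicP.
  + rewrite -(@ler_pM2l _ 2)// -(@ltr_pM2l _ 2 _ _ i.+1%:R)// -e -!d h1/=.
    by rewrite (lt_trans h2)// ltr_nat doubleS.
  + rewrite -(@ler_pM2l _ 2)// -(@ltr_pM2l _ 2 _ _ i.+1%:R)// -e -!d.
    by rewrite (le_trans _ h1) ?ler_nat//= doubleS.
Qed.

Let dyadic_disj l i : dyadic l i `&` dyadic l i.+1 = set0.
Proof.
rewrite -subset0 => x [/dyadicP /andP[_ h1] /dyadicP /andP[h2 _]].
by have := lt_le_trans h1 h2; rewrite ltxx.
Qed.

Let measurable_dyadic l i : measurable (dyadic l i).
Proof. exact: measurable_itv. Qed.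

Let lambda_dyadic l i : lambda (dyadic l i) = (2 ^- l)%:E.
Proof.
rewrite /dyadic lebesgue_measure_itv/= lte_fin ltr_pM2r ?invr_gt0//.
by rewrite ltr_nat ltnSn -EFinB -mulrBl -addn1 natrD addrC addKr mul1r.
Qed.

Let measurable_bit l : measurable_fun [set: measurableTypeR R] (bit l).
Proof.
apply: (@measurable_fun_bool _ _ _ _ true).
have -> : setT `&` bit l @^-1` [set true] =
    \bigcup_(i in [set i | odd i]) dyadic l.+1 i.
  rewrite setTI; apply/seteqP; split=> x /=.
  - move=> bx; exists (Num.truncn (2 ^+ l.+1 * x)) => //=.
    apply/dyadicP/truncn_itv; rewrite leNgt; apply/negP => x0.
    by move: bx; rewrite /bit truncn_floor leNgt x0.
  - by move=> [i /= oi /bit_dyadic ->].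
by apply: bigcup_measurable => i _; exact: (measurable_dyadic l.+1 i).
Qed.

Let phi (x : measurableTypeR R) : walsh_group := fun k => bit k x.

Let measurable_phi : measurable_fun setT phi.
Proof.
apply: (@measurability _ _ _ walsh_group setT phi coord_preimages) => //.
move=> _ [_ [k _ [B mB <-]] <-]; rewrite setTI setTI.
rewrite -[X in measurable X]setTI; exact: (measurable_bit k).
Qed.

Let shifted_box A l n : set R :=
  [set x | forall k, (k < n)%N -> A k (bit (l + k) x)].

Let measurable_shifted_box A l n : measurable (shifted_box A l n).
Proof.
have -> : shifted_box A l n = \bigcap_(k < n) (bit (l + k) @^-1` A k) by [].
apply: bigcap_measurableType => k _; rewrite -[X in measurable X]setTI.
exact: measurable_bit.
Qed.

Let lambda_box n A l i :
  lambda (dyadic l i `&` shifted_box A l n) =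
  ((2 ^- l)%:E * \prod_(k < n) haarZ2 R (A k))%E.
Proof.
elim: n A l i => [|n IH] A l i.
  rewrite big_ord0 mule1 (_ : shifted_box A l 0 = setT) ?setIT//.
  exact/seteqP.
have half j : lambda (dyadic l.+1 j `&` shifted_box A l n.+1) =
  ((odd j \in (A 0%N : set bool))%:R%:E *
   ((2 ^- l.+1)%:E * \prod_(k < n) haarZ2 R (A k.+1)))%E.
  have [Aj|Aj] := pselect (A 0%N (odd j)).
    rewrite mem_set// mul1e -(IH (A \o S) _ j); congr (lambda _).
    apply/seteqP; split=> x [dx sx]; split=> // -[|k] kn/=.
    - by have := sx 1%N kn; rewrite addn1 addn0.
    - by have := sx k.+2 kn; rewrite addnS -addSn.
    - by rewrite addn0 (bit_dyadic dx).
    - by rewrite addnS -addSn; exact: sx.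
  rewrite memNset// mul0e (_ : _ `&` _ = set0) ?measure0//.
  rewrite -subset0 => x [dx /(_ 0%N erefl)].
  by rewrite addn0 (bit_dyadic dx).
rewrite dyadic_split setIUl measureU.
- rewrite [X in (X + _)%E]half [X in (_ + X)%E]half /= odd_double /=
    big_ord_recl haarZ2E.
  set P := (\prod_(k < n) haarZ2 R (A k.+1))%E.
  have Pfin : P \is a fin_num by apply: prode_fin_num => k _; rewrite haarZ2E.
  rewrite -(fineK Pfin) -!EFinM -EFinD; congr (_%:E).
  rewrite exprS invfM -mulrDl addrC !mulrA; congr (_ * _).
  by rewrite mulrC [X in _ * X]mulrC mulrA.
- exact: (measurableI _ _ (measurable_dyadic _ _)
    (measurable_shifted_box _ _ _)).
- exact: (measurableI _ _ (measurable_dyadic _ _)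
    (measurable_shifted_box _ _ _)).
- by rewrite setIACA dyadic_disj set0I.
Qed.

Let lambda01 := mrestr lambda (measurable_dyadic 0 0).

Let phi_mfun : {mfun measurableTypeR R >-> walsh_group} :=
  HB.pack phi (isMeasurableFun.Build _ _ _ _ phi measurable_phi).

(* The law of the sequence of binary digits of a uniform random point of
   [0, 1]. *)
Definition binary_digits_law : set walsh_group -> \bar R :=
  pushforward lambda01 phi_mfun.

Let binary_digits_law_setT : binary_digits_law setT = 1%E.
Proof.
rewrite /binary_digits_law /pushforward preimage_setT /lambda01 /mrestr
  setTI lambda_dyadic.
by rewrite expr0 invr1.
Qed.

Let binary_digits_law_set0 : binary_digits_law set0 = 0%E.
Proof.
by rewrite /binary_digits_law /pushforward preimage_set0 /lambda01
  /mrestr set0I measure0.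
Qed.

Let binary_digits_law_ge0 A : (0 <= binary_digits_law A)%E.
Proof. exact: measure_ge0. Qed.

Let binary_digits_law_sigma_additive : semi_sigma_additive binary_digits_law.
Proof. exact: measure_semi_sigma_additive. Qed.

HB.instance Definition _ := isMeasure.Build _ walsh_group R binary_digits_law
  binary_digits_law_set0 binary_digits_law_ge0 binary_digits_law_sigma_additive.

HB.instance Definition _ := Measure_isProbability.Build _ walsh_group R
  binary_digits_law binary_digits_law_setT.

Lemma product_haarZ2_exists :
  exists mu : probability walsh_group R, is_product_haarZ2 mu.
Proof.
exists binary_digits_law => A n; rewrite -[RHS]mul1e.
have := lambda_box n A 0 0; rewrite expr0 invr1 => <-.
by rewrite /binary_digits_law /pushforward /lambda01 /mrestr /= setIC.
Qed.

End existence.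

(* The choice is immaterial, see is_product_haarZ2_unique. *)
Definition walsh_measure (R : realType) : probability walsh_group R :=
  sval (cid (product_haarZ2_exists R)).

Lemma walsh_measureP (R : realType) : is_product_haarZ2 (walsh_measure R).
Proof. exact: svalP (cid (product_haarZ2_exists R)). Qed.

Definition rademacher (R : realType) (k : nat) (x : walsh_group) : R :=
  (-1) ^+ (x k).

Definition binary_digit (n i : nat) : bool := odd (n %/ 2 ^ i).

(* Since n < 2 ^ n, the digits of n of index at least n vanish, and the infinite
   product reduces to its first n factors. *)
Definition walsh (R : realType) (n : nat) (x : walsh_group) : R :=
  \prod_(k < n) rademacher R k x ^+ binary_digit n k.

Section walsh_fourier.
Variable R : realType.
Implicit Type f : walsh_group * walsh_group -> R.

Definition walsh_coef f (i j : nat) : R :=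
  \int[(walsh_measure R \x walsh_measure R)%E]_z
    (f z * walsh R i z.1 * walsh R j z.2).

Definition walsh_psum (M N : nat) (z : walsh_group * walsh_group) f : R :=
  \sum_(i < M) \sum_(j < N)
    walsh_coef f i j * walsh R i z.1 * walsh R j z.2.

Definition logp (u : R) : R := if 1 < u then ln u else 0.

Definition LlogL f : Prop :=
  measurable_fun setT f /\
  (\int[walsh_measure R \x walsh_measure R]_z
     (`|f z| * logp `|f z|)%:E < +oo)%E.

End walsh_fourier.

(* Main.v *)
(* Cylinder functions P are dense in L^1 and satisfy S_{m,m} P = P for large m;
   since |d|^p <= s^p + s^(p-2) d^2 for all s > 0, the theorem therefore follows
   from the weak type inequality
     mu {sup_n 2^-n sum_(m < 2^n) |S_{m,m} f|^2 > C lam^2}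
       <= (C / lam) (delta + sum_k int_{|f| > delta 2^k / 2} |f|),
   in which the sum over k is O(int |f| (1 + log^+ |f|)). It is proved on the
   finite groups (Z_2)^N, with constants independent of N.

   On (Z_2)^n, a formula of Schipp expands D_m(s) in the w_m(s + e_o), with
   coefficients of size 2^o supported on a dyadic interval, so that Parseval's
   identity in m bounds the strong mean by sum_u H(u)^2. Here H(u) is a sum over
   v of the masses of |f| on products of dyadic intervals whose levels are the
   positions sh v and sh (u + v) of the first nonzero coordinates. For
   sh v <> sh (u + v) the variables are treated one after the other: the sums
   along a row of |f| are square summable with a bound, the gauge, of order
   delta 2^k for the least k such that the point escapes the exceptional set of
   the row at that height, and the gauge then plays the role of |f| for the
   second variable. For sh v = sh (u + v) the rows a |-> (a, a + c) are used
   instead of the horizontal ones. In both cases a quadratic functional of dyadic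
   intervals obeys a splitting inequality with constant 5/4, and iterating it
   down to the maximal intervals on which the mean exceeds lam, as in the
   Calderon-Zygmund decomposition, controls it outside a small set. *)
From HB Require Import structures.
Require Import Defs.
From mathcomp Require Import all_boot all_order all_algebra.
From mathcomp Require Import all_classical all_reals all_analysis.
From mathcomp Require Import measurable_realfun.
From mathcomp Require Import ring lra zify.
Import Order.TTheory GRing.Theory Num.Theory.
Import numFieldNormedType.Exports.
Local Open Scope classical_set_scope.
Local Open Scope ring_scope.

Set Implicit Arguments.
Unset Strict Implicit.
Unset Printing Implicit Defensive.

(** * Dyadic intervals of finite groups *)

(** The obstacle is the translation by [e_o]: it can carry a good point into a bad interval, where
    only the squared mass bounds a functional. Functionals are therefore evaluated at points moved
    by [shift N i] and [shift N j], with weights tuned to two demands. Their total at level [U] has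
    order [4 ^ U], which matches the square of a good mass [lam * 2 ^- U]. If the moved point of a
    good point first turns bad at level [l], then [i <= l], and these indices weigh only
    [(3 / 2) ^ U * (8 / 3) ^ l]; with the decay [2 ^- (U - l)] of the squared masses this leaves
    [4 ^ l * (3 / 4) ^ (U - l)], summable in [U].

    The constant 5/4 comes from [(A + B) ^ 2 <= 5 / 4 * A ^ 2 + 5 * B ^ 2]. Two halves together cost
    a factor 5/2: this is less than the 4 gained from one level to the next, so sums over levels
    converge, and less than 3, so the error terms are absorbed.

    Exceptional sets are built from the finest level [N] alone. They serve every [n <= N] at once,
    which yields the supremum over [n]. *)

Definition cube (n : nat) := {ffun 'I_n -> bool}.
HB.instance Definition _ n := Finite.on (cube n).
HB.instance Definition _ n := GRing.Zmodule.on (cube n).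

Section Cube.
Variable n : nat.
Implicit Types (u v x y a : cube n) (k : nat).

Definition inball k v := [forall i : 'I_n, (i < k)%N ==> ~~ v i].

(* Equal to n at 0. *)
Definition shell v : nat := find (fun k => ~~ inball k.+1 v) (iota 0 n).

(** Indexed by [nat]: it vanishes for [n <= j], a value that occurs in the last term of Schipp's
    formula. *)
Definition unitc (j : nat) : cube n := [ffun i : 'I_n => i == j :> nat].

Lemma inball_leq k l v : (k <= l)%N -> inball l v -> inball k v.
Proof.
move=> kl /forallP h; apply/forallP => i; apply/implyP => ik.
by have := h i; rewrite (leq_trans ik kl).
Qed.

Lemma inball0 v : inball 0 v. Proof. exact/forallP. Qed.

Lemma shell_le v : (shell v <= n)%N.
Proof. by rewrite /shell -[X in (_ <= X)%N](size_iota 0 n) find_size. Qed.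

Lemma shellE k v : (k <= shell v)%N = (k <= n)%N && inball k v.
Proof.
apply/idP/andP => [ks|[kn kv]].
  have kn := leq_trans ks (shell_le v); split=> //.
  case: k ks kn => [_ _|k ks kn]; first exact: inball0.
  have := before_find 0%N ks; rewrite nth_iota // add0n.
  by move/negbFE.
rewrite leqNgt; apply/negP => sk.
have : has (fun k => ~~ inball k.+1 v) (iota 0 n).
  by rewrite has_find size_iota (leq_trans sk kn).
move/(nth_find 0%N); rewrite -/(shell v) nth_iota ?add0n ?(leq_trans sk) //.
by rewrite (inball_leq sk kv).
Qed.

Lemma addcc v : v + v = 0.
Proof. by apply/ffunP => i; rewrite !ffunE; case: (v i). Qed.

Lemma addcK u v : u + (u + v) = v.
Proof. by rewrite addrA addcc add0r. Qed.

Lemma addcDK u v w : (u + v) + (u + w) = v + w.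
Proof. by rewrite addrACA addcc add0r. Qed.

Lemma addcE u v w : (u + v == w) = (v == u + w).
Proof. by apply/eqP/eqP => [<-|->]; rewrite addcK. Qed.

(** Ultrametric inequality: the dyadic intervals around 0 are subgroups. *)
Lemma shellD k u v :
  (k <= shell u)%N -> (k <= shell v)%N -> (k <= shell (u + v)%R)%N.
Proof.
rewrite !shellE => /andP[-> /forallP hu] /andP[_ /forallP hv] /=.
apply/forallP => i; apply/implyP => ik; rewrite ffunE.
by move: (hu i) (hv i); rewrite ik /=; case: (u i); case: (v i).
Qed.

Lemma shell0 : shell 0 = n.
Proof.
apply/eqP; rewrite eqn_leq shell_le shellE leqnn /=.
by apply/forallP => i; rewrite ffunE implybT.
Qed.

Lemma shell_eqn v : (n <= shell v)%N = (v == 0).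
Proof.
apply/idP/eqP => [|->]; last by rewrite shell0.
rewrite shellE leqnn => /forallP h; apply/ffunP => i; rewrite ffunE.
by have := h i; rewrite ltn_ord /=; case: (v i).
Qed.

Lemma shellDr k u v : (k <= shell v)%N -> (k <= shell (u + v)%R)%N = (k <= shell u)%N.
Proof.
move=> kv; apply/idP/idP => ku; last exact: shellD.
by rewrite -(addcK v u); apply: shellD => //; rewrite addrC.
Qed.

Lemma shellD_lt u v : (shell u < shell v)%N -> shell (u + v) = shell u.
Proof.
move=> uv; apply/eqP; rewrite eqn_leq shellDr ?leqnn ?andbT ?(ltnW uv)//.
by rewrite leqNgt shellDr// ltnn.
Qed.

Lemma shell_unitc j : (j <= shell (unitc j))%N = (j <= n)%N.
Proof.
rewrite shellE; case: leqP => //= _; apply/forallP => i.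
by apply/implyP => ij; rewrite ffunE neq_ltn ij.
Qed.

Lemma unitc_ge j : (n <= j)%N -> unitc j = 0.
Proof.
move=> nj; apply/ffunP => i; rewrite !ffunE.
by apply/negbTE; rewrite neq_ltn (leq_trans (ltn_ord i) nj).
Qed.

Lemma shell_unitc_ge k j : (k <= n)%N -> (k <= j)%N -> (k <= shell (unitc j))%N.
Proof.
move=> kn kj; case: (leqP j n) => jn.
  by rewrite (leq_trans kj)// shell_unitc.
by rewrite unitc_ge ?shell0// ltnW.
Qed.

Lemma shell_ltD k v : (k < n)%N -> (k <= shell v)%N ->
  (k < shell (v + unitc k)%R)%N = ~~ (k < shell v)%N.
Proof.
move=> kn; rewrite !shellE kn (ltnW kn) /= => /forallP h.
have inbS (w : cube n) : (forall i : 'I_n, (i < k)%N -> ~~ w i) ->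
   inball k.+1 w = ~~ w (Ordinal kn).
  move=> hw; apply/forallP/idP => [/(_ (Ordinal kn))|hk i].
    by rewrite /= ltnSn.
  rewrite ltnS leq_eqVlt; apply/implyP => /orP[/eqP ik|/hw//].
  by rewrite (_ : i = Ordinal kn)//; exact: val_inj.
rewrite !inbS ?ffunE /=.
- by rewrite eqxx; case: (v _).
- by move=> i ik; have := h i; rewrite ik.
- move=> i ik; have := h i; rewrite !ffunE ik /= (ltn_eqF ik).
  by case: (v i).
Qed.

Lemma shell_split k v : (k < n)%N ->
  (k <= shell v)%N = (k < shell v)%N || (k < shell (v + unitc k)%R)%N.
Proof.
move=> kn; apply/idP/orP => [kv|[/ltnW //|/ltnW]].
  by rewrite shell_ltD //; case: (k < shell v)%N; [left|right].
by rewrite shellDr// shell_unitc ltnW.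
Qed.

End Cube.
Arguments shell {n} v%_R.

Ltac cube_addition := let i := fresh in apply/ffunP => i; rewrite !ffunE;
  repeat match goal with |- context [?f i] => case: (f i) end; done.

Section Mass.
Variables (R : realFieldType) (n : nat).
Implicit Types (x y a : cube n) (k : nat) (f g : cube n -> R).

(* Integral of f over the dyadic interval of level k around x. *)
Definition mass k f x : R := 2 ^- n * \sum_(a | (k <= shell (x + a)%R)%N) f a.

Lemma mass_ge0 k f x : (forall a, 0 <= f a) -> 0 <= mass k f x.
Proof. by move=> f0; rewrite mulr_ge0 ?invr_ge0 ?exprn_ge0 ?sumr_ge0. Qed.

Lemma ler_mass k f g x : (forall a, f a <= g a) -> mass k f x <= mass k g x.
Proof. by move=> fg; rewrite ler_pM2l ?invr_gt0 ?exprn_gt0// ler_sum. Qed.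

Lemma massD k f g x : mass k (fun a => f a + g a) x = mass k f x + mass k g x.
Proof. by rewrite /mass big_split mulrDr. Qed.

Lemma massZ k c f x : mass k (fun a => c * f a) x = c * mass k f x.
Proof. by rewrite /mass -mulr_sumr mulrCA. Qed.

Lemma mass_top f x : mass n f x = 2 ^- n * f x.
Proof.
by rewrite /mass (big_pred1 x)// => a; rewrite shell_eqn addcE addr0.
Qed.

Lemma mass_add k f x u : (k <= shell u)%N -> mass k f (x + u) = mass k f x.
Proof.
move=> ku; congr (_ * _); apply: eq_bigl => a.
by rewrite addrAC (shellDr _ ku).
Qed.

Lemma mass_near k f x y : (k <= shell (x + y)%R)%N -> mass k f x = mass k f y.
Proof.
by move=> kxy; rewrite -[in RHS](addcK x y) mass_add.
Qed.

Lemma ball_split k f x : (k < n)%N ->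
  \sum_(a | (k <= shell (x + a))%N) f a =
  \sum_(a | (k < shell (x + a))%N) f a +
  \sum_(a | (k < shell (x + unitc n k + a))%N) f a.
Proof.
move=> kn; rewrite (bigID (fun a => k < shell (x + a))%N) /=; congr (_ + _).
  by apply: eq_bigl => a; apply: andb_idl => /ltnW.
apply: eq_bigl => a; rewrite -addrA [unitc n k + a]addrC addrA.
case kxa : (k <= shell (x + a))%N; first by rewrite shell_ltD.
by apply/esym/negbTE; apply: contraFN kxa => h; rewrite shell_split// h orbT.
Qed.

Lemma mass_split k f x : (k < n)%N ->
  mass k f x = mass k.+1 f x + mass k.+1 f (x + unitc n k).
Proof. by move=> kn; rewrite /mass -mulrDr ball_split. Qed.

(** Every [a] lies in the intervals of level [k] around [2 ^ (n - k)] points; the induction descends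
    from level [n], where [mass] is a single value, through [mass_split]. *)
Lemma sum_mass k f : (k <= n)%N -> \sum_x mass k f x = 2 ^- k * \sum_x f x.
Proof.
move=> kn; rewrite -(subKn kn).
have : (n - k <= n)%N by rewrite leq_subr.
elim: (n - k)%N => [_|m IH mn].
  rewrite subn0 mulr_sumr; apply: eq_bigr => x _; exact: mass_top.
have lt : (n - m.+1 < n)%N by lia.
under eq_bigr do rewrite mass_split//.
rewrite big_split /= subnSK//.
rewrite [X in _ + X](_ : _ = \sum_x mass (n - m) f x); last first.
  by rewrite [RHS](reindex_inj (addIr (unitc n (n - m.+1)))).
rewrite IH ?(ltnW mn)// -mulr2n -mulrnAl; congr (_ * _).
rewrite -(subnSK mn) exprS invfM -mulrnAl.
by rewrite -[_ *+ 2]mulr_natr mulVf ?mul1r ?pnatr_eq0.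
Qed.

End Mass.

Section Geometric.
Variable R : realFieldType.

Lemma sum_geometric_gt1 (q : R) m : 1 < q ->
  \sum_(i < m) q ^+ i <= q ^+ m / (q - 1).
Proof.
move=> q1; have q0 : 0 < q - 1 by rewrite subr_gt0.
rewrite ler_pdivlMr// mulrC -subrX1 lerBlDl lerDr ler01.
by [].
Qed.

Lemma sum_geometric_tail (q : R) i m : 0 <= q < 1 ->
  \sum_(j < m | (i <= j)%N) q ^+ j <= q ^+ i / (1 - q).
Proof.
move=> /andP[q0 q1]; have q'0 : 0 < 1 - q by rewrite subr_gt0.
rewrite ler_pdivlMr//; elim: m => [|m IH].
  by rewrite big_ord0 mul0r exprn_ge0.
rewrite big_mkcond big_ord_recr /= -big_mkcond /=.
case: ifPn => [im|_]; last by rewrite addr0.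
have {IH} : \sum_(j < m | (i <= j)%N) q ^+ j * (1 - q) <= q ^+ i - q ^+ m.
  rewrite -(subnKC im); elim: (m - i)%N => [|d IHd].
    rewrite addn0 subrr big1// => j; rewrite leqNgt; move/negP => h.
    by case: h; exact: ltn_ord.
  rewrite addnS big_mkcond big_ord_recr /= -big_mkcond /= leq_addr exprS.
  move: IHd; set s := \sum_(_ < _ | _) _; set t := q ^+ (i + d) => h.
  by rewrite (_ : t * (1 - q) = t - q * t); [lra|ring].
rewrite -mulr_suml mulrDl => h.
have : 0 <= q ^+ m * q by rewrite mulr_ge0 ?exprn_ge0.
by have := lerD h (lexx (q ^+ m * (1 - q))) => /le_trans h' h0; apply: h'; lra.
Qed.

End Geometric.

(** * Weighted sums over pairs of shifts *)

Section Weights.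
Variable R : realFieldType.

(** The offset by one makes [2 ^+ i] a bound for the coefficient of Schipp's formula that belongs to
    [shift n i]; the index 0 is a term without shift. *)
Definition shift n (i : nat) : cube n := if i is j.+1 then unitc n j else 0.

Lemma shell_shift n k i : (k <= n)%N -> (k < i)%N -> (k <= shell (shift n i))%N.
Proof. by move=> kn; case: i => // j kj; rewrite /= shell_unitc_ge. Qed.

(* The sum over i <= j <= U + 1 of 4 ^+ i / ((10 / 3) ^+ i * (4 / 5) ^+ j) has
   order (3 / 2) ^+ U, so that by Cauchy-Schwarz these weights dominate the
   square of \sum_(i <= j) 2 ^+ i * q i j. *)
Definition weight (U i j : nat) : R :=
  (3 / 2) ^+ U * ((10 / 3) ^+ i * (4 / 5) ^+ j).

Lemma weight_ge0 U i j : 0 <= weight U i j.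
Proof. by rewrite /weight !mulr_ge0 ?exprn_ge0//; lra. Qed.

Definition wsum U (q : nat -> nat -> R) : R :=
  \sum_(i < U.+2) \sum_(j < U.+2 | (i <= j)%N) weight U i j * q i j.

Lemma ler_wsum U q1 q2 :
  (forall i j, (i <= j)%N -> (j <= U.+1)%N -> q1 i j <= q2 i j) -> wsum U q1 <= wsum U q2.
Proof.
move=> h; apply: ler_sum => i _; apply: ler_sum => j ij.
by apply: ler_wpM2l; rewrite ?weight_ge0// h// -ltnS ltn_ord.
Qed.

Lemma wsumD U q1 q2 : wsum U (fun i j => q1 i j + q2 i j) = wsum U q1 + wsum U q2.
Proof.
rewrite /wsum -big_split; apply: eq_bigr => i _ /=; rewrite -big_split /=.
by apply: eq_bigr => j _; rewrite mulrDr.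
Qed.

Lemma wsumZ U c q : wsum U (fun i j => c * q i j) = c * wsum U q.
Proof.
rewrite /wsum mulr_sumr; apply: eq_bigr => i _; rewrite mulr_sumr.
by apply: eq_bigr => j _; rewrite mulrCA.
Qed.

Lemma wsum_ge0 U q : (forall i j, 0 <= q i j) -> 0 <= wsum U q.
Proof.
by move=> q0; apply: sumr_ge0 => i _; apply: sumr_ge0 => j _; rewrite mulr_ge0 ?weight_ge0.
Qed.

Lemma sum_wsum (I : finType) U (q : I -> nat -> nat -> R) :
  \sum_(x : I) wsum U (q x) = wsum U (fun i j => \sum_x q x i j).
Proof.
rewrite exchange_big /=; apply: eq_bigr => i _.
by rewrite exchange_big /=; apply: eq_bigr => j _; rewrite mulr_sumr.
Qed.

(** Summing over [j >= i] first costs [5 * (4 / 5) ^+ i] and leaves powers of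
    [10 / 3 * (4 / 5) = 8 / 3], whose sum up to [l] has the order of its last term. *)
Lemma wsum1_le l U (c : nat -> bool) : (forall i, c i -> (i <= l)%N) ->
  wsum U (fun i _ => (c i)%:R) <= 8 * ((3 / 2) ^+ U * (8 / 3) ^+ l).
Proof.
move=> cl; apply: (@le_trans _ _ ((3 / 2) ^+ U * (5 * \sum_(i < l.+1) (8 / 3) ^+ i))).
  rewrite /wsum !mulr_sumr.
  rewrite [leRHS](big_ord_widen_cond (maxn U.+2 l.+1) predT
    (fun i => (3 / 2) ^+ U * (5 * (8 / 3) ^+ i)))/= ?leq_maxr//.
  rewrite [leLHS](big_ord_widen_cond (maxn U.+2 l.+1) predT
    (fun i => \sum_(j < U.+2 | (i <= j)%N) weight U i j * (c i)%:R))/= ?leq_maxl//.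
  rewrite big_mkcond [leRHS]big_mkcond /=; apply: ler_sum => i _.
  have nn : 0 <= (3 / 2) ^+ U * (5 * (8 / 3) ^+ i) :> R.
    by rewrite !mulr_ge0 ?exprn_ge0//; lra.
  case: ifP => _; last by case: ifP.
  case ci : (c i); last first.
    by rewrite big1 => [|j _]; [case: ifP|rewrite mulr0].
  rewrite ltnS cl// /weight.
  under eq_bigr do rewrite mulr1.
  rewrite -mulr_sumr -mulr_sumr; apply: ler_wpM2l; first by rewrite exprn_ge0//; lra.
  have h : ((0 : R) <= 4 / 5) && ((4 / 5 : R) < 1) by apply/andP; split; lra.
  apply: (@le_trans _ _ ((10 / 3) ^+ i * ((4 / 5) ^+ i / (1 - 4 / 5)))).
    by apply: ler_wpM2l; [rewrite exprn_ge0//; lra|exact: sum_geometric_tail].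
  rewrite mulrA -exprMn (_ : 10 / 3 * (4 / 5) = 8 / 3 :> R); last by field.
  by rewrite mulrC (_ : (1 - 4 / 5)^-1 = 5 :> R)//; field.
have h : (1 : R) < 8 / 3 by lra.
have := sum_geometric_gt1 l.+1 h.
rewrite exprS; set s := \sum_(_ < _) _; set t := (8 / 3) ^+ l.
rewrite (_ : (8 / 3 - 1)^-1 = 3 / 5 :> R); last by field.
move=> st.
rewrite [leRHS]mulrCA; apply: ler_wpM2l; first by rewrite exprn_ge0//; lra.
lra.
Qed.

(** As [3 / 2 * (8 / 3) = 4], the full weight grows like the inverse square of the length of an
    interval of level [U]. *)
Lemma wsum1_le4 U : wsum U (fun _ _ => 1) <= 22 * 4 ^+ U.
Proof.
apply: (@le_trans _ _ (wsum U (fun i _ => (i <= U.+1)%N%:R))).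
  by apply: ler_wsum => i j ij jU; rewrite (leq_trans ij jU).
apply: le_trans (@wsum1_le U.+1 _ _ _) _ => //.
have e : (3 / 2) ^+ U * (8 / 3) ^+ U = 4 ^+ U :> R.
  by rewrite -exprMn (_ : 3 / 2 * (8 / 3) = 4 :> R)//; field.
rewrite exprS [(3 / 2) ^+ U * _]mulrCA e mulrA.
by apply: ler_wpM2r; [rewrite exprn_ge0|lra].
Qed.

End Weights.

(** * Splitting functionals and their exceptional sets *)

Section CalderonZygmund.
Variables (R : realFieldType) (N : nat) (g : cube N -> R).
Variables (c : nat -> cube N -> R) (lam : R).
Hypotheses (g_ge0 : forall a, 0 <= g a) (c_ge0 : forall k a, 0 <= c k a).
Hypothesis lam_gt0 : 0 < lam.
Implicit Types (x a : cube N) (k : nat).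

(* The dyadic interval of level k around x is contained in an interval over
   which the average of g exceeds lam. *)
Definition bad k x := [exists k' : 'I_k.+1, lam < 2 ^+ k' * mass k' g x].

Lemma badP k x :
  reflect (exists2 l, (l <= k)%N & lam < 2 ^+ l * mass l g x) (bad k x).
Proof.
apply: (iffP existsP) => [[l h]|[l lk h]]; first by exists l; rewrite // -ltnS.
by exists (Ordinal (lk : (l < k.+1)%N)).
Qed.

Lemma badS k l x : (k <= l)%N -> bad k x -> bad l x.
Proof. by move=> kl /badP[m mk h]; apply/badP; exists m => //; exact: leq_trans kl. Qed.

Lemma bad_near k x y : (k <= shell (x + y)%R)%N -> bad k x = bad k y.
Proof.
move=> kxy; apply/badP/badP => -[l lk h]; exists l => //;
  by rewrite ?(mass_near g (leq_trans lk kxy))// -(mass_near g (leq_trans lk kxy)).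
Qed.

Lemma bad_add k x u : (k <= shell u)%N -> bad k (x + u) = bad k x.
Proof. by move=> ku; apply: bad_near; rewrite addrAC addcc add0r. Qed.

Lemma good_mass k x : ~~ bad k x -> mass k g x <= lam * 2 ^- k.
Proof.
move=> /badP b; rewrite ler_pdivlMr ?exprn_gt0// mulrC leNgt; apply/negP => h.
by apply: b; exists k.
Qed.

Lemma mass_mono k l x : (k <= l)%N -> (l <= N)%N -> mass l g x <= mass k g x.
Proof.
move=> kl _; rewrite ler_pM2l ?invr_gt0 ?exprn_gt0// [leRHS](bigID (fun a => l <= shell (x + a))%N)/=.
rewrite [X in X + _](eq_bigl (fun a => l <= shell (x + a)%R)%N).
  by rewrite lerDl sumr_ge0.
by move=> a /=; apply: andb_idl => /(leq_trans kl).
Qed.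

Definition first_bad k x := bad k x && ((k == 0)%N || ~~ bad k.-1 x).

Lemma first_badP k x : bad k x -> exists2 l, (l <= k)%N & first_bad l x.
Proof.
elim: k => [|k IH] b; first by exists 0%N => //; rewrite /first_bad b.
case bk : (bad k x); first by have [l lk fl] := IH bk; exists l => //; exact: leqW.
by exists k.+1 => //; rewrite /first_bad b /= bk.
Qed.

Lemma first_bad_uniq k l x : first_bad k x -> first_bad l x -> k = l.
Proof.
wlog kl : k l / (k <= l)%N => [hw fk fl|].
  by case: (leqP k l) => [/hw|/ltnW/hw h]; [exact|apply/esym/h].
move=> /andP[bk _] /andP[_ /orP[/eqP l0|bl]].
  by move: kl; rewrite l0 leqn0 => /eqP.
case: (ltngtP k l) kl => // kl _; move: bl; rewrite (badS _ bk)//.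
by move: kl; case: (l).
Qed.

(* Iterates the hypothesis th_split of functional_majorant below, stopping at
   the maximal bad intervals; m counts the levels left above N. *)
Fixpoint majorant_rec m x : R :=
  let k := (N - m)%N in
  if bad k x then mass k g x ^+ 2 else
  if m is m'.+1 then
    5 / 4 * (majorant_rec m' x + majorant_rec m' (x + unitc N k)) +
    5 * lam * (2 ^- k * mass k (fun a => g a * c k a) x)
  else 0.

Definition majorant k := majorant_rec (N - k).

Lemma majorant_bad k x : (k <= N)%N -> bad k x -> majorant k x = mass k g x ^+ 2.
Proof.
move=> kN b; rewrite /majorant; case E : (N - k)%N => [|m] /=.
  have e : (N - 0 = k)%N by lia.
  by rewrite e b.
by rewrite -E subKn// b.
Qed.

Lemma majorant_good k x : (k < N)%N -> ~~ bad k x -> majorant k x =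
    5 / 4 * (majorant k.+1 x + majorant k.+1 (x + unitc N k)) +
    5 * lam * (2 ^- k * mass k (fun a => g a * c k a) x).
Proof.
move=> kN b; rewrite /majorant -subnSK//=.
by rewrite subnSK// subKn ?(ltnW kN)// (negbTE b).
Qed.

Lemma majorant_top x : ~~ bad N x -> majorant N x = 0.
Proof. by move=> b; rewrite /majorant subnn /= subn0 (negbTE b). Qed.

Lemma mass_gc_ge0 k x : 0 <= mass k (fun a => g a * c k a) x.
Proof. by apply: mass_ge0 => a; rewrite mulr_ge0. Qed.

Lemma majorant_ge0 k x : 0 <= majorant k x.
Proof.
rewrite /majorant; elim: (N - k)%N x => [|m IH] x /=; case: ifP => _ //.
- by rewrite exprn_ge0// mass_ge0.
- by rewrite exprn_ge0// mass_ge0.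
- have := IH x; have := IH (x + unitc N (N - m.+1)).
  have : 0 <= 5 * lam * (2 ^- (N - m.+1) *
      mass (N - m.+1) (fun a => g a * c (N - m.+1)%N a) x).
    apply: mulr_ge0; first by rewrite mulr_ge0// ltW.
    by apply: mulr_ge0; [rewrite invr_ge0 exprn_ge0|exact: mass_gc_ge0].
  lra.
Qed.

Section Functional.
Variables (n : nat) (th : nat -> cube N -> R).
Hypothesis nN : (n <= N)%N.
Hypothesis th_mass : forall k x, (k <= n)%N -> th k x <= mass k g x ^+ 2.
Hypothesis th_split : forall k x, (k < n)%N ->
  th k x <= 5 / 4 * (th k.+1 x + th k.+1 (x + unitc N k)) +
   5 * (mass k g x * mass k (fun a => g a * ((3 / 4) ^+ (n - k) + c k a)) x).

(** Downward induction on the level. On a good interval [mass k g x <= lam * 2 ^- k], so the part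
    [(3 / 4) ^+ (n - k)] of the error becomes [3 ^+ (n - k) / 4 ^+ n * lam ^+ 2]. The accumulated
    error is only multiplied by [2 * (5 / 4)], below 3, and the difference absorbs the new one:
    [60 * (5 / 2) + 15 <= 60 * 3]. *)
Lemma functional_majorant k x : (k <= n)%N ->
  th k x <= majorant k x + 60 * (3 ^+ (n - k) / 4 ^+ n) * lam ^+ 2.
Proof.
move=> kn; rewrite -(subKn kn); have : (n - k <= n)%N by rewrite leq_subr.
elim: (n - k)%N x => [|m IH] x; [move=> _|move=> mn] => {kn}.
  rewrite subn0 subnn expr0 mul1r.
  have nn : 0 <= lam ^+ 2 / 4 ^+ n by rewrite divr_ge0 ?exprn_ge0// ltW.
  apply: (le_trans (th_mass x (leqnn n))).
  case b : (bad n x).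
    rewrite majorant_bad// lerDl.
    by rewrite -mulrA mulr_ge0// mulrC.
  have h := good_mass (negbT b).
  have h2 : mass n g x ^+ 2 <= (lam * 2 ^- n) ^+ 2.
    by rewrite ler_sqr ?nnegrE; [|exact: mass_ge0|by rewrite mulr_ge0 ?invr_ge0 ?exprn_ge0 ?ltW].
  apply: (le_trans h2); rewrite exprMn exprVn -exprM mulnC exprM.
  rewrite (_ : 2 ^+ 2 = 4 :> R); last by rewrite expr2 -natrM.
  have := majorant_ge0 n x; rewrite -mulrA [(4 ^+ n)^-1 * _]mulrC; lra.
clear k; set k := (n - m.+1)%N; have kn : (k < n)%N by rewrite /k; lia.
have ek : (n - k = m.+1)%N by rewrite /k; lia.
have ek1 : (n - m = k.+1)%N by rewrite /k; lia.
have kN := leq_trans kn nN.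
have L0 : 0 <= lam ^+ 2 by rewrite exprn_ge0// ltW.
case b : (bad k x).
  apply: (le_trans (th_mass x (ltnW kn))).
  rewrite majorant_bad// ?(ltnW kN)// lerDl.
  by apply: mulr_ge0 => //; rewrite mulr_ge0// divr_ge0// exprn_ge0.
apply: (le_trans (th_split x kn)).
rewrite majorant_good ?b// ek.
have := IH x (ltnW mn); have := IH (x + unitc N k) (ltnW mn).
rewrite ek1 (_ : n - k.+1 = m)%N; last by lia.
set t1 := th _ _; set t2 := th _ _; set v1 := majorant _ _; set v2 := majorant _ _.
move=> i1 i2.
have A0 : 0 <= mass k g x by exact: mass_ge0.
have A1 := good_mass (negbT b).
have -> : mass k (fun a => g a * ((3 / 4) ^+ m.+1 + c k a)) x =
   (3 / 4) ^+ m.+1 * mass k g x + mass k (fun a => g a * c k a) x.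
  by rewrite -massZ -massD; congr (_ * _); apply: eq_bigr => a _; ring.
have G0 := mass_gc_ge0 k x.
set G := mass k (fun a => g a * c k a) x in G0 *; set A := mass k g x in A0 A1 *.
have AG : A * G <= lam * (2 ^- k * G) by rewrite [leRHS]mulrA ler_wpM2r.
have AA : A ^+ 2 <= (lam * 2 ^- k) ^+ 2.
  by rewrite ler_sqr ?nnegrE; [|exact: mass_ge0|by rewrite mulr_ge0 ?invr_ge0 ?exprn_ge0 ?ltW].
have AA' : (3 / 4) ^+ m.+1 * A ^+ 2 <= 3 ^+ m.+1 / 4 ^+ n * lam ^+ 2.
  apply: le_trans (_ : (3 / 4) ^+ m.+1 * (lam * 2 ^- k) ^+ 2 <= _).
    by apply: ler_wpM2l => //; rewrite exprn_ge0//; lra.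
  rewrite [(lam * _) ^+ 2]exprMn exprVn -exprM [(k * 2)%N]mulnC exprM expr_div_n.
  rewrite (_ : 2 ^+ 2 = 4 :> R); last by rewrite expr2 -natrM.
  rewrite (_ : 4 ^+ n = 4 ^+ m.+1 * 4 ^+ k); last by rewrite -exprD -ek subnK// ltnW.
  rewrite invfM le_eqVlt; apply/orP; left; apply/eqP; ring.
have q0 : 0 <= 3 ^+ m / 4 ^+ n * lam ^+ 2.
  by apply: mulr_ge0 => //; rewrite divr_ge0// exprn_ge0.
rewrite [3 ^+ m.+1]exprS in AA' *.
set q := 3 ^+ m / 4 ^+ n * lam ^+ 2 in q0.
have e1 : 60 * (3 ^+ m / 4 ^+ n) * lam ^+ 2 = 60 * q by rewrite /q; ring.
have e2 : 60 * (3 * 3 ^+ m / 4 ^+ n) * lam ^+ 2 = 180 * q by rewrite /q; ring.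
have e3 : 3 * 3 ^+ m / 4 ^+ n * lam ^+ 2 = 3 * q by rewrite /q; ring.
rewrite e1 in i1 i2; rewrite e2; rewrite e3 in AA'.
rewrite (_ : A * (_ + G) = (3 / 4) ^+ m.+1 * A ^+ 2 + A * G); last by ring.
lra.
Qed.

End Functional.

Lemma first_bad_add l k x : (l <= N)%N -> (l <= k)%N ->
  first_bad l (x + unitc N k) = first_bad l x.
Proof.
move=> lN lk; rewrite /first_bad !bad_add// shell_unitc_ge//.
- exact: leq_trans (leq_pred _) lN.
- exact: leq_trans (leq_pred _) lk.
Qed.

(** The hypothesis makes [psi] constant on intervals of level [l]; below that level the two terms of
    [mass_split] have equal sums against [psi]. *)
Lemma sum_level_mass (psi : cube N -> R) l U : (l <= U)%N -> (U <= N)%N ->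
  (forall k x, (l <= k)%N -> psi (x + unitc N k) = psi x) ->
  \sum_x psi x * mass U g x = 2 ^- (U - l) * \sum_x psi x * mass l g x.
Proof.
move=> lU UN hpsi; rewrite -(subnKC lU); move: (subnKC lU) => e.
have : (l + (U - l) <= N)%N by rewrite e.
rewrite {e UN lU}; elim: (U - l)%N => [|d IH] dN.
  by rewrite addn0 subnn expr0 invr1 mul1r.
have dN' : (l + d < N)%N by rewrite -addnS.
have := IH (ltnW dN'); rewrite !addKn => IH'.
have e : \sum_x psi x * mass (l + d) g x = 2 * \sum_x psi x * mass (l + d.+1) g x.
  under eq_bigr do rewrite mass_split// mulrDr.
  rewrite big_split /= -addnS [X in _ + X](_ : _ = \sum_x psi x * mass (l + d.+1) g x).
    by ring.
  rewrite [RHS](reindex_inj (addIr (unitc N (l + d)))) /=.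
  by apply: eq_bigr => x _; rewrite hpsi// leq_addr.
by rewrite exprS invfM -mulrA -IH' e mulKf// pnatr_eq0.
Qed.

Let first_sum l U := \sum_x (first_bad l x)%:R * mass U g x ^+ 2.

(** One factor of the square is bounded by its value at level [l], the other gains [2 ^- (U - l)]
    through [sum_level_mass]. Mass concentrated at one point of a bad interval shows that the square
    gains no more. *)
Lemma first_sum_le l U : (l <= U)%N -> (U <= N)%N ->
  first_sum l U <= 2 ^- (U - l) * first_sum l l.
Proof.
move=> lU UN; have lN := leq_trans lU UN.
have -> : first_sum l l = \sum_x ((first_bad l x)%:R * mass l g x) * mass l g x.
  by apply: eq_bigr => x _; rewrite expr2 mulrA.
rewrite -(sum_level_mass lU UN) => [|k x lk]; last first.
  by rewrite first_bad_add// mass_add// shell_unitc_ge.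
apply: ler_sum => x _; rewrite -mulrA ler_wpM2l// expr2.
by rewrite ler_wpM2r ?mass_mono// mass_ge0.
Qed.

Lemma bad_first_bad x : (bad N x)%:R = \sum_(l < N.+1) (first_bad l x)%:R :> R.
Proof.
case b : (bad N x); last first.
  rewrite big1// => l _; case f : (first_bad l x) => //.
  by move: f => /andP[/(badS (ltn_ord l : (l <= N)%N))]; rewrite b.
have [l lN fl] := first_badP b.
rewrite (bigD1 (Ordinal (lN : (l < N.+1)%N))) //= fl big1 ?addr0// => k kl.
case f : (first_bad k x) => //; move: kl.
by rewrite -val_eqE /= (first_bad_uniq f fl) eqxx.
Qed.

Lemma sum_first_bad :
  \sum_(l < N.+1) \sum_x (first_bad l x)%:R = \sum_x (bad N x)%:R :> R.
Proof. by rewrite exchange_big; apply: eq_bigr => x _; rewrite bad_first_bad. Qed.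

(** Weak type bound of the dyadic maximal function: the bad set is the disjoint union of the maximal
    bad intervals, and over each of them the average of [g] exceeds [lam]. *)
Lemma sum_bad : lam * \sum_x (bad N x)%:R <= \sum_x g x.
Proof.
apply: le_trans (_ : \sum_(l < N.+1) \sum_x (first_bad l x)%:R * g x <= _); last first.
  rewrite exchange_big /=; apply: ler_sum => x _.
  by rewrite -mulr_suml -bad_first_bad; case: bad; rewrite ?mul1r ?mul0r.
under eq_bigr => x _ do rewrite bad_first_bad.
rewrite exchange_big /= mulr_sumr; apply: ler_sum => l _.
have lN : (l <= N)%N by rewrite -ltnS.
have -> : \sum_x (first_bad l x)%:R * g x = 2 ^+ l * \sum_x (first_bad l x)%:R * mass l g x.
  transitivity (2 ^+ N * \sum_x (first_bad l x)%:R * mass N g x).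
    rewrite mulr_sumr; apply: eq_bigr => x _.
    by rewrite mass_top mulrCA mulVKf// expf_neq0// pnatr_eq0.
  rewrite (sum_level_mass lN) => [|//|k x lk]; last by rewrite first_bad_add.
  by rewrite mulrA -expfB_cond ?subKn ?pnatr_eq0 ?leq_subr.
rewrite !mulr_sumr; apply: ler_sum => x _.
case f : (first_bad l x); rewrite ?mul0r ?mulr0// mulr1 mul1r.
have [fb _] := andP f; have [k kl h] := badP _ _ fb.
case: (ltngtP k l) kl => // [kl _|<- _]; last exact: ltW.
have : bad l.-1 x by apply/badP; exists k => //; rewrite -ltnS (ltn_predK kl).
move: f => /andP[_ /orP[/eqP l0|/negbTE ->//]].
by move: kl; rewrite l0.
Qed.

Section NotBad.
Hypothesis good0 : forall x, ~~ bad 0 x.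

(** The parent of a maximal bad interval is good, so the mass is at most [lam * 2 ^- l.-1]; the lost
    factor 2 becomes 4 when squared. Level 0, which has no parent, is excluded by [good0]. *)
Lemma first_sum_top l : (l <= N)%N ->
  4 ^+ l * first_sum l l <= 4 * lam ^+ 2 * \sum_x (first_bad l x)%:R.
Proof.
move=> lN; rewrite !mulr_sumr; apply: ler_sum => x _.
case f : (first_bad l x); rewrite ?mul0r ?mulr0// mul1r mulr1.
move: f => /andP[b]; case: l lN b => [|l] lN b /=; first by rewrite (negbTE (good0 x)) in b.
move=> gl; have h := le_trans (mass_mono x (leqnSn l) lN) (good_mass gl).
have h2 : mass l.+1 g x ^+ 2 <= (lam * 2 ^- l) ^+ 2.
  by rewrite ler_sqr ?nnegrE; [|exact: mass_ge0|by rewrite mulr_ge0 ?invr_ge0 ?exprn_ge0 ?ltW].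
apply: le_trans (_ : 4 ^+ l.+1 * (lam * 2 ^- l) ^+ 2 <= _).
  by apply: ler_wpM2l => //; rewrite exprn_ge0.
rewrite [(lam * _) ^+ 2]exprMn exprVn -exprM [(l * 2)%N]mulnC exprM.
rewrite (_ : 2 ^+ 2 = 4 :> R); last by rewrite expr2 -natrM.
by rewrite exprS mulrCA mulfK ?expf_neq0 ?pnatr_eq0// mulrC.
Qed.

Let good_sum k := \sum_x (~~ bad k x)%:R * majorant k x.

(** Each half of a good interval is either good or maximal bad, and summed over all [x] the two
    halves agree, whence [5 / 2 = 2 * (5 / 4)]. *)
Lemma good_sum_rec k : (k < N)%N ->
  good_sum k <= 5 / 2 * (good_sum k.+1 + first_sum k.+1 k.+1) +
    5 * lam * (4 ^- k * \sum_x g x * c k x).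
Proof.
move=> kN; pose f x := (~~ bad k x)%:R * majorant k.+1 x.
have fle : \sum_x f x <= good_sum k.+1 + first_sum k.+1 k.+1.
  rewrite -big_split; apply: ler_sum => x _; rewrite /f /=.
  have m0 := majorant_ge0 k.+1 x; have M0 : 0 <= mass k.+1 g x ^+ 2 by rewrite sqr_ge0.
  case b : (bad k x); first by rewrite mul0r addr_ge0// mulr_ge0.
  case b' : (bad k.+1 x); rewrite /first_bad b' /= ?b ?mul1r ?mul0r ?add0r ?addr0//.
  by rewrite majorant_bad.
have -> : 4 ^- k * \sum_x g x * c k x = 2 ^- k * \sum_x mass k (fun a => g a * c k a) x.
  rewrite sum_mass ?(ltnW kN)// mulrA -invfM -exprMn; congr ((_ ^+ _)^-1 * _).
  by rewrite -natrM.
apply: le_trans (_ : 5 / 4 * (\sum_x f x + \sum_x f (x + unitc N k)) + 5 * lam * (2 ^- k * \sum_x mass k (fun a => g a * c k a) x) <= _).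
  rewrite -big_split !mulr_sumr -big_split; apply: ler_sum => x _ /=.
  rewrite /f bad_add ?shell_unitc ?(ltnW kN)// -mulrDr.
  case b : (bad k x); last by rewrite majorant_good ?b// !mul1r.
  rewrite !mul0r mulr0 add0r; apply: mulr_ge0; first by rewrite mulr_ge0// ltW.
  by apply: mulr_ge0; [rewrite invr_ge0 exprn_ge0|exact: mass_gc_ge0].
have -> : \sum_x f (x + unitc N k) = \sum_x f x.
  by rewrite [RHS](reindex_inj (addIr (unitc N k))).
rewrite lerD2r; lra.
Qed.

(** Multiplied by [4 ^+ k], the recursion has ratio [5 / 2 / 4 = 5 / 8], so the sum is absorbed into
    the left side at the cost of [(1 - 5 / 8)^-1 = 8 / 3]. *)
Lemma good_sum_total : \sum_(k < N.+1) 4 ^+ k * good_sum k <=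
  8 / 3 * (5 / 2 * lam ^+ 2 * (\sum_x (bad N x)%:R) +
           5 * lam * \sum_(k < N) \sum_x g x * c k x).
Proof.
have gN : good_sum N = 0.
  apply: big1 => x _; case b : (bad N x); rewrite ?mul0r//.
  by rewrite majorant_top ?b// mulr0.
have g0 k : 0 <= 4 ^+ k * good_sum k.
  apply: mulr_ge0; rewrite ?exprn_ge0//; apply: sumr_ge0 => x _.
  by apply: mulr_ge0 => //; exact: majorant_ge0.
rewrite big_ord_recr /= gN mulr0 addr0.
set T := \sum_(k < N) _.
have shiftT : \sum_(k < N) 4 ^+ k.+1 * good_sum k.+1 <= T.
  have : \sum_(k < N.+1) 4 ^+ k * good_sum k = T by rewrite big_ord_recr /= gN mulr0 addr0.
  by rewrite big_ord_recl /= => <-; rewrite lerDr.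
have shiftZ : \sum_(k < N) 4 ^+ k.+1 * first_sum k.+1 k.+1 <=
    4 * lam ^+ 2 * \sum_x (bad N x)%:R.
  apply: le_trans (_ : 4 * lam ^+ 2 * \sum_(l < N.+1) \sum_x (first_bad l x)%:R <= _).
    rewrite big_ord_recl mulrDr /= -[leLHS]add0r; apply: lerD.
      by apply: mulr_ge0; [rewrite mulr_ge0 ?sqr_ge0|exact: sumr_ge0].
    by rewrite mulr_sumr; apply: ler_sum => k _; exact: first_sum_top.
  by rewrite sum_first_bad.
have : T <= 5 / 8 * (\sum_(k < N) 4 ^+ k.+1 * good_sum k.+1 +
     \sum_(k < N) 4 ^+ k.+1 * first_sum k.+1 k.+1) +
     5 * lam * \sum_(k < N) \sum_x g x * c k x.
  rewrite -big_split !mulr_sumr -big_split; apply: ler_sum => k _ /=.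
  apply: le_trans (_ : 4 ^+ k * (5 / 2 * (good_sum k.+1 + first_sum k.+1 k.+1) +
    5 * lam * (4 ^- k * \sum_x g x * c k x)) <= _).
    by apply: ler_wpM2l; rewrite ?exprn_ge0//; exact: good_sum_rec.
  rewrite mulrDr [X in _ + X <= _](_ : _ = 5 * lam * \sum_x g x * c k x); last first.
    by rewrite mulrCA mulVKf// expf_neq0// pnatr_eq0.
  by rewrite lerD2r exprS le_eqVlt; apply/orP; left; apply/eqP; field.
lra.
Qed.

(** At a shifted point that is good, the total weight [4 ^+ U] and [good_sum_total] apply. At a bad
    one the majorant is a squared mass, attributed in [bm] to the level [l] at which the point first
    turns bad; only indices [i <= l] can occur there. *)
Lemma sum_majorant :
  \sum_x (~~ bad N x)%:R * \sum_(U < N.+1)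
     wsum U (fun i j => majorant U (x + shift N i + shift N j)) <=
  300 * (lam ^+ 2 * \sum_x (bad N x)%:R + lam * \sum_(k < N) \sum_x g x * c k x).
Proof.
pose gm U x := (~~ bad U x)%:R * majorant U x.
pose bm U i x := \sum_(l < U.+1) ((i <= l)%N)%:R * ((first_bad l x)%:R * mass U g x ^+ 2).
have gm0 U x : 0 <= gm U x by apply: mulr_ge0 => //; exact: majorant_ge0.
have bm0 U i x : 0 <= bm U i x.
  by apply: sumr_ge0 => l _; rewrite mulr_ge0// mulr_ge0// sqr_ge0.
apply: le_trans (_ : \sum_x \sum_(U < N.+1) wsum U (fun i j =>
    gm U (x + shift N i + shift N j) + bm U i (x + shift N i + shift N j)) <= _).
  apply: ler_sum => x _; case bx : (bad N x).
    by rewrite mul0r; apply: sumr_ge0 => U _; apply: wsum_ge0 => i j; rewrite addr_ge0.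
  rewrite mul1r; apply: ler_sum => U _; apply: ler_wsum => i j ij _.
  set x' := x + shift N i + shift N j; rewrite /gm.
  have UN : (U <= N)%N by rewrite -ltnS ltn_ord.
  case b : (bad U x'); last by rewrite mul1r lerDl.
  rewrite mul0r add0r majorant_bad//.
  have [l lU fl] := first_badP b.
  rewrite /bm (bigD1 (Ordinal (lU : (l < U.+1)%N))) //= fl mul1r.
  case: (leqP i l) => il.
    rewrite mul1r lerDl; apply: sumr_ge0 => k _.
    by rewrite mulr_ge0// mulr_ge0// sqr_ge0.
  (* Here [l < i <= j], so neither shift leaves the interval of level [l], and [x] itself would be
     bad. *)
  have : bad l x.
    move: (fl) => /andP[bl _]; rewrite -(bad_near (x := x')) // /x'.
    rewrite addrC -[x + _ + _]addrA addcK.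
    by rewrite shellD ?shell_shift ?(leq_trans lU) ?(leq_trans il).
  by move=> /(badS (leq_trans lU UN)); rewrite bx.
rewrite exchange_big /=.
have -> : \sum_(U < N.+1) \sum_x wsum U (fun i j =>
     gm U (x + shift N i + shift N j) + bm U i (x + shift N i + shift N j)) =
  \sum_(U < N.+1) (good_sum U * wsum U (fun _ _ => 1) +
     \sum_(l < U.+1) wsum U (fun i _ => ((i <= l)%N)%:R) * first_sum l U).
  apply: eq_bigr => U _; rewrite sum_wsum.
  under [X in _ = _ + X]eq_bigr do rewrite mulrC -wsumZ.
  rewrite sum_wsum -wsumZ -wsumD; apply: eq_bigr => i _; apply: eq_bigr => j _.
  congr (_ * _); rewrite big_split /= mulr1; congr (_ + _).
    rewrite [RHS](reindex_inj (addIr (shift N i + shift N j))) /=.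
    by apply: eq_bigr => x _; rewrite addrA.
  rewrite exchange_big /=; apply: eq_bigr => l _.
  rewrite /first_sum mulr_suml.
  rewrite [RHS](reindex_inj (addIr (shift N i + shift N j))) /=.
  by apply: eq_bigr => x _; rewrite addrA mulrC.
rewrite big_split /=.
have h1 : \sum_(U < N.+1) good_sum U * wsum U (fun _ _ => 1) <=
    22 * \sum_(U < N.+1) 4 ^+ U * good_sum U.
  rewrite mulr_sumr; apply: ler_sum => U _.
  rewrite [leRHS](_ : _ = good_sum U * (22 * 4 ^+ U)); last by ring.
  by apply: ler_wpM2l; [apply: sumr_ge0 => x _; exact: gm0|exact: wsum1_le4].
have f0 l : 0 <= first_sum l l.
  by apply: sumr_ge0 => x _; apply: mulr_ge0 => //; rewrite sqr_ge0.
have h2 : \sum_(U < N.+1) \sum_(l < U.+1) wsum U (fun i _ => ((i <= l)%N)%:R) * first_sum l U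
    <= 32 * \sum_(l < N.+1) 4 ^+ l * first_sum l l.
  (* The factor [(3 / 4) ^+ U * (4 / 3) ^+ l] combines the weight of the indices [i <= l] with the
     decay from [first_sum_le]; it is summable over [U >= l]. *)
  apply: le_trans (_ : \sum_(U < N.+1) \sum_(l < N.+1 | (l <= U)%N)
      8 * ((3 / 4) ^+ U * ((4 / 3) ^+ l * (4 ^+ l * first_sum l l))) <= _).
    apply: ler_sum => U _.
    rewrite (big_ord_widen N.+1 (fun l => wsum U (fun i _ => ((i <= l)%N)%:R) * first_sum l U)) ?ltn_ord//.
    apply: ler_sum => l; rewrite ltnS => lU.
    have UN : (U <= N)%N by rewrite -ltnS ltn_ord.
    have w := @wsum1_le R l U (fun i => i <= l)%N (fun i h => h).
    apply: le_trans (_ : 8 * ((3 / 2) ^+ U * (8 / 3) ^+ l) * (2 ^- (U - l) * first_sum l l) <= _).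
      apply: ler_pM => //; last exact: first_sum_le.
        by apply: wsum_ge0.
      by apply: sumr_ge0 => x _; apply: mulr_ge0 => //; rewrite sqr_ge0.
    rewrite le_eqVlt; apply/orP; left; apply/eqP.
    have -> : (3 / 4) ^+ U = (3 / 2) ^+ U * 2 ^- U :> R.
      by rewrite -exprVn -exprMn; congr (_ ^+ _); field.
    have -> : 2 ^- (U - l) = 2 ^- U * 2 ^+ l :> R.
      by rewrite -[in RHS](subnK lU) exprD invfM mulfVK// expf_neq0// pnatr_eq0.
    have e : (8 / 3) ^+ l * 2 ^+ l = 4 ^+ l * (4 / 3) ^+ l :> R.
      by rewrite -!exprMn; congr (_ ^+ _); field.
    rewrite (_ : 8 * _ * _ = 8 * ((3 / 2) ^+ U * 2 ^- U) * ((8 / 3) ^+ l * 2 ^+ l) * first_sum l l).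
      by rewrite e; ring.
    by ring.
  rewrite (exchange_big_dep predT)//= mulr_sumr; apply: ler_sum => l _.
  rewrite -mulr_sumr -mulr_suml.
  have t0 : 0 <= 4 ^+ l * first_sum l l by rewrite mulr_ge0 ?exprn_ge0.
  have q : ((0 : R) <= 3 / 4) && ((3 / 4 : R) < 1) by apply/andP; split; lra.
  have := sum_geometric_tail l N.+1 q.
  rewrite (_ : (1 - 3 / 4)^-1 = 4 :> R); last by field.
  set s := \sum_(_ < _ | _) _ => sl.
  apply: le_trans (_ : 8 * ((3 / 4) ^+ l * 4 * ((4 / 3) ^+ l * (4 ^+ l * first_sum l l))) <= _).
    rewrite ler_pM2l//; apply: ler_wpM2r; last exact: sl.
    by apply: mulr_ge0; [rewrite exprn_ge0//; lra|exact: t0].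
  have e : (3 / 4) ^+ l * (4 / 3) ^+ l = 1 :> R.
    by rewrite -exprMn (_ : 3 / 4 * (4 / 3) = 1 :> R) ?expr1n//; field.
  rewrite le_eqVlt; apply/orP; left; apply/eqP.
  transitivity (32 * ((3 / 4) ^+ l * (4 / 3) ^+ l) * (4 ^+ l * first_sum l l)); first by ring.
  by rewrite e mulr1.
have h3 : \sum_(l < N.+1) 4 ^+ l * first_sum l l <= 4 * lam ^+ 2 * \sum_x (bad N x)%:R.
  apply: le_trans (_ : 4 * lam ^+ 2 * \sum_(l < N.+1) \sum_x (first_bad l x)%:R <= _).
    by rewrite mulr_sumr; apply: ler_sum => l _; apply: first_sum_top; rewrite -ltnS.
  by rewrite sum_first_bad.
have h4 := good_sum_total.
have p1 : 0 <= lam ^+ 2 * \sum_x (bad N x)%:R by apply: mulr_ge0; rewrite ?sqr_ge0 ?sumr_ge0.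
have p2 : 0 <= lam * \sum_(k < N) \sum_x g x * c k x.
  apply: mulr_ge0; first exact: ltW.
  by apply: sumr_ge0 => k _; apply: sumr_ge0 => x _; rewrite mulr_ge0.
(* The constant 300 exceeds both [22 * (8 / 3) * (5 / 2) + 32 * 4] and [22 * (8 / 3) * 5]. *)
move: h1 h2 h3 h4 p1 p2; lra.
Qed.

End NotBad.
End CalderonZygmund.

Section Covering.
Variables (R : realFieldType) (N : nat) (g : cube N -> R).
Variables (c : nat -> cube N -> R) (lam : R).

Definition profile U (x : cube N) : R :=
  wsum U (fun i j => majorant g c lam U (x + shift N i + shift N j)).

Definition exceptional (x : cube N) : bool :=
  bad g lam N x || (lam ^+ 2 < \sum_(U < N.+1) profile U x).

Hypotheses (g_ge0 : forall a, 0 <= g a) (c_ge0 : forall k a, 0 <= c k a).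
Hypothesis lam_gt0 : 0 < lam.

Lemma profile_ge0 U x : 0 <= profile U x.
Proof. by apply: wsum_ge0 => i j; exact: majorant_ge0. Qed.

(** Off the bad set, Chebyshev's inequality applied to [sum_majorant]; the bad set itself accounts
    for the step from 300 to 301. *)
Lemma sum_exceptional :
  \sum_x (exceptional x)%:R <=
  301 * (\sum_x (bad g lam N x)%:R + lam^-1 * \sum_(k < N) \sum_x g x * c k x).
Proof.
have S0 : 0 <= lam^-1 * \sum_(k < N) \sum_x g x * c k x.
  apply: mulr_ge0; first by rewrite invr_ge0 ltW.
  by apply: sumr_ge0 => k _; apply: sumr_ge0 => x _; rewrite mulr_ge0.
have B0 : 0 <= \sum_x (bad g lam N x)%:R :> R by apply: sumr_ge0.
(* The interval of level 0 is the whole group: if it is bad, every point is bad and the bound is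
   trivial. Otherwise [good0] is available. *)
case: (boolP [exists x, bad g lam 0 x]) => [/existsP[x0 b0]|/existsPn good0].
  apply: le_trans (_ : \sum_x (bad g lam N x)%:R <= _); last lra.
  apply: ler_sum => x _; rewrite (badS (leq0n N))//.
    by case: exceptional.
  by rewrite (bad_near g lam (y := x0)).
have sm := sum_majorant g_ge0 c_ge0 lam_gt0 good0.
have L2 : 0 < lam ^+ 2 by rewrite exprn_gt0.
apply: le_trans (_ : \sum_x (bad g lam N x)%:R + lam ^- 2 * \sum_x (~~ bad g lam N x)%:R *
  (\sum_(U < N.+1) profile U x) <= _).
  rewrite mulr_sumr -big_split; apply: ler_sum => x _; rewrite /exceptional /=.
  have p0 : 0 <= \sum_(U < N.+1) profile U x.
    by apply: sumr_ge0 => U _; exact: profile_ge0.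
  case: (bad g lam N x) => /=; first by rewrite mul0r mulr0 addr0.
  rewrite mul1r add0r; case: ltP => h; last by rewrite mulr_ge0 ?invr_ge0 ?(ltW L2).
  by rewrite mulrC ler_pdivlMr// mul1r ltW.
apply: le_trans (_ : \sum_x (bad g lam N x)%:R + lam ^- 2 * (300 * (lam ^+ 2 *
  \sum_x (bad g lam N x)%:R + lam * \sum_(k < N) \sum_x g x * c k x)) <= _).
  by rewrite lerD2l ler_wpM2l// invr_ge0 ltW.
rewrite (_ : lam ^- 2 * _ = 300 * (\sum_x (bad g lam N x)%:R +
    lam^-1 * \sum_(k < N) \sum_x g x * c k x)); last by field; exact: lt0r_neq0.
lra.
Qed.

Lemma exceptionalPn x : ~~ exceptional x ->
  ~~ bad g lam N x /\ \sum_(U < N.+1) profile U x <= lam ^+ 2.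
Proof. by rewrite /exceptional negb_or -leNgt => /andP. Qed.

(** The weight [22 * 4 ^+ U] turns the error [60 * 3 ^+ (n - U) / 4 ^+ n] into
    [1320 * (3 / 4) ^+ (n - U)], whose sum over [U] is bounded uniformly in [n]. *)
Lemma functional_profile (n : nat) (th : nat -> cube N -> R) : (n <= N)%N ->
  (forall k x, (k <= n)%N -> th k x <= mass k g x ^+ 2) ->
  (forall k x, (k < n)%N ->
     th k x <= 5 / 4 * (th k.+1 x + th k.+1 (x + unitc N k)) +
     5 * (mass k g x * mass k (fun a => g a * ((3 / 4) ^+ (n - k) + c k a)) x)) ->
  forall U x, (U <= n)%N ->
  wsum U (fun i j => th U (x + shift N i + shift N j)) <=
  profile U x + 1320 * ((3 / 4) ^+ (n - U) * lam ^+ 2).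
Proof.
move=> nN h1 h3 U x Un.
apply: le_trans (_ : wsum U (fun i j => majorant g c lam U (x + shift N i + shift N j)
   + 60 * (3 ^+ (n - U) / 4 ^+ n) * lam ^+ 2 * 1) <= _).
  by apply: ler_wsum => i j _ _; rewrite mulr1; exact: functional_majorant.
rewrite wsumD wsumZ lerD2l.
apply: le_trans (_ : 60 * (3 ^+ (n - U) / 4 ^+ n) * lam ^+ 2 * (22 * 4 ^+ U) <= _).
  apply: ler_wpM2l; last exact: wsum1_le4.
  by apply: mulr_ge0; rewrite ?sqr_ge0// mulr_ge0// divr_ge0// exprn_ge0.
rewrite expr_div_n -[in 4 ^+ n](subnK Un) exprD le_eqVlt; apply/orP; left; apply/eqP.
by field; rewrite !expf_neq0 ?pnatr_eq0.
Qed.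

Lemma sum_geometric34 n : \sum_(U < n.+1) (3 / 4) ^+ (n - U) <= 4 :> R.
Proof.
rewrite (reindex_inj rev_ord_inj) /=.
under eq_bigr => i _ do rewrite subSS subKn -1?ltnS ?ltn_ord//.
have h : ((0 : R) <= 3 / 4) && ((3 / 4 : R) < 1) by apply/andP; split; lra.
have := sum_geometric_tail 0 n.+1 h.
by rewrite expr0 mul1r (_ : (1 - 3 / 4)^-1 = 4 :> R)//; field.
Qed.

(** [exceptional] involves neither [n] nor [th], so a single set serves all functionals at all
    resolutions [n <= N]. *)
Lemma functional_total (n : nat) (th : nat -> cube N -> R) : (n <= N)%N ->
  (forall k x, (k <= n)%N -> th k x <= mass k g x ^+ 2) ->
  (forall k x, (k < n)%N ->
     th k x <= 5 / 4 * (th k.+1 x + th k.+1 (x + unitc N k)) +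
     5 * (mass k g x * mass k (fun a => g a * ((3 / 4) ^+ (n - k) + c k a)) x)) ->
  forall x, ~~ exceptional x ->
  \sum_(U < n.+1) wsum U (fun i j => th U (x + shift N i + shift N j)) <=
  4 * 1321 * lam ^+ 2.
Proof.
move=> nN h1 h3 x /exceptionalPn[_ ex].
apply: le_trans (_ : \sum_(U < n.+1) (profile U x + 1320 * ((3 / 4) ^+ (n - U) * lam ^+ 2)) <= _).
  by apply: ler_sum => U _; apply: functional_profile => //; rewrite -ltnS.
rewrite big_split /= -mulr_sumr -mulr_suml.
have L0 : 0 <= lam ^+ 2 by rewrite sqr_ge0.
have g4 := ler_wpM2r L0 (sum_geometric34 n).
have : \sum_(U < n.+1) profile U x <= lam ^+ 2.
  apply: le_trans ex; rewrite (big_ord_widen N.+1 (fun U => profile U x))//.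
  rewrite big_mkcond; apply: ler_sum => U _; case: ifP => // _.
  exact: profile_ge0.
move: g4; lra.
Qed.

End Covering.

(** * Square sums over shifts by the Cauchy-Schwarz inequality *)

Section CauchySchwarz.
Variable R : realFieldType.

(** Cauchy-Schwarz without square roots: after expansion, [2 * (B i * B j) <= G i * H j + G j * H i]
    is obtained by comparing squares. *)
Lemma sqr_sum_le (I : finType) (P : pred I) (B G H : I -> R) :
  (forall i, P i -> 0 <= G i) -> (forall i, P i -> 0 <= H i) ->
  (forall i, P i -> B i ^+ 2 <= G i * H i) ->
  (\sum_(i | P i) B i) ^+ 2 <= (\sum_(i | P i) G i) * (\sum_(i | P i) H i).
Proof.
move=> G0 H0 BGH.
suff : 2 * (\sum_(i | P i) B i) ^+ 2 <=
       2 * ((\sum_(i | P i) G i) * (\sum_(i | P i) H i)) by rewrite ler_pM2l.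
have -> : 2 * (\sum_(i | P i) B i) ^+ 2 = \sum_(i | P i) \sum_(j | P j) 2 * (B i * B j).
  rewrite expr2 big_distrlr mulr_sumr; apply: eq_bigr => i _.
  by rewrite mulr_sumr.
have -> : 2 * ((\sum_(i | P i) G i) * (\sum_(i | P i) H i)) =
    \sum_(i | P i) \sum_(j | P j) (G i * H j + G j * H i).
  rewrite mulr_natl mulr2n big_distrlr /= [X in _ + X]exchange_big -big_split.
  by apply: eq_bigr => i _; rewrite -big_split.
apply: ler_sum => i Pi; apply: ler_sum => j Pj.
have b := BGH _ Pi; have b' := BGH _ Pj.
have g := G0 _ Pi; have g' := G0 _ Pj; have h := H0 _ Pi; have h' := H0 _ Pj.
have s0 : 0 <= G i * H j + G j * H i by rewrite addr_ge0 ?mulr_ge0.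
suff hh : (2 * (B i * B j)) ^+ 2 <= (G i * H j + G j * H i) ^+ 2.
  apply: le_trans (ler_norm _) _.
  by rewrite -[leRHS](ger0_norm s0) -ler_sqr ?nnegrE ?normr_ge0// !real_normK ?num_real.
apply: le_trans (_ : 4 * ((G i * H i) * (G j * H j)) <= _).
  rewrite exprMn exprMn (_ : 2 ^+ 2 = 4 :> R); last by ring.
  by rewrite ler_pM2l// ler_pM// sqr_ge0.
have := sqr_ge0 (G i * H j - G j * H i); lra.
Qed.

(** Cauchy-Schwarz with [4 ^+ i = (6 / 5) ^+ i * (10 / 3) ^+ i] and
    [1 = (5 / 4) ^+ j * (4 / 5) ^+ j]. The sum of [(6 / 5) ^+ i * (5 / 4) ^+ j] over [i <= j] is at
    most [6 * (3 / 2) ^+ j], and the sum over [j] at most [27 * (3 / 2) ^+ U]. *)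
Lemma sqr_wsum_le U (q : nat -> nat -> R) :
  (\sum_(i < U.+2) \sum_(j < U.+2 | (i <= j)%N) 2 ^+ i * q i j) ^+ 2 <=
  27 * wsum U (fun i j => q i j ^+ 2).
Proof.
have p (i j : nat) : 0 <= (6 / 5) ^+ i * (5 / 4) ^+ j :> R.
  by rewrite mulr_ge0// exprn_ge0//; lra.
rewrite !pair_big_dep /=.
apply: le_trans (@sqr_sum_le ('I_U.+2 * 'I_U.+2)%type _ _ (fun p => (6 / 5) ^+ p.1 * (5 / 4) ^+ p.2)
  (fun p => (10 / 3) ^+ p.1 * (4 / 5) ^+ p.2 * q p.1 p.2 ^+ 2) _ _ _) _ => //=.
- by move=> i _; rewrite mulr_ge0 ?sqr_ge0// mulr_ge0// exprn_ge0//; lra.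
- move=> [i j] _ /=; rewrite exprMn le_eqVlt; apply/orP; left; apply/eqP.
  have -> : 2 ^+ i ^+ 2 = (6 / 5) ^+ i * (10 / 3) ^+ i :> R.
    by rewrite -exprM mulnC exprM -exprMn; congr (_ ^+ _); field.
  have e : (5 / 4) ^+ j * (4 / 5) ^+ j = 1 :> R.
    by rewrite -exprMn (_ : 5 / 4 * (4 / 5) = 1 :> R) ?expr1n//; field.
  transitivity ((6 / 5) ^+ i * (10 / 3) ^+ i * ((5 / 4) ^+ j * (4 / 5) ^+ j) * q i j ^+ 2).
    by rewrite e mulr1.
  by ring.
rewrite -(pair_big_dep predT (fun i j : 'I_U.+2 => (i <= j)%N) (fun i j => (6 / 5) ^+ i * (5 / 4) ^+ j)) /=.
rewrite -(pair_big_dep predT (fun i j : 'I_U.+2 => (i <= j)%N) (fun i j => (10 / 3) ^+ i * (4 / 5) ^+ j * q i j ^+ 2)) /=.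
have -> : 27 * wsum U (fun i j => q i j ^+ 2) = (27 * (3 / 2) ^+ U) *
   \sum_(i < U.+2) \sum_(j < U.+2 | (i <= j)%N) (10 / 3) ^+ i * (4 / 5) ^+ j * q i j ^+ 2.
  rewrite -mulrA; congr (_ * _); rewrite mulr_sumr; apply: eq_bigr => i _.
  by rewrite mulr_sumr; apply: eq_bigr => j _; rewrite /weight -!mulrA.
apply: ler_wpM2r.
  apply: sumr_ge0 => i _; apply: sumr_ge0 => j _.
  by rewrite mulr_ge0 ?sqr_ge0// mulr_ge0// exprn_ge0//; lra.
rewrite (exchange_big_dep predT)//=.
apply: le_trans (_ : \sum_(j < U.+2) 6 * (3 / 2) ^+ j <= _).
  apply: ler_sum => j _; rewrite -mulr_suml.
  have h : (1 : R) < 6 / 5 by lra.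
  apply: le_trans (_ : (6 / 5) ^+ j.+1 / (6 / 5 - 1) * (5 / 4) ^+ j <= _).
    apply: ler_wpM2r; first by rewrite exprn_ge0//; lra.
    apply: le_trans (sum_geometric_gt1 j.+1 h).
    rewrite [leRHS](big_ord_widen U.+2 (fun i => (6 / 5) ^+ i)) ?ltn_ord//.
  have e : (6 / 5) ^+ j * (5 / 4) ^+ j = (3 / 2) ^+ j :> R.
    by rewrite -exprMn; congr (_ ^+ _); field.
  rewrite -e exprS le_eqVlt; apply/orP; left; apply/eqP; by field.
rewrite -mulr_sumr; have h : (1 : R) < 3 / 2 by lra.
have := sum_geometric_gt1 U.+2 h; rewrite !exprS.
rewrite (_ : (3 / 2 - 1)^-1 = 2 :> R); last by field.
set s := \sum_(_ < _) _; lra.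
Qed.

Lemma sum_sqr_wsum_le (I : finType) (P : pred I) U (q : I -> nat -> nat -> R)
    (th : nat -> nat -> R) :
  (forall i j, (i <= j)%N -> (j <= U.+1)%N -> \sum_(u | P u) q u i j ^+ 2 <= th i j) ->
  \sum_(u | P u) (\sum_(i < U.+2) \sum_(j < U.+2 | (i <= j)%N) 2 ^+ i * q u i j) ^+ 2 <=
  27 * wsum U th.
Proof.
move=> h; apply: le_trans (_ : \sum_(u | P u) 27 * wsum U (fun i j => q u i j ^+ 2) <= _).
  by apply: ler_sum => u _; exact: (sqr_wsum_le U (q u)).
rewrite -mulr_sumr ler_pM2l// /wsum exchange_big /=; apply: ler_sum => i _.
rewrite exchange_big /=; apply: ler_sum => j ij.
by rewrite -mulr_sumr ler_wpM2l ?weight_ge0// h// -ltnS.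
Qed.

(** A sum over one shift is embedded into the double sum as its entries with [j = U.+1]: in the
    applications the second shift is then by [e_U], which does not leave an interval of level
    [U]. *)
Lemma sum_sqr_schipp_le (I : finType) (P : pred I) U (q : I -> nat -> R)
    (th : nat -> nat -> R) :
  (forall i j, 0 <= th i j) ->
  (forall o, (o <= U.+1)%N -> \sum_(u | P u) q u o ^+ 2 <= th o U.+1) ->
  \sum_(u | P u) (\sum_(o < U.+2) 2 ^+ o * q u o) ^+ 2 <= 27 * wsum U th.
Proof.
move=> th0 h.
rewrite (eq_bigr (fun u => (\sum_(i < U.+2) \sum_(j < U.+2 | (i <= j)%N)
    2 ^+ i * (if j == U.+1 :> nat then q u i else 0)) ^+ 2)) => [|u _].
  apply: (@sum_sqr_wsum_le _ _ U (fun u i j => if j == U.+1 then q u i else 0)).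
  move=> i j ij jU; case: eqP => [e|_]; first by rewrite e h// -e.
  by rewrite big1// => u _; rewrite expr0n.
congr (_ ^+ 2); apply: eq_bigr => i _.
rewrite (bigD1 ord_max) /=; last by rewrite -ltnS ltn_ord.
rewrite eqxx big1 ?addr0// => j /andP[_ jm].
case: eqP => [e|_]; last by rewrite mulr0.
by move: jm; rewrite -val_eqE /= e eqxx.
Qed.

End CauchySchwarz.

(** * Rows *)

Section Projection.
Variables N n : nat.
Implicit Types x y : cube N.

(** Total in [n], with padding by [false], so that no proof of [n <= N] occurs in terms. *)
Definition proj x : cube n :=
  [ffun i : 'I_n => oapp x false (insub (i : nat) : option 'I_N)].

Lemma projD x y : proj (x + y) = proj x + proj y.
Proof. by apply/ffunP => i; rewrite !ffunE; case: insub => //= j; rewrite ffunE. Qed.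

Hypothesis nN : (n <= N)%N.

Lemma projE x (i : 'I_n) : proj x i = x (widen_ord nN i).
Proof.
rewrite ffunE; have iN : (i < N)%N := leq_trans (ltn_ord i) nN.
by rewrite insubT /=; congr (x _); exact: val_inj.
Qed.

Lemma shell_proj k x : (k <= n)%N -> (k <= shell (proj x))%N = (k <= shell x)%N.
Proof.
move=> kn; rewrite !shellE kn (leq_trans kn nN) /=.
apply/forallP/forallP => h i; apply/implyP => ik.
  have := h (Ordinal (leq_trans ik kn)); rewrite projE /= ik /=.
  by congr (~~ x _); exact: val_inj.
by rewrite projE; have := h (widen_ord nN i); rewrite /= ik.
Qed.

Lemma proj_unitc j : proj (unitc N j) = unitc n j.
Proof. by apply/ffunP => i; rewrite projE !ffunE. Qed.

Lemma proj0 : proj 0 = 0.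
Proof. by apply/ffunP => i; rewrite projE !ffunE. Qed.

Lemma proj_shift i : proj (shift N i) = shift n i.
Proof. by case: i => [|j] /=; [exact: proj0|exact: proj_unitc]. Qed.

Lemma ball_proj k x y : (k <= n)%N ->
  (k <= shell (proj x + proj y))%N = (k <= shell (x + y))%N.
Proof. by move=> kn; rewrite -projD shell_proj. Qed.

End Projection.
Arguments proj {N} n x.

Section Pushforward.
Variables (R : realFieldType) (N n : nat).
Hypothesis nN : (n <= N)%N.
Implicit Types (phi : cube N -> R).

(** The mass of [phi] over the interval of level [n] coded by [b]. *)
Definition push phi (b : cube n) : R := 2 ^- N * \sum_(b' | proj n b' == b) phi b'.

Lemma sum_push phi (P : pred (cube n)) :
  \sum_(b | P b) push phi b = 2 ^- N * \sum_(b' | P (proj n b')) phi b'.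
Proof.
rewrite -mulr_sumr; congr (_ * _).
rewrite (exchange_big_dep (fun b' => P (proj n b')))//=; last first.
  by move=> b b' Pb /eqP ->.
apply: eq_bigr => b' Pb'; rewrite (big_pred1 (proj n b'))// => b /=.
by rewrite eq_sym andbC; case: eqP => // ->.
Qed.

Lemma push_ge0 phi b : (forall a, 0 <= phi a) -> 0 <= push phi b.
Proof. by move=> p0; rewrite /push mulr_ge0 ?sumr_ge0// invr_ge0 exprn_ge0. Qed.

Lemma sum_push_ball phi k x : (k <= n)%N ->
  \sum_(b | (k <= shell (proj n x + b))%N) push phi b = mass k phi x.
Proof.
move=> kn; rewrite sum_push; congr (_ * _); apply: eq_bigl => b.
by rewrite ball_proj.
Qed.

Definition energy phi k (x : cube N) : R :=
  \sum_(b : cube n | (k <= shell (proj n x + b))%N) push phi b ^+ 2.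

Lemma sum_sqr_le (I : finType) (P : pred I) (F : I -> R) :
  (forall i, P i -> 0 <= F i) -> \sum_(i | P i) F i ^+ 2 <= (\sum_(i | P i) F i) ^+ 2.
Proof.
move=> F0; rewrite [leRHS]expr2 mulr_suml; apply: ler_sum => i Pi.
rewrite expr2 ler_wpM2l ?F0// (bigD1 i)//= lerDl sumr_ge0// => j /andP[Pj _].
exact: F0.
Qed.

Lemma energy_mass phi k x : (forall a, 0 <= phi a) -> (k <= n)%N ->
  energy phi k x <= mass k phi x ^+ 2.
Proof.
move=> p0 kn; rewrite -sum_push_ball//; apply: sum_sqr_le => b _.
exact: push_ge0.
Qed.

Lemma energy_split phi k x : (k < n)%N ->
  energy phi k x = energy phi k.+1 x + energy phi k.+1 (x + unitc N k).
Proof. by move=> kn; rewrite /energy ball_split// projD proj_unitc. Qed.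

Lemma energy_ge0 phi k x : 0 <= energy phi k x.
Proof. by apply: sumr_ge0 => b _; rewrite sqr_ge0. Qed.

(** [energy] splits without error and with factor 1, so it is a splitting functional with
    [c = 0]. *)
Lemma wsum_energy phi lam : (forall a, 0 <= phi a) -> 0 < lam ->
  forall U x, (U <= n)%N ->
  wsum U (fun i j => energy phi U (x + shift N i + shift N j)) <=
  profile phi (fun _ _ => 0) lam U x + 1320 * ((3 / 4) ^+ (n - U) * lam ^+ 2).
Proof.
move=> p0 l0 U x Un; apply: functional_profile => //.
  by move=> k y kn; exact: energy_mass.
move=> k y kn; rewrite energy_split//.
have h1 := energy_ge0 phi k.+1 y; have h2 := energy_ge0 phi k.+1 (y + unitc N k).
have h3 : 0 <= mass k phi y * mass k (fun a => phi a * ((3 / 4) ^+ (n - k) + 0)) y.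
  apply: mulr_ge0; apply: mass_ge0 => // a.
  by rewrite mulr_ge0// addr0 exprn_ge0//; lra.
lra.
Qed.

End Pushforward.

Lemma card_cube n : #|{: cube n}| = (2 ^ n)%N.
Proof. by rewrite card_ffun card_bool card_ord. Qed.

Lemma sum_pow2 (R : realFieldType) l : 2 ^+ l = 1 + \sum_(k < l) 2 ^+ k :> R.
Proof.
elim: l => [|l IH]; first by rewrite big_ord0 addr0.
by rewrite big_ord_recr /= addrA -IH exprS; ring.
Qed.

Section Row.
Variables (R : realFieldType) (N : nat) (phi : cube N -> R) (delta : R) (K : nat).

Definition height (k : nat) : R := delta * 2 ^+ k.

(* Below K.+1 by not_exceptional_K. *)
Definition row_level (y : cube N) : nat :=
  find (fun k => ~~ exceptional phi (fun _ _ => 0) (height k) y) (iota 0 K.+1).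

(** The factor 600 makes [600 ^ 2 / 9] exceed the [27 * 1320] that arises in [sum_schipp_row]. *)
Definition row_gauge y : R := 600 * height (row_level y).

(** Normalized to have sum at most 1 over the levels, which makes it an admissible coefficient [c]
    for the second variable. *)
Definition row_profile T y : R :=
  profile phi (fun _ _ => 0) (height (row_level y)) T y / height (row_level y) ^+ 2.

(** The inner sum over [o'] of [schipp_term], for a single row. *)
Definition schipp_row n (y : cube N) (t : cube n) : R :=
  \sum_(o < (shell t).+2) 2 ^+ o * push phi (proj n y + t + shift n o).

Hypotheses (phi_ge0 : forall a, 0 <= phi a) (delta_gt0 : 0 < delta).
Hypothesis K_large : \sum_a phi a <= height K.

Lemma height_gt0 k : 0 < height k.
Proof. by rewrite mulr_gt0 ?exprn_gt0. Qed.

Lemma row_gauge_gt0 y : 0 < row_gauge y.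
Proof. by rewrite mulr_gt0 ?height_gt0 ?ltr0n. Qed.

(** No average of [phi] exceeds its total, so nothing is bad at height [K]; as [c = 0],
    [sum_exceptional] then bounds the number of exceptional points by 0. *)
Lemma not_exceptional_K y : ~~ exceptional phi (fun _ _ => 0) (height K) y.
Proof.
have nb x : ~~ bad phi (height K) N x.
  apply/badP => -[l lN]; rewrite ltNge => /negP; apply.
  apply: le_trans K_large.
  rewrite /mass mulrA; apply: le_trans (_ : 1 * \sum_a phi a <= _); last by rewrite mul1r.
  apply: ler_pM.
  - by rewrite divr_ge0 ?exprn_ge0.
  - exact: sumr_ge0.
  - by rewrite ler_pdivrMr ?exprn_gt0// mul1r ler_eXn2l// ltr1n.
  - rewrite [leRHS](bigID (fun a => l <= shell (x + a))%N)/=.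
    by rewrite lerDl sumr_ge0.
have bad0 : \sum_x (bad phi (height K) N x)%:R = 0 :> R.
  by apply: big1 => x _; rewrite (negbTE (nb x)).
have := @sum_exceptional R N phi (fun _ _ => 0) (height K) phi_ge0
  (fun _ _ => lexx 0) (height_gt0 K).
have z : \sum_(k < N) \sum_x phi x * 0 = 0 :> R.
  by rewrite big1// => k _; rewrite big1// => x _; rewrite mulr0.
rewrite bad0 z mulr0 addr0 mulr0 (bigD1 y)//= => h; apply/negP => e.
have h' : 0 <= \sum_(i | i != y) (exceptional phi (fun _ _ => 0) (height K) i)%:R :> R.
  exact: sumr_ge0.
by move: h; rewrite e mulr1n; lra.
Qed.

Lemma row_levelP y : [/\ (row_level y <= K)%N,
  ~~ exceptional phi (fun _ _ => 0) (height (row_level y)) y &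
  forall k, (k < row_level y)%N -> exceptional phi (fun _ _ => 0) (height k) y].
Proof.
have hs : has (fun k => ~~ exceptional phi (fun _ _ => 0) (height k) y) (iota 0 K.+1).
  by apply/hasP; exists K; [rewrite mem_iota add0n ltnSn|exact: not_exceptional_K].
have lt : (row_level y < K.+1)%N by move: hs; rewrite has_find size_iota.
split; first by rewrite -ltnS.
  by have := nth_find 0%N hs; rewrite nth_iota// add0n.
move=> k kl; have := before_find 0%N kl.
by rewrite nth_iota ?add0n ?(ltn_trans kl)// => /negbFE.
Qed.

Lemma row_profile_ge0 T y : 0 <= row_profile T y.
Proof.
by apply: divr_ge0; [apply: profile_ge0 => //; exact: height_gt0|exact: sqr_ge0].
Qed.

Lemma sum_row_profile y : \sum_(T < N.+1) row_profile T y <= 1.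
Proof.
have [_ /exceptionalPn[_ h] _] := row_levelP y.
by rewrite -mulr_suml ler_pdivrMr ?exprn_gt0 ?height_gt0// mul1r.
Qed.

Lemma mass_row_gauge k y : (k <= N)%N -> 2 ^+ k * mass k phi y <= row_gauge y.
Proof.
move=> kN; have [_ /exceptionalPn[nb _] _] := row_levelP y.
apply: le_trans (_ : height (row_level y) <= _).
  rewrite leNgt; apply/negP => h; move/badP: nb; apply.
  by exists k.
have := height_gt0 (row_level y); rewrite /row_gauge; lra.
Qed.

(** Layer cake: [2 ^+ l = 1 + \sum_(k < l) 2 ^+ k], and every [k] below [row_level y] makes [y]
    exceptional at height [k]. As [c = 0], that set has at most 301 times the size of the bad
    set. *)
Lemma sum_row_gauge :
  \sum_y row_gauge y <= 600 * 301 * (delta * 2 ^+ N +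
     \sum_(k < K) height k * \sum_y (bad phi (height k) N y)%:R).
Proof.
apply: le_trans (_ : \sum_y 600 * (delta + \sum_(k < K)
   height k * (exceptional phi (fun _ _ => 0) (height k) y)%:R) <= _).
  apply: ler_sum => y _; rewrite ler_pM2l ?ltr0n// {1}/height sum_pow2 mulrDr mulr1 lerD2l.
  have [lK _ h] := row_levelP y.
  rewrite mulr_sumr (big_ord_widen K (fun k => delta * 2 ^+ k))//.
  rewrite big_mkcond; apply: ler_sum => k _ /=.
  case: ifP => [kl|_]; first by rewrite h// mulr1.
  by rewrite mulr_ge0// ltW// height_gt0.
rewrite -mulr_sumr big_split /= sumr_const card_cube exchange_big /=.
have h : \sum_(k < K) \sum_y height k * (exceptional phi (fun _ _ => 0) (height k) y)%:R <=
   301 * \sum_(k < K) height k * \sum_y (bad phi (height k) N y)%:R.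
  rewrite mulr_sumr; apply: ler_sum => k _; rewrite -mulr_sumr mulrCA.
  rewrite ler_pM2l ?height_gt0//.
  have := @sum_exceptional R N phi (fun _ _ => 0) (height k) phi_ge0
    (fun _ _ => lexx 0) (height_gt0 k).
  have z : \sum_(k < N) \sum_x phi x * 0 = 0 :> R.
    by rewrite big1// => l _; rewrite big1// => x _; rewrite mulr0.
  by rewrite z mulr0 addr0.
rewrite -[delta *+ _]mulr_natr natrX.
have : 0 <= delta * 2 ^+ N by rewrite mulr_ge0 ?exprn_ge0 ?ltW.
move: h; lra.
Qed.

(** For [t] in the shell [T] and fixed [o], the argument of [push] stays in the interval of level
    [T] around the point shifted by [shift n o], so [energy] dominates and [wsum_energy] applies at
    the height of the row. *)
Lemma sum_schipp_row n T y : (T <= n)%N -> (n <= N)%N ->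
  \sum_(t : cube n | shell t == T) schipp_row y t ^+ 2 <=
  row_gauge y ^+ 2 / 9 * ((3 / 4) ^+ (n - T) + row_profile T y).
Proof.
move=> Tn nN.
apply: le_trans (_ : 27 * wsum T (fun i j => energy n phi T (y + shift N i + shift N j)) <= _).
  rewrite (eq_bigr (fun t => (\sum_(o < T.+2)
      2 ^+ o * push phi (proj n y + t + shift n o)) ^+ 2)); last first.
    by move=> t /eqP tT; rewrite /schipp_row tT.
  apply: (@sum_sqr_schipp_le _ _ _ T
    (fun t o => push phi (proj n y + t + shift n o))) => [i j|o oT].
    exact: energy_ge0.
  rewrite /energy [leRHS](reindex_inj (addrI (proj n y + shift n o))) /=.
  rewrite [leRHS](eq_bigl (fun t : cube n => T <= shell t)%N) => [|t]; last first.
    rewrite !projD !proj_shift// addcDK addrC shellDr//.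
    by rewrite proj_unitc ?shell_unitc.
  rewrite [leRHS](bigID (fun t : cube n => shell t == T)) /=.
  rewrite [X in _ <= X + _](eq_bigl (fun t : cube n => shell t == T)); last first.
    by move=> t; case: eqP => [->|]; rewrite ?leqnn ?andbF.
  rewrite [leLHS](eq_bigr (fun t => push phi (proj n y + shift n o + t) ^+ 2)); last first.
    by move=> t _; rewrite addrAC.
  by rewrite lerDl sumr_ge0// => t _; rewrite sqr_ge0.
have l0 := height_gt0 (row_level y).
apply: le_trans (_ : 27 * (profile phi (fun _ _ => 0) (height (row_level y)) T y +
   1320 * ((3 / 4) ^+ (n - T) * height (row_level y) ^+ 2)) <= _).
  by rewrite ler_pM2l// wsum_energy.
rewrite /row_gauge /row_profile; set h := height _ in l0 *.
have : 0 <= profile phi (fun _ _ => 0) h T y by apply: profile_ge0.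
set b := profile _ _ _ _ _ => b0.
rewrite (_ : (600 * h) ^+ 2 / 9 * _ = 200 * 200 * ((3 / 4) ^+ (n - T) * h ^+ 2) + 200 * 200 * b).
  have : 0 <= (3 / 4) ^+ (n - T) * h ^+ 2.
    by apply: mulr_ge0; rewrite ?sqr_ge0// exprn_ge0//; lra.
  lra.
by field; rewrite lt0r_neq0.
Qed.

End Row.

(** * The second variable: superposition of rows *)

Section RowStage.
Variables (R : realFieldType) (N : nat) (F : cube N -> cube N -> R).
Variables (delta : R) (K : nat) (y : cube N).
Hypotheses (F_ge0 : forall a b, 0 <= F a b) (delta_gt0 : 0 < delta).
Hypothesis K_large : forall a, \sum_b F a b <= height delta K.

Definition gauge (a : cube N) : R := row_gauge (F a) delta K y.
Definition gauge_profile T (a : cube N) : R := row_profile (F a) delta K T y.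

Variable n : nat.
Hypothesis nN : (n <= N)%N.

Let P a (t : cube n) := schipp_row (F a) y t.

(** Squared norm, in [xi], of the integral over [a] of the rows; the off-diagonal terms with
    [shell u = U] reduce to its value at level [U]. *)
Definition row_functional k (x : cube N) : R :=
  \sum_(xi : cube n | (k <= shell (proj n x + xi))%N)
    (2 ^- N * \sum_(a | (k <= shell (x + a))%N) P a (proj n a + xi)) ^+ 2.

Lemma gauge_gt0 a : 0 < gauge a. Proof. exact: row_gauge_gt0. Qed.

(** Minkowski's inequality in the form of Cauchy-Schwarz with weights [gauge a]: the square of a sum
    of rows is at most the sum of the gauges times that of [P a ^ 2 / gauge a]. After exchanging
    sums, [xi] is translated by [proj n a]. *)
Lemma minkowski_ball (Q : pred (cube n)) (w : cube N -> R) k (x : cube N) :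
  (forall a, 0 <= w a) ->
  (forall a, \sum_(t | Q t) P a t ^+ 2 <= gauge a ^+ 2 * w a) ->
  \sum_(xi : cube n) (2 ^- N * \sum_(a | (k <= shell (x + a))%N && Q (proj n a + xi))
       P a (proj n a + xi)) ^+ 2 <=
  mass k gauge x * mass k (fun a => gauge a * w a) x.
Proof.
move=> w0 h; pose S := \sum_(a | (k <= shell (x + a))%N) gauge a.
apply: le_trans (_ : \sum_(xi : cube n) 2 ^- N * 2 ^- N * (S *
   \sum_(a | (k <= shell (x + a))%N && Q (proj n a + xi))
     (gauge a)^-1 * P a (proj n a + xi) ^+ 2) <= _).
  apply: ler_sum => xi _; rewrite exprMn [(2 ^- N) ^+ 2]expr2.
  rewrite ler_wpM2l ?mulr_ge0 ?invr_ge0 ?exprn_ge0//.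
  apply: le_trans (_ : (\sum_(a | (k <= shell (x + a))%N && Q (proj n a + xi)) gauge a) *
    \sum_(a | (k <= shell (x + a))%N && Q (proj n a + xi)) (gauge a)^-1 * P a (proj n a + xi) ^+ 2 <= _).
    apply: sqr_sum_le => a _; first exact/ltW/gauge_gt0.
      by rewrite mulr_ge0 ?sqr_ge0// invr_ge0 ltW ?gauge_gt0.
    by rewrite mulrA divff ?mul1r// lt0r_neq0// gauge_gt0.
  apply: ler_wpM2r.
    by apply: sumr_ge0 => a _; rewrite mulr_ge0 ?sqr_ge0// invr_ge0 ltW ?gauge_gt0.
  rewrite [leRHS](bigID (fun a => Q (proj n a + xi))) /=.
  by rewrite lerDl sumr_ge0// => a _; rewrite ltW ?gauge_gt0.
rewrite -mulr_sumr -mulr_sumr.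
rewrite (exchange_big_dep (fun a => k <= shell (x + a))%N)/=; last by move=> ? ? _ /andP[].
rewrite [leRHS](_ : _ = 2 ^- N * 2 ^- N *
    (S * \sum_(a | (k <= shell (x + a))%N) gauge a * w a)); last first.
  by rewrite /mass -/S; ring.
apply: ler_wpM2l; first by rewrite mulr_ge0// invr_ge0 exprn_ge0.
apply: ler_wpM2l; first by apply: sumr_ge0 => a _; rewrite ltW ?gauge_gt0.
apply: ler_sum => a na; rewrite na /= -mulr_sumr.
rewrite mulrC ler_pdivrMr ?gauge_gt0// [leRHS]mulrAC -expr2.
apply: le_trans (h a); rewrite le_eqVlt; apply/orP; left; apply/eqP.
rewrite [RHS](reindex_inj (addrI (proj n a))) /=.
by apply: eq_bigr.
Qed.

(** Take [w = 1]: over all shells the geometric terms sum to at most 4 and the profiles to at most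
    1, below the 9 of [sum_schipp_row]. *)
Lemma row_functional_mass k x : (k <= n)%N ->
  row_functional k x <= mass k gauge x ^+ 2.
Proof.
move=> kn; rewrite expr2.
apply: le_trans (_ : \sum_(xi : cube n) (2 ^- N * \sum_(a | (k <= shell (x + a))%N && predT (proj n a + xi))
       P a (proj n a + xi)) ^+ 2 <= _).
  rewrite /row_functional [leRHS](bigID (fun xi : cube n => k <= shell (proj n x + xi))%N) /=.
  rewrite ler_wpDr ?sumr_ge0//; first by move=> i _; rewrite sqr_ge0.
  by apply: ler_sum => xi _; rewrite le_eqVlt; apply/orP; left; apply/eqP;
    congr ((_ * _) ^+ 2); apply: eq_bigl => a; rewrite andbT.
rewrite [X in _ <= _ * X](_ : _ = mass k (fun a => gauge a * 1) x); last first.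
  by congr (_ * _); apply: eq_bigr => a _; rewrite mulr1.
apply: minkowski_ball => [//|a]; rewrite mulr1.
rewrite (partition_big (fun t : cube n => inord (shell t) : 'I_n.+1) predT)//=.
apply: le_trans (_ : \sum_(T < n.+1) gauge a ^+ 2 / 9 *
    ((3 / 4) ^+ (n - T) + gauge_profile T a) <= _).
  apply: ler_sum => T _.
  apply: le_trans (_ : \sum_(t : cube n | shell t == T) P a t ^+ 2 <= _); last first.
    by apply: sum_schipp_row => //; rewrite -ltnS.
  rewrite le_eqVlt; apply/orP; left; apply/eqP; apply: eq_bigl => t.
  by rewrite -val_eqE /= inordK// ltnS shell_le.
rewrite -mulr_sumr big_split /=.
have h1 := sum_geometric34 R n.
have h2 : \sum_(T < n.+1) gauge_profile T a <= 1.
  apply: le_trans (sum_row_profile (F_ge0 a) delta_gt0 (K_large a) y).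
  rewrite (big_ord_widen N.+1 (fun T => gauge_profile T a))//.
  rewrite big_mkcond; apply: ler_sum => T _; case: ifP => // _.
  exact: row_profile_ge0.
apply: le_trans (_ : gauge a ^+ 2 / 9 * 9 <= _).
  by apply: ler_wpM2l; [rewrite divr_ge0 ?sqr_ge0|lra].
by rewrite divfK// pnatr_eq0.
Qed.

(** For [a] and [xi] in one interval, [proj n a + xi] has shell at least [k]. If it is larger, [a]
    and [xi] lie in the same half, and these terms [A] give the functionals of the two halves. The
    terms [B] involve the single shell [k], so [sum_schipp_row] bounds them with
    [c k = gauge_profile k]. *)
Lemma row_functional_split k x : (k < n)%N ->
  row_functional k x <= 5 / 4 * (row_functional k.+1 x + row_functional k.+1 (x + unitc N k)) +
   5 * (mass k gauge x * mass k (fun a => gauge a * ((3 / 4) ^+ (n - k) + gauge_profile k a)) x).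
Proof.
move=> kn; have kN := leq_trans kn nN.
pose A (xi : cube n) := 2 ^- N * \sum_(a | (k <= shell (x + a))%N && (k < shell (proj n a + xi))%N)
   P a (proj n a + xi).
pose B (xi : cube n) := 2 ^- N * \sum_(a | (k <= shell (x + a))%N && (shell (proj n a + xi) == k))
   P a (proj n a + xi).
apply: le_trans (_ : 5 / 4 * (\sum_(xi : cube n | (k <= shell (proj n x + xi))%N) A xi ^+ 2) +
    5 * \sum_(xi : cube n) B xi ^+ 2 <= _).
  apply: le_trans (_ : \sum_(xi : cube n | (k <= shell (proj n x + xi))%N)
     (5 / 4 * A xi ^+ 2 + 5 * B xi ^+ 2) <= _).
    apply: ler_sum => xi nx.
    rewrite (_ : 2 ^- N * _ = A xi + B xi).
      (* [(A + B) ^ 2 = 5 / 4 * A ^ 2 + 5 * B ^ 2 - (A - 4 * B) ^ 2 / 4]. *)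
      have := sqr_ge0 (A xi - 4 * B xi); lra.
    rewrite -mulrDr; congr (_ * _).
    rewrite (bigID (fun a => k < shell (proj n a + xi))%N) /=; congr (_ + _).
    apply: eq_bigl => a; case na : (k <= shell (x + a))%N => //=.
    rewrite -leqNgt eqn_leq; case: leqP => //= _; apply/esym.
    by rewrite -(addcDK (proj n x)) shellD// ball_proj// ltnW.
  rewrite big_split /= -!mulr_sumr lerD2l ler_pM2l//.
  rewrite [leRHS](bigID (fun xi : cube n => k <= shell (proj n x + xi))%N) /=.
  by rewrite lerDl sumr_ge0// => xi _; rewrite sqr_ge0.
have near2 (z : cube N) xi a : (k < shell (proj n z + xi))%N ->
    (k < shell (proj n a + xi))%N = (k < shell (z + a))%N.
  by move=> nz; rewrite -(addcDK (proj n z)) shellDr// ball_proj.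
apply: lerD.
  rewrite ler_wpM2l ?divr_ge0// ball_split//; apply: lerD.
    apply: ler_sum => xi nx; rewrite le_eqVlt; apply/orP; left; apply/eqP.
    congr ((_ * _) ^+ 2); apply: eq_bigl => a; rewrite (near2 x)//.
    by apply: andb_idl => /ltnW.
  rewrite /row_functional -(proj_unitc nN) -projD.
  apply: ler_sum => xi nx; rewrite le_eqVlt; apply/orP; left; apply/eqP.
  congr ((_ * _) ^+ 2); apply: eq_bigl => a; rewrite (near2 (x + unitc N k))//.
  apply: andb_idl => h; rewrite -(addcK (unitc N k) (x + a)).
  by rewrite shellD ?shell_unitc ?(ltnW kN)// addrCA addrA ltnW.
rewrite ler_pM2l//; apply: (@minkowski_ball (fun t => shell t == k)
  (fun a => (3 / 4) ^+ (n - k) + gauge_profile k a)) => a.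
  by apply: addr_ge0; [rewrite exprn_ge0//; lra|exact: row_profile_ge0].
apply: le_trans (_ : gauge a ^+ 2 / 9 * ((3 / 4) ^+ (n - k) + gauge_profile k a) <= _).
  by apply: sum_schipp_row => //; exact: ltnW.
apply: ler_wpM2r; first by rewrite addr_ge0 ?row_profile_ge0// exprn_ge0//; lra.
by rewrite ler_pdivrMr// -[leLHS]mulr1 ler_wpM2l ?sqr_ge0// ler1n.
Qed.

End RowStage.

(** * Finite Walsh functions and Schipp's formula *)

Section FiniteWalsh.
Variables (R : realFieldType) (n : nat).
Implicit Types (s t u v x y a b : cube n) (m k j : nat).

Definition bit (m i : nat) : bool := odd (m %/ 2 ^ i).

Lemma bit_small m i : (m < 2 ^ i)%N -> bit m i = false.
Proof. by move=> mi; rewrite /bit divn_small. Qed.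

Lemma bit_add m k i : (m < 2 ^ k)%N -> bit (2 ^ k + m) i = (i == k) || bit m i.
Proof.
move=> mk; case: (ltngtP i k) => [ik|ki|->].
- rewrite /bit divnDl ?dvdn_exp2l 1?ltnW// -expnB ?(ltnW ik)// oddD oddX.
  by rewrite -(subnSK ik).
- have km : (2 ^ k + m < 2 ^ i)%N.
    apply: (@leq_trans (2 ^ k.+1)); last by rewrite leq_exp2l.
    by rewrite expnS mul2n -addnn ltn_add2l.
  by rewrite !bit_small//; apply: leq_trans km; rewrite ltnS leq_addl.
- by rewrite /bit divnDl// divnn expn_gt0 /= divn_small.
Qed.

(** The Rademacher function [r_j], written as a product so that [j] is a natural number; it equals 1
    for [n <= j]. *)
Definition sgn s (j : nat) : R := \prod_(i < n | i == j :> nat) (-1) ^+ s i.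

Definition wal m s : R := \prod_(i < n) (if bit m i then (-1) ^+ s i else 1).

Lemma walD m s t : wal m (s + t) = wal m s * wal m t.
Proof.
rewrite -big_split; apply: eq_bigr => i _ /=; case: bit; last by rewrite mulr1.
by rewrite ffunE -signr_addb.
Qed.

Lemma sgnE s (i : 'I_n) : sgn s i = (-1) ^+ s i.
Proof. by rewrite /sgn (big_pred1 i)// => k; rewrite /= -val_eqE. Qed.

Lemma wal_unitc m j : (j < n)%N -> wal m (unitc n j) = (-1) ^+ bit m j.
Proof.
move=> jn; rewrite /wal (bigD1 (Ordinal jn)) //= ffunE eqxx.
rewrite big1 ?mulr1 => [|i ij]; first by case: bit.
by rewrite ffunE (_ : i == j :> nat = false) ?if_same//; exact: negbTE.
Qed.

Lemma wal_add m k s : (k < n)%N -> (m < 2 ^ k)%N -> wal (2 ^ k + m) s = sgn s k * wal m s.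
Proof.
move=> kn mk; rewrite -[k]/(nat_of_ord (Ordinal kn)) sgnE /wal.
rewrite (bigD1 (Ordinal kn)) //= bit_add// eqxx /=; congr (_ * _).
rewrite [RHS](bigD1 (Ordinal kn)) //= bit_small// mul1r.
apply: eq_bigr => i; rewrite -val_eqE /= => ik.
by rewrite bit_add// (negbTE ik).
Qed.

Lemma wal_ball m k s : (m < 2 ^ k)%N -> (k <= shell s)%N -> wal m s = 1.
Proof.
move=> mk ks; rewrite /wal big1// => i _; case: (ltnP i k) => ik.
  move: ks; rewrite shellE => /andP[_ /forallP /(_ i)]; rewrite ik /= => /negbTE ->.
  by rewrite if_same.
by rewrite bit_small// (leq_trans mk)// leq_exp2l.
Qed.

Definition dirichlet m s : R := \sum_(k < m) wal k s.

Lemma sum_ord_add (F : nat -> R) p q :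
  \sum_(k < p + q) F k = \sum_(k < p) F k + \sum_(k < q) F (p + k)%N.
Proof. by rewrite big_split_ord. Qed.

Lemma sgn_sqr s k : sgn s k * sgn s k = 1.
Proof.
rewrite -big_split big1// => i _ /=; by rewrite -signr_addb addbb.
Qed.

Lemma sgn_val s k : (k < n)%N -> (k <= shell s)%N ->
  sgn s k = if (k < shell s)%N then 1 else -1.
Proof.
move=> kn; rewrite !shellE kn (ltnW kn) /= => /forallP h.
rewrite -[k]/(nat_of_ord (Ordinal kn)) sgnE; case: ifPn => /=.
  by move/forallP/(_ (Ordinal kn)); rewrite /= ltnSn /= => /negbTE ->.
move/forallPn => [i]; rewrite negb_imply negbK ltnS leq_eqVlt => /andP[/orP[/eqP ik|ik] si].
  by rewrite (_ : Ordinal kn = i) ?si//; exact: val_inj.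
by have := h i; rewrite ik si.
Qed.

(** Paley's formula, by [D_(2 ^ k.+1) = (1 + r_k) D_(2 ^ k)]. *)
Lemma dirichlet_pow2 k s : (k <= n)%N -> dirichlet (2 ^ k) s = 2 ^+ k * (k <= shell s)%N%:R.
Proof.
elim: k => [_|k IH kn].
  by rewrite /dirichlet expn0 big_ord1 expr0 mul1r (@wal_ball _ 0).
rewrite /dirichlet expnS mul2n -addnn (sum_ord_add (wal^~ s)).
under [X in _ + X]eq_bigr do rewrite wal_add//.
rewrite -mulr_sumr -/(dirichlet _ _) IH ?(ltnW kn)//.
case ks : (k <= shell s)%N; last first.
  rewrite (_ : (k < shell s)%N = false) ?mulr0 ?addr0//.
  by apply/negbTE; apply: contraFN ks => /ltnW.
by rewrite sgn_val//; case: ifP => _; rewrite exprS /= ?mulr1n ?mulr0n; ring.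
Qed.

(** The top digit is removed by [D_(2 ^ k + m') = D_(2 ^ k) + r_k D_m']. Where [D_(2 ^ k)] does not
    vanish, [w_m' = 1], so that [D_(2 ^ k) = w_m r_k D_(2 ^ k)]. *)
Lemma dirichlet_digits m k s : (k <= n)%N -> (m < 2 ^ k)%N ->
  dirichlet m s = wal m s *
    \sum_(i < k) (bit m i)%:R * (sgn s i * (2 ^+ i * (i <= shell s)%N%:R)).
Proof.
elim: k m => [|k IH] m kn mk.
  by move: mk; rewrite expn0 ltnS leqn0 => /eqP ->; rewrite /dirichlet !big_ord0 mulr0.
rewrite big_ord_recr /=; case: (ltnP m (2 ^ k)) => mk'.
  by rewrite (bit_small mk') mul0r addr0 IH// ltnW.
have mk2 : (m - 2 ^ k < 2 ^ k)%N by rewrite ltn_subLR// addnn -mul2n -expnS.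
rewrite -(subnKC mk') wal_add// /dirichlet (sum_ord_add (wal^~ s)) -/(dirichlet _ _).
under [X in _ + X = _]eq_bigr => i _.
  rewrite wal_add ?(ltn_trans _ mk2)//.
over.
rewrite -mulr_sumr -/(dirichlet _ _) dirichlet_pow2 ?(ltnW kn)//.
rewrite (IH _ (ltnW kn) mk2) bit_add// eqxx mul1r mulrDr addrC; congr (_ + _).
  rewrite mulrA; congr (_ * _); apply: eq_bigr => i _.
  by rewrite bit_add// (ltn_eqF (ltn_ord i)).
case ks : (k <= shell s)%N; last by rewrite !mulr0.
by rewrite (wal_ball mk2)// mulr1 mulrA sgn_sqr mul1r.
Qed.

(** Telescoping: [r_i D_(2 ^ i) = D_(2 ^ i.+1) - D_(2 ^ i)]. *)
Lemma sum_sgn k s : (k <= n)%N ->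
  \sum_(i < k) sgn s i * (2 ^+ i * (i <= shell s)%N%:R) =
  2 ^+ k * (k <= shell s)%N%:R - 1.
Proof.
elim: k => [_|k IH kn]; first by rewrite big_ord0 expr0 mul1r subrr.
rewrite big_ord_recr /= IH ?(ltnW kn)//.
case ks : (k <= shell s)%N; last first.
  rewrite (_ : (k < shell s)%N = false) ?mulr0 ?addr0//.
  by apply/negbTE; apply: contraFN ks => /ltnW.
by rewrite sgn_val//; case: ifP => _; rewrite exprS /= ?mulr1n ?mulr0n; ring.
Qed.

(* Coefficients of Schipp's formula dirichletE. *)
Definition kap o s : R :=
  if o is j.+1 then
    if (j < n)%N then - (sgn s j * (2 ^+ j * (j <= shell s)%N%:R))
    else 2 ^+ n * (n <= shell s)%N%:R
  else -1.

(** A digit [m_i] equals [(1 - (-1) ^ m_i) / 2], and [(-1) ^ m_i = w_m(e_i)] turns the dependence on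
    digits into a translation. The part without sign telescopes to [D_(2 ^ n) - 1], which provides
    the terms [o = n.+1] and [o = 0]. *)
Lemma dirichletE m s : (m < 2 ^ n)%N ->
  dirichlet m s = 1 / 2 * \sum_(o < n.+2) kap o s * wal m (s + shift n o).
Proof.
move=> mn; rewrite (dirichlet_digits s (leqnn n) mn).
rewrite big_ord_recl big_ord_recr /= addr0 ltnn.
rewrite add0n; under [X in _ = _ * (_ + (X + _))]eq_bigr => i _ do rewrite !add0n ltn_ord.
rewrite unitc_ge// addr0.
have tele : \sum_(i < n) sgn s i * (2 ^+ i * (i <= shell s)%N%:R) =
    2 ^+ n * (n <= shell s)%N%:R - 1.
  exact: sum_sgn.
have e : \sum_(i < n) (bit m i)%:R * (sgn s i * (2 ^+ i * (i <= shell s)%N%:R)) =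
  1 / 2 * (\sum_(i < n) sgn s i * (2 ^+ i * (i <= shell s)%N%:R) +
  \sum_(i < n) - (sgn s i * (2 ^+ i * (i <= shell s)%N%:R)) * (-1) ^+ bit m i).
  rewrite -big_split mulr_sumr; apply: eq_bigr => i _ /=.
  by case: bit => /=; rewrite ?expr0 ?expr1; field.
have e2 : \sum_(i < n) - (sgn s i * (2 ^+ i * (i <= shell s)%N%:R)) * wal m (s + unitc n i) =
  wal m s * \sum_(i < n) - (sgn s i * (2 ^+ i * (i <= shell s)%N%:R)) * (-1) ^+ bit m i.
  by rewrite mulr_sumr; apply: eq_bigr => i _; rewrite walD wal_unitc// mulrCA.
rewrite e e2 tele; ring.
Qed.

End FiniteWalsh.

(** * Quadratic partial sums as Walsh series in the index *)

Section SquareSums.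
Variables (R : realFieldType) (n : nat) (M : cube n -> cube n -> R) (x y : cube n).
Implicit Types (u v a b : cube n).

Definition square_psum m : R :=
  \sum_a \sum_b M a b * (dirichlet R m (x + a) * dirichlet R m (y + b)).

(** [b] has been eliminated: it is determined by [u], [a] and the two shifts. The point of the
    definition is its independence of [m]. *)
Definition schipp_coef u : R :=
  \sum_(o < n.+2) \sum_(o' < n.+2) \sum_a
    kap R o (x + a) * kap R o' (y + (u + (x + a + shift n o + (y + shift n o')))) *
    M a (u + (x + a + shift n o + (y + shift n o'))).

(** Here it matters that both kernels have the same index: [w_m(s) w_m(t) = w_m(s + t)] is again one
    Walsh function of index [m]. *)
Lemma square_psumE m : (m < 2 ^ n)%N ->
  square_psum m = 1 / 4 * \sum_u schipp_coef u * wal R m u.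
Proof.
move=> mn; rewrite /square_psum.
transitivity (\sum_(o < n.+2) \sum_(o' < n.+2) \sum_a \sum_b
   1 / 4 * (kap R o (x + a) * kap R o' (y + b) * M a b *
   wal R m (x + a + shift n o + (y + b + shift n o')))).
  transitivity (\sum_a \sum_b \sum_(o < n.+2) \sum_(o' < n.+2)
     1 / 4 * (kap R o (x + a) * kap R o' (y + b) * M a b *
     wal R m (x + a + shift n o + (y + b + shift n o')))).
    apply: eq_bigr => a _; apply: eq_bigr => b _.
    rewrite !dirichletE// mulrACA big_distrlr /= mulrA mulr_sumr.
    apply: eq_bigr => o _; rewrite mulr_sumr; apply: eq_bigr => o' _.
    by rewrite [wal R m (_ + (y + _ + _))]walD; field.
  under eq_bigr => a _ do rewrite exchange_big /=.
  rewrite exchange_big /=; apply: eq_bigr => o _.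
  under eq_bigr => a _ do rewrite exchange_big /=.
  by rewrite exchange_big.
rewrite mulr_sumr /schipp_coef.
under [RHS]eq_bigr => u _ do rewrite mulr_suml mulr_sumr.
rewrite [RHS]exchange_big /=; apply: eq_bigr => o _.
under [RHS]eq_bigr => u _ do rewrite mulr_suml mulr_sumr.
rewrite [RHS]exchange_big /=; apply: eq_bigr => o' _.
under [RHS]eq_bigr => u _ do rewrite mulr_suml mulr_sumr.
rewrite [RHS]exchange_big /=; apply: eq_bigr => a _.
rewrite (reindex_inj (addIr (x + a + shift n o + (y + shift n o')))) /=.
apply: eq_bigr => u _; congr (_ * (_ * wal R m _)).
by cube_addition.
Qed.

Lemma parseval (H : cube n -> R) :
  \sum_(m < 2 ^ n) (\sum_u H u * wal R m u) ^+ 2 = 2 ^+ n * \sum_u H u ^+ 2.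
Proof.
transitivity (\sum_u \sum_v H u * H v * dirichlet R (2 ^ n) (u + v)).
  under eq_bigr => m _ do rewrite expr2 big_distrlr /=.
  rewrite exchange_big /=; apply: eq_bigr => u _.
  rewrite exchange_big /=; apply: eq_bigr => v _.
  rewrite /dirichlet mulr_sumr; apply: eq_bigr => m _.
  by rewrite walD; ring.
rewrite mulr_sumr; apply: eq_bigr => u _.
rewrite (bigD1 u) //= dirichlet_pow2// addcc shell0 leqnn big1 ?addr0.
  by rewrite mulr1 mulrC expr2.
move=> v vu; rewrite dirichlet_pow2// shell_eqn addcE addr0 (negbTE vu).
by rewrite !mulr0.
Qed.

Lemma norm_kap o (s : cube n) : (o <= n.+1)%N ->
  `|kap R o s| <= 2 ^+ o * ((o <= (shell s).+1)%N)%:R.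
Proof.
case: o => [_|j jn]; first by rewrite /= normrN normr1 expr0 mulr1.
rewrite /= ltnS; case: ltnP => jn'.
  rewrite normrN normrM [`|sgn _ _ _|](_ : _ = 1) ?mul1r.
    rewrite normrM normr_nat ger0_norm ?exprn_ge0// exprS -mulrA.
    by rewrite ler_peMl ?mulr_ge0 ?exprn_ge0// ler1n.
  by rewrite -[j]/(nat_of_ord (Ordinal jn')) sgnE normrX normrN1 expr1n.
have -> : j = n by apply/eqP; rewrite eqn_leq -ltnS jn.
rewrite ger0_norm ?mulr_ge0 ?exprn_ge0// exprS -mulrA.
by rewrite ler_peMl ?mulr_ge0 ?exprn_ge0// ler1n.
Qed.

Lemma shell_add_shift o v : (o <= n.+1)%N ->
  (o <= (shell (v + shift n o)).+1)%N = (o <= (shell v).+1)%N.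
Proof. by case: o => // j jn; rewrite /= !ltnS shellDr// shell_unitc. Qed.

Variable A : cube n -> cube n -> R.
Hypothesis MA : forall a b, `|M a b| <= A a b.

Definition schipp_term u v o o' : R :=
  2 ^+ o * 2 ^+ o' * A (x + v + shift n o) (y + (u + v) + shift n o').

Definition schipp_majorant u : R :=
  \sum_v \sum_(o < (shell v).+2) \sum_(o' < (shell (u + v)).+2) schipp_term u v o o'.

Lemma norm_schipp_coef u : `|schipp_coef u| <= schipp_majorant u.
Proof.
have A0 a b : 0 <= A a b by apply: le_trans (MA a b).
apply: le_trans (_ : \sum_(o < n.+2) \sum_(o' < n.+2) \sum_v
   ((o <= (shell v).+1)%N)%:R * ((o' <= (shell (u + v)).+1)%N)%:R * schipp_term u v o o' <= _).
  apply: le_trans (ler_norm_sum _ _ _) _; apply: ler_sum => o _.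
  apply: le_trans (ler_norm_sum _ _ _) _; apply: ler_sum => o' _.
  apply: le_trans (ler_norm_sum _ _ _) _.
  (* With [a = x + shift n o + v] the kernels have arguments [v + shift n o] and
     [u + v + shift n o'], and by [shell_add_shift] the shifts drop out of the support
     conditions. *)
  rewrite (reindex_inj (addrI (x + shift n o))) /=; apply: ler_sum => v _.
  have on : (o <= n.+1)%N by rewrite -ltnS.
  have on' : (o' <= n.+1)%N by rewrite -ltnS.
  have e1 : x + (x + shift n o + v) = v + shift n o by rewrite -addrA addcK addrC.
  have e2 : u + (x + (x + shift n o + v) + shift n o + (y + shift n o')) =
     y + (u + v) + shift n o'.
    by rewrite e1; cube_addition.
  have e3 : y + (y + (u + v) + shift n o') = u + v + shift n o'.
    by rewrite -addrA addcK.
  have e4 : x + shift n o + v = x + v + shift n o by rewrite addrAC.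
  rewrite e2 e3 e1 e4 2!normrM.
  have k1 := norm_kap (v + shift n o) on.
  have k2 := norm_kap (u + v + shift n o') on'.
  rewrite !shell_add_shift// in k1 k2.
  rewrite /schipp_term [leRHS](_ : _ = (2 ^+ o * (o <= (shell v).+1)%N%:R) *
     (2 ^+ o' * (o' <= (shell (u + v)).+1)%N%:R) * A (x + v + shift n o) (y + (u + v) + shift n o')).
    apply: ler_pM; [exact: mulr_ge0|exact: normr_ge0| |exact: MA].
    by apply: ler_pM; rewrite ?normr_ge0.
  by ring.
rewrite /schipp_majorant; under eq_bigr => o _ do rewrite exchange_big /=.
rewrite exchange_big /=; apply: ler_sum => v _.
rewrite (big_ord_widen n.+2 (fun o => \sum_(o' < (shell (u + v)).+2) schipp_term u v o o')); last first.
  by rewrite !ltnS shell_le.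
rewrite [leRHS]big_mkcond; apply: ler_sum => o _ /=; rewrite ltnS.
case: ifP => ov; last by rewrite big1// => o' _; rewrite !mul0r.
rewrite (big_ord_widen n.+2 (fun o' => schipp_term u v o o')); last by rewrite !ltnS shell_le.
rewrite [leRHS]big_mkcond; apply: ler_sum => o' _ /=; rewrite ltnS mul1r.
by case: ifP; rewrite ?mul1r ?mul0r.
Qed.

Lemma sum_sqr_psum :
  2 ^- n * \sum_(m < 2 ^ n) square_psum m ^+ 2 <= \sum_u schipp_majorant u ^+ 2.
Proof.
have A0 a b : 0 <= A a b by apply: le_trans (MA a b).
under eq_bigr => m _ do rewrite square_psumE// exprMn.
rewrite -mulr_sumr parseval mulrCA mulKf ?expf_neq0 ?pnatr_eq0//.
apply: le_trans (_ : 1 * \sum_u schipp_coef u ^+ 2 <= _).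
  apply: ler_wpM2r; first by apply: sumr_ge0 => u _; rewrite sqr_ge0.
  by rewrite expr_div_n expr1n ler_pdivrMr ?mul1r ?exprn_gt0// -natrX ler1n.
rewrite mul1r; apply: ler_sum => u _.
have h0 : 0 <= schipp_majorant u.
  do 3!(apply: sumr_ge0 => ? _); rewrite /schipp_term mulr_ge0// mulr_ge0 ?exprn_ge0//.
by rewrite -[schipp_coef u ^+ 2]real_normK ?num_real// ler_sqr ?nnegrE// norm_schipp_coef.
Qed.

End SquareSums.

Section ShellSplit.
Variables (R : realFieldType) (n : nat).
Implicit Types (A : cube n -> cube n -> R) (u v x y : cube n).

Definition off_diagonal A x y u : R :=
  \sum_(v | (shell v < shell (u + v))%N)
    \sum_(o < (shell v).+2) \sum_(o' < (shell (u + v)).+2) schipp_term x y A u v o o'.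

(** With [o' <= o], the sum over [v] will cancel the larger of [2 ^ o] and [2 ^ o']. The pairs with
    [o = o'] are covered by both orders, which is harmless for an upper bound. *)
Definition near_diagonal A x y u : R :=
  \sum_(v | shell v == shell (u + v))
    \sum_(o < (shell v).+2) \sum_(o' < (shell v).+2 | (o' <= o)%N) schipp_term x y A u v o o'.

Let flip A a b := A b a.

Lemma flip_term A x y u v o o' :
  schipp_term x y A u (u + v) o o' = schipp_term y x (flip A) u v o' o.
Proof. by rewrite /schipp_term /flip addcK [2 ^+ o * _]mulrC. Qed.

(* Exchanging the variables maps v to u + v, hence the two flipped terms. *)
Lemma schipp_majorant_le A x y u : (forall a b, 0 <= A a b) ->
  schipp_majorant x y A u <=
  off_diagonal A x y u + off_diagonal (flip A) y x u +
  (near_diagonal A x y u + near_diagonal (flip A) y x u).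
Proof.
move=> A0.
have t0 v o o' : 0 <= schipp_term x y A u v o o'.
  by rewrite /schipp_term mulr_ge0// mulr_ge0 ?exprn_ge0.
rewrite /schipp_majorant (bigID (fun v => shell v < shell (u + v))%N) /= -addrA lerD2l.
rewrite (bigID (fun v => shell v == shell (u + v))) /= addrC; apply: lerD.
  rewrite (reindex_inj (addrI u)) /= le_eqVlt; apply/orP; left; apply/eqP.
  apply: eq_big => [v|v _]; first by rewrite addcK -leqNgt ltn_neqAle andbC eq_sym.
  rewrite addcK exchange_big /=; apply: eq_bigr => o _; apply: eq_bigr => o' _.
  exact: flip_term.
apply: le_trans (_ : near_diagonal A x y u +
  \sum_(v | shell v == shell (u + v))
    \sum_(o < (shell v).+2) \sum_(o' < (shell v).+2 | (o <= o')%N) schipp_term x y A u v o o' <= _).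
  rewrite -big_split /= [leLHS](eq_bigl (fun v => shell v == shell (u + v))); last first.
    by move=> v; case: eqP => [->|]; rewrite ?ltnn ?andbF.
  apply: ler_sum => v /eqP e; rewrite -e -big_split; apply: ler_sum => o _ /=.
  rewrite (bigID (fun o' : 'I_(shell v).+2 => o' <= o)%N) /= lerD2l.
  rewrite big_mkcond [leRHS]big_mkcond; apply: ler_sum => o' _ /=.
  by rewrite -ltnNge; case: ltnP => [/ltnW ->//|_]; case: ifP.
rewrite lerD2l (reindex_inj (addrI u)) /= le_eqVlt; apply/orP; left; apply/eqP.
apply: eq_big => [v|v]; rewrite addcK eq_sym// => /eqP e.
rewrite -e (exchange_big_dep predT)//=; apply: eq_bigr => o _; apply: eq_bigr => o' _.
exact: flip_term.
Qed.

End ShellSplit.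

(** * The finite maximal inequality *)

Section OffDiagonal.
Variables (R : realFieldType) (N : nat) (F : cube N -> cube N -> R).
Hypothesis F_ge0 : forall a b, 0 <= F a b.
Variable n : nat.
Hypothesis nN : (n <= N)%N.
Variables x y : cube N.

Definition cell (a b : cube n) : R := push (fun a' => push (F a') b) a.

Lemma cell_ge0 a b : 0 <= cell a b.
Proof. by apply: push_ge0 => a'; exact: push_ge0. Qed.

Lemma row_functional_add k z e : (k <= n)%N -> (k <= shell e)%N ->
  row_functional F y n k (z + e) = row_functional F y n k z.
Proof.
move=> kn ke; have ke' : (k <= shell (proj n e))%N by rewrite shell_proj.
apply: eq_big => [xi|xi _]; first by rewrite projD addrAC (shellDr _ ke').
by congr ((_ * _) ^+ 2); apply: eq_bigl => a; rewrite addrAC (shellDr _ ke).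
Qed.

Lemma schipp_row_ge0 a (t : cube n) : 0 <= schipp_row (F a) y t.
Proof. by apply: sumr_ge0 => o _; rewrite mulr_ge0 ?exprn_ge0// push_ge0. Qed.

Let Q (u : cube n) o : R := 2 ^- N *
  \sum_(a | (shell u <= shell (x + shift N o + a))%N)
    schipp_row (F a) y (proj n a + (proj n x + u + shift n o)).

(** As [shell v < shell (u + v)], also [shell u = shell v]: the range of [o] depends on [u] only.
    For each [o], the cell of [a] then determines [v]. *)
Lemma off_diagonal_le u :
  off_diagonal cell (proj n x) (proj n y) u <= \sum_(o < (shell u).+2) 2 ^+ o * Q u o.
Proof.
rewrite /off_diagonal.
rewrite (eq_bigr (fun v => \sum_(o < (shell u).+2) \sum_(o' < (shell (u + v)).+2)
  schipp_term (proj n x) (proj n y) cell u v o o')) => [|v lv]; last first.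
  by rewrite -(shellD_lt lv) addrCA addcc addr0.
rewrite exchange_big /=; apply: ler_sum => o _.
have e v : \sum_(o' < (shell (u + v)).+2) schipp_term (proj n x) (proj n y) cell u v o o' =
   2 ^+ o * (2 ^- N * \sum_(a | proj n a == proj n x + v + shift n o) schipp_row (F a) y (u + v)).
  rewrite /schipp_row /schipp_term /cell /push exchange_big /= !mulr_sumr.
  apply: eq_bigr => o' _; rewrite -!mulr_sumr; ring.
under eq_bigr => v _ do rewrite e.
rewrite -mulr_sumr ler_wpM2l ?exprn_ge0// -mulr_sumr ler_wpM2l ?invr_ge0 ?exprn_ge0//.
rewrite (exchange_big_dep predT) //= [leRHS]big_mkcond /=; apply: ler_sum => a _.
pose v0 := proj n x + shift n o + proj n a.
rewrite (eq_bigl (fun v => (shell v < shell (u + v))%N && (v == v0))) => [|v]; last first.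
  by congr (_ && _); rewrite eq_sym addrAC addcE.
rewrite big_mkcondl big_pred1_eq.
have -> : proj n a + (proj n x + u + shift n o) = u + v0 by rewrite /v0; move: (proj n a) (proj n x) => p q; cube_addition.
case: ifP => [lv|_]; last by case: ifP => // _; exact: schipp_row_ge0.
have e' : shell u = shell v0 by rewrite -(shellD_lt lv) addrCA addcc addr0.
by rewrite -(shell_proj nN) ?shell_le// !projD proj_shift// -/v0 e' leqnn.
Qed.

(** On the shell [U] of [u], the change of variable [xi = proj n x + u + shift n o] bounds the
    squares of [Q] by [row_functional] at level [U] and point [x + shift N o]. *)
Lemma sum_off_diagonal :
  \sum_u off_diagonal cell (proj n x) (proj n y) u ^+ 2 <=
  27 * \sum_(U < n.+1) wsum U (fun i j => row_functional F y n U (x + shift N i + shift N j)).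
Proof.
have o0 u : 0 <= off_diagonal cell (proj n x) (proj n y) u.
  do 3!(apply: sumr_ge0 => ? _); rewrite /schipp_term; apply: mulr_ge0; [by rewrite mulr_ge0 ?exprn_ge0|exact: cell_ge0].
apply: le_trans (_ : \sum_u (\sum_(o < (shell u).+2) 2 ^+ o * Q u o) ^+ 2 <= _).
  apply: ler_sum => u _; have h := off_diagonal_le u.
  by rewrite ler_sqr ?nnegrE// (le_trans _ h).
rewrite (partition_big (fun u : cube n => inord (shell u) : 'I_n.+1) predT)//=.
rewrite mulr_sumr; apply: ler_sum => U _.
have Un : (U <= n)%N by rewrite -ltnS.
have eU (u : cube n) : (inord (shell u) == U :> 'I_n.+1) = (shell u == U :> nat).
  by rewrite -val_eqE /= inordK// ltnS shell_le.
rewrite (eq_bigl _ _ eU) (eq_bigr (fun u => (\sum_(o < U.+2) 2 ^+ o * Q u o) ^+ 2)); last first.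
  by move=> u /eqP ->.
have rf0 z k : 0 <= row_functional F y n k z by apply: sumr_ge0 => xi _; rewrite sqr_ge0.
apply: (@sum_sqr_schipp_le _ _ _ U Q) => // o oU.
rewrite row_functional_add ?shell_shift ?shell_unitc ?(leq_trans Un nN)//.
rewrite /row_functional [leRHS](reindex_inj (addrI (proj n x + shift n o))) /=.
rewrite [leRHS](eq_bigl (fun u : cube n => U <= shell u)%N) => [|u]; last first.
  by rewrite projD proj_shift// addcK.
rewrite [leRHS](bigID (fun u : cube n => shell u == U)) /=.
rewrite [X in _ <= X + _](eq_bigl (fun u : cube n => shell u == U :> nat)); last first.
  by move=> u; case: eqP => [->|]; rewrite ?leqnn ?andbF.
rewrite [leLHS](eq_bigr (fun u => (2 ^- N * \sum_(a | (U <= shell (x + shift N o + a))%N)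
    schipp_row (F a) y (proj n a + (proj n x + shift n o + u))) ^+ 2)); last first.
  by move=> u /eqP uU; rewrite /Q uU [proj n x + u + _]addrAC.
by rewrite lerDl sumr_ge0// => u _; rewrite sqr_ge0.
Qed.

End OffDiagonal.
Arguments cell {R N} F {n} a b.

Section NearDiagonal.
Variables (R : realFieldType) (N : nat) (F : cube N -> cube N -> R).
Variables (delta : R) (K : nat) (x y : cube N).
Hypotheses (F_ge0 : forall a b, 0 <= F a b) (delta_gt0 : 0 < delta).
Hypothesis K_large : forall c, \sum_a F a (a + c) <= height delta K.

Definition diagonal_gauge (c : cube N) : R := row_gauge (fun a => F a (a + c)) delta K x.

Lemma diagonal_gauge_ge0 c : 0 <= diagonal_gauge c.
Proof. by apply/ltW/row_gauge_gt0. Qed.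

Variable n : nat.
Hypothesis nN : (n <= N)%N.

(** A diagonal of coarse cells consists of the fine diagonals [c'] that project to [c]. *)
Lemma sum_cell_diagonal (P : pred (cube n)) c :
  \sum_(a | P a) cell F a (a + c) =
  2 ^- N * \sum_(c' | proj n c' == c) 2 ^- N * \sum_(a | P (proj n a)) F a (a + c').
Proof.
have e a' : push (F a') (proj n a' + c) = 2 ^- N * \sum_(c' | proj n c' == c) F a' (a' + c').
  rewrite /push (reindex_inj (addrI a')) /=; congr (_ * _).
  by apply: eq_bigl => c'; rewrite projD (inj_eq (addrI _)).
transitivity (\sum_(a | P a) push (fun a' => push (F a') (proj n a' + c)) a).
  by apply: eq_bigr => a _; congr (_ * _); apply: eq_bigr => a' /eqP ->.
rewrite sum_push; congr (_ * _); under eq_bigr => a' _ do rewrite e.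
by rewrite -!mulr_sumr exchange_big.
Qed.

(** Equal shells imply [shell v <= shell u]. For fixed [i <= j], the cells met as [v] varies lie on
    the single diagonal [c], over an interval of level [j.-1]. By [mass_row_gauge] each fine
    diagonal has mass at most [2 ^- j.-1] times its gauge there, which cancels [2 ^+ j] up to the
    factor 2. Both shifts survive in [c]; hence the double sums. *)
Lemma near_diagonal_le u :
  near_diagonal (cell F) (proj n x) (proj n y) u <=
  2 * \sum_(i < (shell u).+2) \sum_(j < (shell u).+2 | (i <= j)%N)
    2 ^+ i * push diagonal_gauge (proj n (x + y) + u + shift n i + shift n j).
Proof.
have t0 v o o' : 0 <= schipp_term (proj n x) (proj n y) (cell F) u v o o'.
  by rewrite /schipp_term mulr_ge0 ?cell_ge0// mulr_ge0 ?exprn_ge0.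
apply: le_trans (_ : \sum_(v : cube n) \sum_(j < (shell u).+2) \sum_(i < (shell u).+2 | (i <= j)%N)
   (j <= (shell v).+1)%N%:R * schipp_term (proj n x) (proj n y) (cell F) u v j i <= _).
  rewrite /near_diagonal big_mkcond; apply: ler_sum => v _; case: eqP => [e|_]; last first.
    by do 2!(apply: sumr_ge0 => ? _); rewrite mulr_ge0.
  have vu : (shell v <= shell u)%N.
    by rewrite -[u](addcK v) [v + u]addrC shellD// e.
  rewrite (big_ord_widen (shell u).+2 (fun o => \sum_(o' < (shell v).+2 | (o' <= o)%N)
     schipp_term (proj n x) (proj n y) (cell F) u v o o')) ?ltnS//.
  rewrite big_mkcond; apply: ler_sum => o _ /=; rewrite ltnS.
  case: ifP => ov; last by apply: sumr_ge0 => o' _; rewrite mulr_ge0.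
  rewrite (big_ord_widen_cond (shell u).+2 (fun o' => o' <= o)%N
     (fun o' => schipp_term (proj n x) (proj n y) (cell F) u v o o')) ?ltnS//.
  rewrite big_mkcond [leRHS]big_mkcond; apply: ler_sum => o' _ /=.
  by case: (o' <= o)%N => //=; rewrite mul1r; case: ifP.
rewrite exchange_big /=; under eq_bigr => j _ do rewrite exchange_big /=.
rewrite (exchange_big_dep predT)//= mulr_sumr; apply: ler_sum => i _.
rewrite mulr_sumr; apply: ler_sum => j ij.
have jn : (j <= n.+1)%N by rewrite -ltnS (leq_trans (ltn_ord j))// !ltnS shell_le.
have j1n : (j.-1 <= n)%N by move: jn; case: (nat_of_ord j).
rewrite (reindex_inj (addrI (proj n x + shift n j))) /=.
pose c := proj n (x + y) + u + shift n i + shift n j.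
rewrite (eq_bigr (fun a => 2 ^+ j * 2 ^+ i * ((j.-1 <= shell (proj n x + shift n j + a))%N%:R *
    cell F a (a + c)))) => [|a _]; last first.
  rewrite (_ : (j <= _.+1)%N = (j.-1 <= shell (proj n x + shift n j + a))%N); last by case: (nat_of_ord j).
  rewrite /schipp_term mulrCA; congr (_ * (_ * cell F _ _)).
    by move: (proj n x) => p; cube_addition.
  by rewrite /c projD; move: (proj n x) (proj n y) => p q; cube_addition.
rewrite -mulr_sumr (eq_bigr (fun a => if (j.-1 <= shell (proj n x + shift n j + a))%N
  then cell F a (a + c) else 0)) => [|a _]; last by case: ifP; rewrite ?mul1r ?mul0r.
rewrite -big_mkcond /= sum_cell_diagonal -/c.
have jp : 2 ^+ j <= 2 * 2 ^+ j.-1 :> R.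
  by case: (nat_of_ord j) => [|j'] /=; rewrite ?exprS//; rewrite expr0; lra.
rewrite mulrA; apply: le_trans (_ : 2 ^+ j * 2 ^+ i * (2 ^- N *
  \sum_(c' | proj n c' == c) 2 ^- j.-1 * diagonal_gauge c') <= _).
  apply: ler_wpM2l; first by rewrite mulr_ge0 ?exprn_ge0.
  apply: ler_wpM2l; first by rewrite invr_ge0 exprn_ge0.
  apply: ler_sum => c' _.
  have h := mass_row_gauge (fun a => F_ge0 a (a + c')) delta_gt0 (K_large c') x
    (leq_trans j1n nN).
  rewrite -ler_pdivlMl ?exprn_gt0// in h; apply: le_trans h.
  rewrite -(mass_add _ _ (u := shift N j)); last first.
    case: (nat_of_ord j) j1n => [//|j'] /= j'n.
    by rewrite shell_unitc (leq_trans j'n).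
  rewrite le_eqVlt; apply/orP; left; apply/eqP; congr (_ * _); apply: eq_bigl => a.
  by rewrite -(proj_shift nN) -!projD shell_proj.
rewrite -mulr_sumr [2 ^- N * _]mulrCA -/(push diagonal_gauge c).
have p0 := push_ge0 (n := n) c diagonal_gauge_ge0.
rewrite -/c; set p := push _ _ in p0 *.
rewrite (_ : _ * _ * _ = (2 ^+ j / 2 ^+ j.-1) * (2 ^+ i * p)); last by ring.
rewrite -[leRHS]mulrA; apply: ler_wpM2r; first by rewrite mulr_ge0 ?exprn_ge0.
by rewrite ler_pdivrMr ?exprn_gt0.
Qed.

Lemma sum_near_diagonal :
  \sum_u near_diagonal (cell F) (proj n x) (proj n y) u ^+ 2 <=
  4 * 27 * \sum_(U < n.+1)
    wsum U (fun i j => energy n diagonal_gauge U (x + y + shift N i + shift N j)).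
Proof.
have o0 u : 0 <= near_diagonal (cell F) (proj n x) (proj n y) u.
  do 3!(apply: sumr_ge0 => ? _); rewrite /schipp_term; apply: mulr_ge0; [by rewrite mulr_ge0 ?exprn_ge0|exact: cell_ge0].
pose q (u : cube n) i j := push diagonal_gauge (proj n (x + y) + u + shift n i + shift n j).
apply: le_trans (_ : 4 * \sum_u (\sum_(i < (shell u).+2) \sum_(j < (shell u).+2 | (i <= j)%N)
    2 ^+ i * q u i j) ^+ 2 <= _).
  rewrite mulr_sumr; apply: ler_sum => u _; have h := near_diagonal_le u.
  rewrite [4](_ : _ = 2 ^+ 2) -?exprMn; last by rewrite expr2 -natrM.
  by rewrite ler_sqr ?nnegrE// (le_trans _ h).
rewrite -mulrA ler_pM2l// (partition_big (fun u : cube n => inord (shell u) : 'I_n.+1) predT)//=.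
rewrite mulr_sumr; apply: ler_sum => U _.
have Un : (U <= n)%N by rewrite -ltnS.
have eU (u : cube n) : (inord (shell u) == U :> 'I_n.+1) = (shell u == U :> nat).
  by rewrite -val_eqE /= inordK// ltnS shell_le.
rewrite (eq_bigl _ _ eU) (eq_bigr (fun u => (\sum_(i < U.+2) \sum_(j < U.+2 | (i <= j)%N)
    2 ^+ i * q u i j) ^+ 2)); last by move=> u /eqP ->.
apply: sum_sqr_wsum_le => i j ij jU.
rewrite /energy [leRHS](reindex_inj (addrI (proj n (x + y) + shift n i + shift n j))) /=.
rewrite [leRHS](eq_bigl (fun u : cube n => U <= shell u)%N) => [|u]; last first.
  by rewrite !projD !proj_shift// addcK.
rewrite [leRHS](bigID (fun u : cube n => shell u == U)) /=.
rewrite [X in _ <= X + _](eq_bigl (fun u : cube n => shell u == U :> nat)); last first.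
  by move=> u; case: eqP => [->|]; rewrite ?leqnn ?andbF.
rewrite [leLHS](eq_bigr (fun u => push diagonal_gauge
    (proj n (x + y) + shift n i + shift n j + u) ^+ 2)); last first.
  move=> u _; rewrite /q; congr (push _ _ ^+ 2).
  by move: (proj n (x + y)) => p; cube_addition.
by rewrite lerDl sumr_ge0// => u _; rewrite sqr_ge0.
Qed.

End NearDiagonal.

Section Truncation.
Variables (R : realFieldType) (N : nat).
Implicit Types (phi psi : cube N -> R).

Lemma mass_const k (c : R) (x : cube N) : (k <= N)%N -> mass k (fun=> c) x = 2 ^- k * c.
Proof.
move=> kN; have := sum_mass (fun=> c) kN.
rewrite (eq_bigr (fun=> mass k (fun=> c) x)) => [|z _]; last first.
  congr (_ * _); rewrite (reindex_inj (addrI (z + x))) /=; apply: eq_bigl => a.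
  by congr (_ <= shell _)%N; cube_addition.
move: (mass k _ x) => m; rewrite !sumr_const card_cube -[m *+ _]mulr_natr -[c *+ _]mulr_natr mulrA => /mulIf; apply.
by rewrite pnatr_eq0 -lt0n expn_gt0.
Qed.

(** A part of [phi] bounded by [mu] adds at most [mu] to every average. *)
Lemma bad_truncate phi psi mu k x : (k <= N)%N -> (forall a, phi a <= psi a + mu) ->
  bad phi (2 * mu) k x -> bad psi mu k x.
Proof.
move=> kN h /badP[l lk hl]; apply/badP; exists l => //.
have : 2 ^+ l * mass l phi x <= 2 ^+ l * mass l psi x + mu.
  apply: le_trans (_ : 2 ^+ l * mass l (fun a => psi a + mu) x <= _).
    by rewrite ler_wpM2l ?exprn_ge0// ler_mass.
  by rewrite massD mass_const ?(leq_trans lk)// mulrDr mulVKf// expf_neq0// pnatr_eq0.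
lra.
Qed.

(** By truncation and [sum_bad], the bad set at height [k] has at most [2 / height delta k] times
    the sum of [psi k] points. The height cancels in [sum_row_gauge]; this is the origin of the sum
    over [k] in the weak type inequality. *)
Lemma sum_row_gauge_truncate phi (psi : nat -> cube N -> R) delta K :
  (forall a, 0 <= phi a) -> (forall k a, 0 <= psi k a) -> 0 < delta ->
  \sum_a phi a <= height delta K ->
  (forall k a, phi a <= psi k a + height delta k / 2) ->
  \sum_y row_gauge phi delta K y <=
  600 * 301 * (delta * 2 ^+ N + 2 * \sum_(k < K) \sum_a psi k a).
Proof.
move=> p0 q0 d0 hK h; apply: le_trans (sum_row_gauge p0 d0 hK) _.
rewrite ler_pM2l ?mulr_gt0 ?ltr0n// lerD2l mulr_sumr; apply: ler_sum => k _.
have hk : 0 < height delta k / 2 by rewrite divr_gt0// height_gt0.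
apply: le_trans (_ : 2 * (height delta k / 2 *
    \sum_y (bad (psi k) (height delta k / 2) N y)%:R) <= _).
  rewrite mulrA [2 * _]mulrC divfK ?pnatr_eq0//.
  apply: ler_wpM2l; first exact/ltW/height_gt0.
  apply: ler_sum => y _; rewrite -[X in bad phi X](@divfK _ 2) ?pnatr_eq0// mulrC.
  by case b : (bad phi _ _ _) => //; rewrite (bad_truncate (leqnn N) (h k) b).
by rewrite ler_pM2l ?ltr0n// sum_bad.
Qed.

End Truncation.

Section FiniteMaximal.
Variables (R : realFieldType) (N : nat) (delta : R) (K : nat) (lam : R).
Hypotheses (delta_gt0 : 0 < delta) (lam_gt0 : 0 < lam).

Definition off_exceptional (F : cube N -> cube N -> R) x y :=
  exceptional (gauge F delta K y) (gauge_profile F delta K y) lam x.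

Definition near_exceptional (F : cube N -> cube N -> R) x y :=
  exceptional (diagonal_gauge F delta K x) (fun _ _ => 0) lam (x + y).

Section Sums.
Variables (F : cube N -> cube N -> R) (G : nat -> cube N -> cube N -> R).
Hypotheses (F_ge0 : forall a b, 0 <= F a b) (G_ge0 : forall k a b, 0 <= G k a b).
Hypothesis K_large : \sum_a \sum_b F a b <= height delta K.
Hypothesis FG : forall k a b, F a b <= G k a b + height delta k / 2.

Let total := delta * 4 ^+ N + 2 * \sum_(k < K) \sum_a \sum_b G k a b.

Lemma row_large a : \sum_b F a b <= height delta K.
Proof.
apply: le_trans K_large; rewrite [leRHS](bigD1 a)//= lerDl.
by apply: sumr_ge0 => ? _; apply: sumr_ge0.
Qed.

Lemma diagonal_large c : \sum_a F a (a + c) <= height delta K.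
Proof.
apply: le_trans K_large; apply: ler_sum => a _.
by rewrite [leRHS](bigD1 (a + c))//= lerDl sumr_ge0.
Qed.

(** Since the [c k a] sum to at most 1 over [k], both terms of [sum_exceptional] are at most
    [lam^-1] times the sum of [g]; hence [602 = 2 * 301]. *)
Lemma sum_weak (g : cube N -> R) (c : nat -> cube N -> R) : (forall a, 0 <= g a) -> (forall k a, 0 <= c k a) ->
  (forall a, \sum_(k < N) c k a <= 1) ->
  \sum_x (exceptional g c lam x)%:R <= 602 * (lam^-1 * \sum_x g x).
Proof.
move=> g0 c0 c1; apply: le_trans (sum_exceptional g0 c0 lam_gt0) _.
have h1 : \sum_x (bad g lam N x)%:R <= lam^-1 * \sum_x g x.
  by rewrite mulrC ler_pdivlMr// mulrC; exact: sum_bad.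
have h2 : lam^-1 * \sum_(k < N) \sum_x g x * c k x <= lam^-1 * \sum_x g x.
  rewrite ler_pM2l ?invr_gt0// exchange_big /=; apply: ler_sum => x _.
  by rewrite -mulr_sumr ler_piMr.
lra.
Qed.

Lemma total4 : 2 ^+ N * (delta * 2 ^+ N) = delta * 4 ^+ N.
Proof.
rewrite mulrCA; congr (_ * _); rewrite -exprMn; congr (_ ^+ _); by rewrite -natrM.
Qed.

Lemma sum_off_exceptional : \sum_x \sum_y (off_exceptional F x y)%:R <=
  602 * (600 * 301) * (lam^-1 * total).
Proof.
rewrite exchange_big /=.
apply: le_trans (_ : \sum_y 602 * (lam^-1 * \sum_x gauge F delta K y x) <= _).
  apply: ler_sum => y _; apply: sum_weak.
  - by move=> a; exact/ltW/row_gauge_gt0.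
  - by move=> k a; exact: row_profile_ge0.
  move=> a; apply: le_trans (sum_row_profile (F_ge0 a) delta_gt0 (row_large a) y).
  rewrite big_ord_recr /= lerDl; exact: row_profile_ge0.
rewrite -mulr_sumr -mulr_sumr exchange_big /= -mulrA ler_pM2l ?ltr0n// mulrCA ler_pM2l ?invr_gt0//.
apply: le_trans (_ : \sum_a 600 * 301 * (delta * 2 ^+ N + 2 * \sum_(k < K) \sum_b G k a b) <= _).
  by apply: ler_sum => a _; apply: (sum_row_gauge_truncate (psi := G^~ a)) => //; exact: row_large.
rewrite -mulr_sumr ler_pM2l ?mulr_gt0 ?ltr0n// big_split /= sumr_const card_cube -mulr_sumr.
by rewrite exchange_big /= -[_ *+ _]mulr_natl natrX total4.
Qed.

Lemma sum_near_exceptional : \sum_x \sum_y (near_exceptional F x y)%:R <=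
  602 * (600 * 301) * (lam^-1 * total).
Proof.
apply: le_trans (_ : \sum_x 602 * (lam^-1 * \sum_c diagonal_gauge F delta K x c) <= _).
  apply: ler_sum => x _; rewrite /near_exceptional.
  rewrite -(reindex_inj (addrI x) (P := predT)
     (F := fun z => (exceptional (diagonal_gauge F delta K x) (fun _ _ => 0) lam z)%:R)) /=.
  apply: sum_weak => [a|//|a]; first exact: diagonal_gauge_ge0.
  by rewrite big1.
rewrite -mulr_sumr -mulr_sumr exchange_big /= -mulrA ler_pM2l ?ltr0n// mulrCA ler_pM2l ?invr_gt0//.
apply: le_trans (_ : \sum_c 600 * 301 * (delta * 2 ^+ N + 2 * \sum_(k < K) \sum_a G k a (a + c)) <= _).
  apply: ler_sum => c _; apply: (sum_row_gauge_truncate (psi := fun k a => G k a (a + c))) => //.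
  exact: diagonal_large.
rewrite -mulr_sumr ler_pM2l ?mulr_gt0 ?ltr0n// big_split /= sumr_const card_cube -mulr_sumr.
rewrite exchange_big /= -[_ *+ _]mulr_natl natrX total4 lerD2l ler_pM2l ?ltr0n//.
apply: ler_sum => k _; rewrite exchange_big /=; apply: ler_sum => a _.
by rewrite [leRHS](reindex_inj (addrI a)).
Qed.

Variables (n : nat) (x y : cube N).
Hypothesis nN : (n <= N)%N.

Lemma off_diagonal_bound : ~~ off_exceptional F x y ->
  \sum_u off_diagonal (@cell _ _ F n) (proj n x) (proj n y) u ^+ 2 <=
  27 * (4 * 1321 * lam ^+ 2).
Proof.
move=> ex; apply: le_trans (sum_off_diagonal F_ge0 nN x y) _.
rewrite ler_pM2l ?ltr0n//; apply: functional_total ex => //.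
- by move=> a; exact/ltW/row_gauge_gt0.
- by move=> k a; exact: row_profile_ge0.
- move=> k z kn; apply: row_functional_mass => //; exact: row_large.
- move=> k z kn; apply: row_functional_split => //; exact: row_large.
Qed.

Lemma near_diagonal_bound : ~~ near_exceptional F x y ->
  \sum_u near_diagonal (@cell _ _ F n) (proj n x) (proj n y) u ^+ 2 <=
  108 * (4 * 1321 * lam ^+ 2).
Proof.
move=> ex; apply: le_trans (sum_near_diagonal x y F_ge0 delta_gt0 diagonal_large nN) _.
rewrite [4 * 27](_ : _ = 108); last by rewrite -natrM.
rewrite ler_pM2l ?ltr0n//; apply: functional_total ex => //.
- by move=> a; exact: diagonal_gauge_ge0.
- by move=> k z kn; apply: energy_mass => // a; exact: diagonal_gauge_ge0.
- move=> k z kn; rewrite energy_split//.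
  set th := energy n _.
  have h1 : 0 <= th k.+1 z by exact: energy_ge0.
  have h2 : 0 <= th k.+1 (z + unitc N k) by exact: energy_ge0.
  have h3 : 0 <= mass k (diagonal_gauge F delta K x) z * mass k (fun a =>
      diagonal_gauge F delta K x a * ((3 / 4) ^+ (n - k) + 0)) z.
    apply: mulr_ge0; apply: mass_ge0 => a; first exact: diagonal_gauge_ge0.
    by apply: mulr_ge0; [exact: diagonal_gauge_ge0|rewrite addr0 exprn_ge0//; lra].
  lra.
Qed.

End Sums.

(** [E] is the union of the off-diagonal and near-diagonal exceptional sets of [F] and of its
    transpose. The four square sums contribute [2 * (27 + 108) = 270], and the square of a sum of
    four terms the factor 4. [E] precedes [n] and [M], as a maximal inequality requires. *)
Theorem finite_maximal (F : cube N -> cube N -> R) (G : nat -> cube N -> cube N -> R) :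
  (forall a b, 0 <= F a b) -> (forall k a b, 0 <= G k a b) ->
  \sum_a \sum_b F a b <= height delta K ->
  (forall k a b, F a b <= G k a b + height delta k / 2) ->
  exists2 E : cube N -> cube N -> bool,
    \sum_x \sum_y (E x y)%:R <= 4 * (602 * (600 * 301) *
      (lam^-1 * (delta * 4 ^+ N + 2 * \sum_(k < K) \sum_a \sum_b G k a b))) &
    forall x y n (M : cube n -> cube n -> R), ~~ E x y -> (n <= N)%N ->
      (forall a b, `|M a b| <= cell F a b) ->
      2 ^- n * \sum_(m < 2 ^ n) square_psum M (proj n x) (proj n y) m ^+ 2 <=
      4 * 270 * (4 * 1321 * lam ^+ 2).
Proof.
move=> F0 G0 hK FG.
pose F' a b := F b a; pose G' k a b := G k b a.
have F'0 a b : 0 <= F' a b by exact: F0.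
have G'0 k a b : 0 <= G' k a b by exact: G0.
have hK' : \sum_a \sum_b F' a b <= height delta K by rewrite exchange_big.
have FG' k a b : F' a b <= G' k a b + height delta k / 2 by exact: FG.
pose E x y := [|| off_exceptional F x y, near_exceptional F x y,
  off_exceptional F' y x | near_exceptional F' y x].
exists E => [|x y n M].
  set T := 602 * _ * _.
  have GG : \sum_(k < K) \sum_a \sum_b G' k a b = \sum_(k < K) \sum_a \sum_b G k a b.
    by apply: eq_bigr => k _; rewrite exchange_big.
  have h1 := sum_off_exceptional F0 G0 hK FG.
  have h2 := sum_near_exceptional F0 G0 hK FG.
  have h3 := sum_off_exceptional F'0 G'0 hK' FG'.
  have h4 := sum_near_exceptional F'0 G'0 hK' FG'.
  rewrite GG -/T in h3 h4; rewrite -/T in h1 h2; rewrite exchange_big /= in h3.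
  rewrite exchange_big /= in h4.
  apply: le_trans (_ : \sum_x \sum_y ((off_exceptional F x y)%:R +
     (near_exceptional F x y)%:R + ((off_exceptional F' y x)%:R + (near_exceptional F' y x)%:R)) <= _).
    apply: ler_sum => x _; apply: ler_sum => y _; rewrite /E -!natrD ler_nat.
    by case: off_exceptional; case: near_exceptional; case: off_exceptional;
      case: near_exceptional.
  rewrite (eq_bigr (fun x => \sum_y (off_exceptional F x y)%:R + \sum_y (near_exceptional F x y)%:R
     + (\sum_y (off_exceptional F' y x)%:R + \sum_y (near_exceptional F' y x)%:R))); last first.
    by move=> x _; rewrite !big_split.
  rewrite !big_split /=; move: h1 h2 h3 h4; lra.
move=> /norP[e1 /norP[e2 /norP[e3 e4]]] nN hM.
have c0 a b : 0 <= @cell _ _ F n a b by exact: cell_ge0.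
have cT a b : @cell _ _ F n b a = @cell _ _ F' n a b.
  rewrite /cell /push -!mulr_sumr exchange_big /=; congr (_ * (_ * _)).
have oT u : off_diagonal (fun a b => @cell _ _ F n b a) (proj n y) (proj n x) u =
    off_diagonal (@cell _ _ F' n) (proj n y) (proj n x) u.
  by do 3!(apply: eq_bigr => ? _); rewrite /schipp_term cT.
have nT u : near_diagonal (fun a b => @cell _ _ F n b a) (proj n y) (proj n x) u =
    near_diagonal (@cell _ _ F' n) (proj n y) (proj n x) u.
  by do 3!(apply: eq_bigr => ? _); rewrite /schipp_term cT.
apply: le_trans (sum_sqr_psum _ _ hM) _.
have b1 := off_diagonal_bound F0 hK nN e1.
have b2 := near_diagonal_bound F0 hK nN e2.
have b3 := off_diagonal_bound F'0 hK' nN e3.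
have b4 := near_diagonal_bound F'0 hK' nN e4.
apply: le_trans (_ : 4 * (\sum_u off_diagonal (@cell _ _ F n) (proj n x) (proj n y) u ^+ 2 +
   \sum_u off_diagonal (@cell _ _ F' n) (proj n y) (proj n x) u ^+ 2 +
   (\sum_u near_diagonal (@cell _ _ F n) (proj n x) (proj n y) u ^+ 2 +
   \sum_u near_diagonal (@cell _ _ F' n) (proj n y) (proj n x) u ^+ 2)) <= _); last first.
  move: b1 b2 b3 b4; lra.
rewrite -!big_split mulr_sumr; apply: ler_sum => u _ /=.
have h := schipp_majorant_le (proj n x) (proj n y) u c0; rewrite oT nT in h.
have h0 : 0 <= schipp_majorant (proj n x) (proj n y) (@cell _ _ F n) u.
  do 3!(apply: sumr_ge0 => ? _); rewrite /schipp_term; apply: mulr_ge0; [by rewrite mulr_ge0 ?exprn_ge0|exact: c0].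
move: h; set p := off_diagonal _ _ _ _; set q := off_diagonal _ _ _ _.
set r := near_diagonal _ _ _ _; set s := near_diagonal _ _ _ _ => h.
apply: le_trans (_ : (p + q + (r + s)) ^+ 2 <= _).
  by rewrite ler_sqr ?nnegrE// (le_trans h0).
have := sqr_ge0 (p - q); have := sqr_ge0 (p - r); have := sqr_ge0 (p - s).
have := sqr_ge0 (q - r); have := sqr_ge0 (q - s); have := sqr_ge0 (r - s).
lra.
Qed.

End FiniteMaximal.

(** * Integration and cylinder functions *)

Section Integrable.
Context d (T : measurableType d) (R : realType) (mu : {measure set T -> \bar R}).
Hypothesis muT : (mu setT < +oo)%E.
Implicit Types f g : T -> R.

Definition L1 f : Prop := mu.-integrable setT (EFin \o f).

Definition integ f : R := \int[mu]_x f x.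

Lemma eq_L1 f g : f =1 g -> L1 f -> L1 g.
Proof. by move=> /funext ->. Qed.

Lemma L1_measurable f : L1 f -> measurable_fun setT f.
Proof. by move=> /measurable_int /measurable_EFinP. Qed.

Lemma L1_le f g : measurable_fun setT f -> (forall x, `|f x| <= g x) -> L1 g -> L1 f.
Proof.
move=> mf fg; apply: le_integrable => //; first exact/measurable_EFinP.
by move=> x _; rewrite !abse_EFin lee_fin (le_trans (fg x))// ler_norm.
Qed.

Lemma L1D f g : L1 f -> L1 g -> L1 (fun x => f x + g x).
Proof. by move=> hf hg; apply: eq_integrable (integrableD measurableT hf hg). Qed.

Lemma L1Z c f : L1 f -> L1 (fun x => c * f x).
Proof. by move=> hf; apply: eq_integrable (integrableZl measurableT c hf). Qed.

Lemma L1B f g : L1 f -> L1 g -> L1 (fun x => f x - g x).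
Proof. by move=> hf hg; apply: eq_integrable (integrableB measurableT hf hg). Qed.

Lemma L1_norm f : L1 f -> L1 (fun x => `|f x|).
Proof. exact: integrable_norm. Qed.

Lemma L1_sum (I : Type) (r : seq I) (P : pred I) (F : I -> T -> R) :
  (forall i, P i -> L1 (F i)) -> L1 (fun x => \sum_(i <- r | P i) F i x).
Proof.
move=> hF.
apply: eq_integrable (integrable_sum measurableT r (h := fun i => EFin \o F i) hF) => //.
by move=> x _; rewrite /= sumEFin.
Qed.

Lemma L1_bounded f c : measurable_fun setT f -> (forall x, `|f x| <= c) -> L1 f.
Proof.
move=> mf fc; apply: measurable_bounded_integrable => //.
by exists c; split; rewrite ?num_real// => M cM x _ /=; rewrite (le_trans (fc x))// ltW.
Qed.

Lemma L1_cst c : L1 (fun=> c).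
Proof. exact: (@L1_bounded _ `|c|). Qed.

Lemma integD f g : L1 f -> L1 g -> integ (fun x => f x + g x) = integ f + integ g.
Proof. by move=> hf hg; apply: RintegralD. Qed.

Lemma integZ c f : L1 f -> integ (fun x => c * f x) = c * integ f.
Proof. by move=> hf; apply: RintegralZl. Qed.

Lemma eq_integ f g : f =1 g -> integ f = integ g.
Proof. by move=> fg; congr integ; apply/funext. Qed.

Lemma integ_sum (I : Type) (r : seq I) (P : pred I) (F : I -> T -> R) :
  (forall i, P i -> L1 (F i)) ->
  integ (fun x => \sum_(i <- r | P i) F i x) = \sum_(i <- r | P i) integ (F i).
Proof.
move=> hF; elim: r => [|i r IH].
  under eq_integ do rewrite big_nil.
  by rewrite big_nil /integ Rintegral_cst// mul0r.
under eq_integ do rewrite big_cons.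
rewrite big_cons; case: ifPn => // Pi.
by rewrite (integD (hF i Pi) (L1_sum r hF)) IH.
Qed.

Lemma le_integ f g : L1 f -> L1 g -> (forall x, f x <= g x) -> integ f <= integ g.
Proof. by move=> hf hg fg; apply: le_Rintegral. Qed.

Lemma integ_ge0 f : (forall x, 0 <= f x) -> 0 <= integ f.
Proof. by move=> f0; apply: Rintegral_ge0. Qed.

Lemma norm_integ f : L1 f -> `|integ f| <= integ (fun x => `|f x|).
Proof. exact: le_normr_Rintegral. Qed.

Lemma L1_indic A : measurable A -> L1 (\1_A).
Proof.
move=> mA; apply: (@L1_bounded _ 1) => // x.
by rewrite indicE normr_nat lern1 leq_b1.
Qed.

Lemma integ_indic A : measurable A -> mu A = (integ (\1_A))%:E.
Proof.
move=> mA; rewrite /integ /Rintegral integral_indic// setIT fineK//.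
by rewrite ge0_fin_numE// (le_lt_trans _ muT)// le_measure// inE.
Qed.

Lemma measurable_norm_gt f (c : R) : measurable_fun setT f ->
  measurable [set x | c < `|f x|].
Proof.
move=> mf; have := measurableT_comp (@normr_measurable R setT) mf.
move=> /(_ measurableT _ (measurable_itv `]c, +oo[)).
rewrite setTI; congr measurable; apply/seteqP.
by split=> x /=; rewrite in_itv/= andbT.
Qed.

Lemma measurable_indicator_norm_gt f (c : R) : measurable_fun setT f ->
  measurable_fun setT (fun x => (c < `|f x|)%R%:R : R).
Proof.
move=> mf; rewrite (_ : (fun x => _) = \1_[set x | c < `|f x|]).
  by apply: measurable_indic; exact: measurable_norm_gt.
apply/funext => x; rewrite indicE; congr (_%:R); congr nat_of_bool.
by apply/idP/idP; rewrite inE.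
Qed.

Lemma measure_norm_gt f (c : R) : 0 < c -> L1 f ->
  (mu [set x | (c < `|f x|)%R] <= (c^-1 * integ (fun x => `|f x|))%:E)%E.
Proof.
move=> c0 hf; have mA := measurable_norm_gt c (L1_measurable hf).
rewrite integ_indic// lee_fin -integZ//; last exact: L1_norm.
apply: le_integ; [exact: L1_indic|exact/L1Z/L1_norm|move=> x].
rewrite indicE; have [|] := boolP (_ \in _).
  by rewrite inE/= => cf; rewrite mulrC ler_pdivlMr// mul1r ltW.
by move=> _; apply: mulr_ge0; rewrite ?invr_ge0 ?normr_ge0// ltW.
Qed.

End Integrable.

Definition trunc n (x : walsh_group) : cube n := [ffun i : 'I_n => x i].

Lemma proj_trunc n N x : (n <= N)%N -> proj n (trunc N x) = trunc n x.
Proof. by move=> nN; apply/ffunP => i; rewrite projE !ffunE. Qed.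

Definition cylinder n (a : cube n) : set walsh_group := [set x | trunc n x = a].

Lemma cylinderE n (a : cube n) :
  cylinder a = walsh_box (fun k => [set b | b = oapp a false (insub k)]) n.
Proof.
apply/seteqP; split=> x /=.
  by move=> <- k kn; rewrite insubT /= ffunE.
move=> h; apply/ffunP => i; rewrite ffunE (h i)// insubT//=.
by move=> i_lt; congr (fun_of_fin a _); exact: val_inj.
Qed.

Lemma measurable_cylinder n (a : cube n) : measurable (cylinder a).
Proof. by rewrite cylinderE; exact: measurable_walsh_box. Qed.

Lemma walsh_measure_cylinder (R : realType) n (a : cube n) :
  walsh_measure R (cylinder a) = (2 ^- n)%:E.
Proof.
rewrite cylinderE walsh_measureP (eq_bigr (fun=> (2^-1 : R)%:E)).
  by rewrite prodEFin prodr_const card_ord exprVn.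
by move=> i _; rewrite -(haarZ2_set1 R (oapp a false (insub (i : nat)))).
Qed.

Section TwoDim.
Variable R : realType.
Local Notation plane := (walsh_group * walsh_group)%type.
Local Notation mu2 := (walsh_measure R \x walsh_measure R)%E.
Implicit Types (f g : plane -> R) (z : plane).

Lemma mu2X A B : measurable A -> measurable B ->
  mu2 (A `*` B) = (walsh_measure R A * walsh_measure R B)%E.
Proof. exact: product_measure1E. Qed.

Lemma mu2_setT : mu2 setT = 1%E.
Proof.
by rewrite -setXTT mu2X// !probability_setT mule1.
Qed.

Lemma mu2_fin : (mu2 setT < +oo)%E.
Proof. by rewrite mu2_setT ltry. Qed.

Local Notation L1 := (L1 mu2).
Local Notation integ := (integ mu2).

Definition on_cell n (a b : cube n) z : R :=
  ((trunc n z.1 == a) && (trunc n z.2 == b))%:R.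

Lemma on_cellE n (a b : cube n) : on_cell a b = \1_(cylinder a `*` cylinder b).
Proof.
apply/funext => z; rewrite /on_cell indicE; congr (_%:R); congr nat_of_bool.
apply/andP/idP; first by move=> [/eqP h1 /eqP h2]; rewrite inE.
by rewrite inE => -[h1 h2]; split; apply/eqP.
Qed.

Lemma L1_on_cell n (a b : cube n) : L1 (on_cell a b).
Proof.
rewrite on_cellE; apply: L1_indic; first exact: mu2_fin.
by apply: measurableX; exact: measurable_cylinder.
Qed.

Lemma integ_on_cell n (a b : cube n) : integ (on_cell a b) = 4 ^- n.
Proof.
have mA : measurable (cylinder a `*` cylinder b).
  by apply: measurableX; exact: measurable_cylinder.
apply: EFin_inj; rewrite on_cellE -(integ_indic mu2_fin mA).
apply: etrans (mu2X (measurable_cylinder a) (measurable_cylinder b)) _.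
by rewrite !walsh_measure_cylinder -EFinM -!exprVn -exprMn -invfM -natrM.
Qed.

Lemma sum_on_cell n (phi : cube n -> cube n -> R) z :
  \sum_a \sum_b phi a b * on_cell a b z = phi (trunc n z.1) (trunc n z.2).
Proof.
rewrite (bigD1 (trunc n z.1))//= (bigD1 (trunc n z.2))//= /on_cell !eqxx/= mulr1.
rewrite !big1 ?addr0// => [a az|b bz].
  by apply: big1 => b _; rewrite eq_sym (negbTE az)/= mulr0.
by rewrite eq_sym (negbTE bz)/= mulr0.
Qed.

Lemma L1_cylinder_fun n (phi : cube n -> cube n -> R) :
  L1 (fun z => phi (trunc n z.1) (trunc n z.2)).
Proof.
apply: eq_L1 (sum_on_cell phi) _.
by do 2 (apply: L1_sum => ? _); exact/L1Z/L1_on_cell.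
Qed.

Lemma L1M_on_cell n (a b : cube n) g : L1 g -> L1 (fun z => g z * on_cell a b z).
Proof.
move=> hg; apply: (L1_le _ _ (L1_norm hg)).
  by apply: measurable_funM; [exact: L1_measurable hg|exact: L1_measurable (L1_on_cell a b)].
by move=> z; rewrite normrM normr_nat ler_piMr// lern1 leq_b1.
Qed.

Definition cell_integ g n (a b : cube n) : R := integ (fun z => g z * on_cell a b z).

Lemma integ_cylinder_fun g n (phi : cube n -> cube n -> R) : L1 g ->
  integ (fun z => g z * phi (trunc n z.1) (trunc n z.2)) =
  \sum_a \sum_b phi a b * cell_integ g a b.
Proof.
move=> hg; under eq_integ => z do rewrite -sum_on_cell mulr_sumr.
have h a b : L1 (fun z => g z * (phi a b * on_cell a b z)).
  apply: eq_L1 (L1Z (phi a b) (L1M_on_cell a b hg)) => z.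
  by rewrite mulrCA.
rewrite integ_sum => [|a _]; last first.
  apply: eq_L1 (L1_sum _ (fun b _ => h a b)) => z.
  by rewrite mulr_sumr.
apply: eq_bigr => a _; under eq_integ do rewrite mulr_sumr.
rewrite integ_sum//.
apply: eq_bigr => b _; under eq_integ do rewrite mulrCA.
by rewrite integZ//; exact: L1M_on_cell.
Qed.

Lemma sum_cell_integ g n : L1 g -> \sum_a \sum_b @cell_integ g n a b = integ g.
Proof.
move=> hg; have := integ_cylinder_fun (fun _ _ : cube n => 1) hg.
under eq_integ do rewrite mulr1.
by move=> ->; do 2 (apply: eq_bigr => ? _); rewrite mul1r.
Qed.

(** The factor [4 ^+ N] turns integrals over cells into averages, which [cell] integrates over the
    finite group. *)
Lemma cell_cell_integ g n N (a b : cube n) : L1 g -> (n <= N)%N ->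
  cell (fun a' b' : cube N => 4 ^+ N * cell_integ g a' b') a b = cell_integ g a b.
Proof.
move=> hg nN; rewrite {2}/cell_integ.
have := @integ_cylinder_fun g N (fun a' b' => ((proj n a' == a) && (proj n b' == b))%:R) hg.
under eq_integ do rewrite !proj_trunc//.
move=> ->; rewrite /cell /push mulr_sumr [RHS](bigID (fun a' => proj n a' == a)) /=.
rewrite [X in _ = _ + X]big1 ?addr0 => [|a' /negbTE ->]; last first.
  by rewrite big1// => b' _; rewrite mul0r.
apply: eq_bigr => a' ->; rewrite mulrA [RHS](bigID (fun b' => proj n b' == b)) /=.
rewrite [X in _ = _ + X]big1 ?addr0 => [|b' /negbTE ->]; last by rewrite mul0r.
rewrite mulr_sumr; apply: eq_bigr => b' ->; rewrite mul1r mulrA.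
rewrite -invfM -exprMn -natrM mulVf ?mul1r// expf_neq0//.
Qed.

Lemma cell_integ_ge0 g n (a b : cube n) : (forall z, 0 <= g z) -> 0 <= cell_integ g a b.
Proof. by move=> g0; apply: integ_ge0 => z; rewrite mulr_ge0 ?ler0n. Qed.

Lemma norm_cell_integ g n (a b : cube n) : L1 g ->
  `|cell_integ g a b| <= cell_integ (fun z => `|g z|) a b.
Proof.
move=> hg; apply: le_trans (norm_integ (L1M_on_cell a b hg)) _.
by rewrite (eq_integ mu2 (g := fun z => `|g z| * on_cell a b z))// => z; rewrite normrM normr_nat.
Qed.

Lemma measurable_cylinder_set n (c : cube n -> cube n -> bool) :
  measurable [set z : plane | c (trunc n z.1) (trunc n z.2)].
Proof.
have := L1_measurable (L1_cylinder_fun (fun a b => (c a b)%:R)) measurableT (measurable_set1 1).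
rewrite setTI; congr measurable; apply/seteqP; split=> z /=; last by move=> ->.
by case: c => // /eqP; rewrite eq_sym oner_eq0.
Qed.

Lemma mu2_cylinder_set n (c : cube n -> cube n -> bool) :
  mu2 [set z : plane | c (trunc n z.1) (trunc n z.2)] =
  (4 ^- n * \sum_a \sum_b (c a b)%:R)%:E.
Proof.
rewrite (integ_indic mu2_fin (measurable_cylinder_set c)); congr EFin.
have h1 : L1 (fun=> 1) by apply: L1_cst; exact: mu2_fin.
have := integ_cylinder_fun (fun a b : cube n => (c a b)%:R) h1.
rewrite (eq_integ mu2 (g := \1_[set z : plane | c (trunc n z.1) (trunc n z.2)])) => [->|z].
  rewrite mulr_sumr; apply: eq_bigr => a _; rewrite mulr_sumr; apply: eq_bigr => b _.
  rewrite mulrC -(integ_on_cell a b); congr (_ * _).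
  by apply: eq_integ => z; rewrite mul1r.
by rewrite mul1r indicE; congr (_%:R); congr nat_of_bool; apply/idP/idP; rewrite inE.
Qed.

End TwoDim.

(** [walsh] has [m] factors and [wal] has [n]; both products are compared with the one of [m + n]
    factors, as the further digits of [m] vanish. *)
Lemma walsh_trunc (R : realType) n m x : (m < 2 ^ n)%N ->
  walsh R m x = wal R m (trunc n x).
Proof.
move=> mn; pose F k : R := if bit m k then (-1) ^+ x k else 1.
have widen p q : (m < 2 ^ p)%N -> \prod_(k < p + q) F k = \prod_(k < p) F k.
  move=> mp; rewrite big_split_ord /= [X in _ * X]big1 ?mulr1// => k _.
  by rewrite /F bit_small// (leq_trans mp)// leq_exp2l// leq_addr.
transitivity (\prod_(k < m) F k).
  by apply: eq_bigr => k _; rewrite /F /rademacher /binary_digit /bit; case: odd.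
have mm : (m < 2 ^ m)%N by exact: ltn_expl.
transitivity (\prod_(k < m + n) F k); first by rewrite (widen _ _ mm).
rewrite addnC (widen _ _ mn).
by apply: eq_bigr => k _; rewrite /F ffunE.
Qed.

Lemma top_bit k : (0 < k)%N -> bit k (trunc_log 2 k).
Proof.
move=> k0; have [h1 h2] := andP (trunc_log_bounds (isT : 1 < 2)%N k0).
rewrite /bit (_ : k %/ _ = 1)%N//; apply/eqP; rewrite eqn_leq.
by rewrite -ltnS ltn_divLR ?expn_gt0// -expnS h2 divn_gt0 ?expn_gt0.
Qed.

(** * Cylinder functions and the reduction of partial sums to finite groups *)

Section FiniteDirichlet.
Variables (R : realFieldType) (n : nat).
Implicit Types (x : cube n).

(* Translation by unitc n j changes the sign of wal k. *)
Lemma sum_wal_eq0 k j (chi : cube n -> R) x : (j < n)%N -> bit k j ->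
  (forall a, chi (a + unitc n j) = chi a) -> \sum_a chi a * wal R k (x + a) = 0.
Proof.
move=> jn kj chij; suff h : \sum_a chi a * wal R k (x + a) = - \sum_a chi a * wal R k (x + a).
  lra.
rewrite {1}(reindex_inj (addIr (unitc n j))) -sumrN /=.
apply: eq_bigr => a _; rewrite chij addrA [wal R k (x + a + _)]walD wal_unitc// kj expr1 mulrN1.
by rewrite mulrN.
Qed.

(** An index [k >= 2 ^ n0] has a digit 1 at a position at least [n0], so [w_k] is orthogonal to
    functions of the first [n0] coordinates. Thus [D_m] may be replaced by [D_(2 ^ n0)], on whose
    support [psi] is constant; its total is found from the function 1, where only [k = 0]
    survives. *)
Lemma sum_dirichlet_proj n0 m (psi : cube n0 -> R) x :
  (2 ^ n0 <= m)%N -> (m <= 2 ^ n)%N ->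
  \sum_a psi (proj n0 a) * dirichlet R m (x + a) = 2 ^+ n * psi (proj n0 x).
Proof.
move=> n0m mn.
have n0n : (n0 <= n)%N by rewrite -(leq_exp2l n0 n (isT : 1 < 2)%N) (leq_trans n0m).
have vanish k (chi : cube n0 -> R) : (2 ^ n0 <= k)%N -> (k < 2 ^ n)%N ->
    \sum_a chi (proj n0 a) * wal R k (x + a) = 0.
  move=> n0k kn; have k0 : (0 < k)%N by apply: leq_trans n0k; rewrite expn_gt0.
  have h1 := trunc_log_max (isT : 1 < 2)%N n0k.
  apply: sum_wal_eq0 (top_bit k0) _.
    rewrite -(ltn_exp2l _ n (isT : 1 < 2)%N); apply: leq_ltn_trans kn.
    by have [] := andP (trunc_log_bounds (isT : 1 < 2)%N k0).
  by move=> a; rewrite projD proj_unitc// unitc_ge// addr0.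
have big chi : \sum_a chi (proj n0 a) * dirichlet R m (x + a) =
    \sum_a chi (proj n0 a) * dirichlet R (2 ^ n0) (x + a).
  rewrite -(subnKC n0m) /dirichlet.
  under eq_bigr => a _ do rewrite (sum_ord_add (fun k => wal R k (x + a))) mulrDr.
  rewrite big_split /= [X in _ + X](_ : _ = 0) ?addr0//.
  under eq_bigr => a _ do rewrite mulr_sumr.
  rewrite exchange_big big1// => k _; apply: vanish; first exact: leq_addr.
  by apply: leq_trans mn; rewrite -ltn_subRL.
have ball a : psi (proj n0 a) * dirichlet R (2 ^ n0) (x + a) =
    psi (proj n0 x) * (1 * dirichlet R (2 ^ n0) (x + a)).
  rewrite dirichlet_pow2//; case h : (n0 <= shell (x + a))%N; last by rewrite !mulr0.
  congr (_ * _); last by rewrite mul1r.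
  move: h; rewrite -(shell_proj n0n)// shell_eqn projD => /eqP h.
  by rewrite -[in RHS](addcK (proj n0 a) (proj n0 x)) [proj n0 a + proj n0 x]addrC h addr0.
rewrite big (eq_bigr _ (fun a _ => ball a)) -mulr_sumr mulrC; congr (_ * _).
rewrite -(big (fun=> 1)).
have m0 : (0 < m)%N by apply: leq_trans n0m; rewrite expn_gt0.
transitivity (\sum_a \sum_(k < m) 1 * wal R k (x + a)).
  by apply: eq_bigr => a _; rewrite mul1r; apply: eq_bigr => k _; rewrite mul1r.
rewrite exchange_big (bigD1 (Ordinal m0)) //= [X in _ + X]big1 ?addr0.
  under eq_bigr => a _ do rewrite mul1r (@wal_ball R n 0 0)//.
  by rewrite sumr_const card_cube natrX.
move=> k k0; have k0' : (0 < k)%N by rewrite lt0n.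
apply: sum_wal_eq0 (top_bit k0') _ => //.
rewrite -(ltn_exp2l _ n (isT : 1 < 2)%N); apply: leq_ltn_trans (leq_trans (ltn_ord k) mn).
by have [] := andP (trunc_log_bounds (isT : 1 < 2)%N k0').
Qed.

End FiniteDirichlet.

Section Psum.
Variable R : realType.
Local Notation plane := (walsh_group * walsh_group)%type.
Local Notation mu2 := (walsh_measure R \x walsh_measure R)%E.
Local Notation L1 := (L1 mu2).
Implicit Types (f g : plane -> R) (z : plane).

Lemma walsh_psumE n m z f : L1 f -> (m <= 2 ^ n)%N ->
  walsh_psum m m z f =
  square_psum (@cell_integ R f n) (trunc n z.1) (trunc n z.2) m.
Proof.
move=> hf mn; rewrite /walsh_psum /square_psum.
transitivity (\sum_(i < m) \sum_(j < m) \sum_a \sum_b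
    wal R i (trunc n z.1) * wal R j (trunc n z.2) *
    (wal R i a * wal R j b * @cell_integ R f n a b)).
  apply: eq_bigr => i _; apply: eq_bigr => j _.
  have im := leq_trans (ltn_ord i) mn; have jm := leq_trans (ltn_ord j) mn.
  rewrite /walsh_coef -/(integ mu2 _) (eq_integ mu2 (g := fun z => f z *
      (wal R i (trunc n z.1) * wal R j (trunc n z.2)))); last first.
    by move=> u; rewrite !(walsh_trunc _ _ im) !(walsh_trunc _ _ jm) mulrA.
  rewrite (integ_cylinder_fun (fun a b => wal R i a * wal R j b) hf).
  rewrite !(walsh_trunc _ _ im) !(walsh_trunc _ _ jm) -mulrA mulrC mulr_sumr.
  by apply: eq_bigr => a _; rewrite mulr_sumr.
transitivity (\sum_(i < m) \sum_a \sum_b \sum_(j < m)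
    wal R i (trunc n z.1) * wal R j (trunc n z.2) *
    (wal R i a * wal R j b * @cell_integ R f n a b)).
  apply: eq_bigr => i _; rewrite exchange_big; apply: eq_bigr => a _.
  by rewrite exchange_big.
rewrite exchange_big; apply: eq_bigr => a _.
rewrite exchange_big; apply: eq_bigr => b _.
rewrite /dirichlet big_distrlr /= mulr_sumr; apply: eq_bigr => i _.
rewrite mulr_sumr; apply: eq_bigr => j _; rewrite !walD.
ring.
Qed.

Lemma walsh_psumD m z f g : L1 f -> L1 g ->
  walsh_psum m m z (fun u => f u + g u) = walsh_psum m m z f + walsh_psum m m z g.
Proof.
move=> hf hg; have mm : (m <= 2 ^ m)%N by rewrite ltnW// ltn_expl.
rewrite (walsh_psumE _ hf mm) (walsh_psumE _ hg mm) (walsh_psumE _ (L1D hf hg) mm).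
rewrite /square_psum -big_split; apply: eq_bigr => a _ /=.
rewrite -big_split; apply: eq_bigr => b _ /=; rewrite -mulrDl; congr (_ * _).
rewrite /cell_integ; under eq_integ do rewrite mulrDl.
by apply: integD; exact: L1M_on_cell.
Qed.

Lemma walsh_psum_cylinder_fun n0 (phi : cube n0 -> cube n0 -> R) m z : (2 ^ n0 <= m)%N ->
  walsh_psum m m z (fun u => phi (trunc n0 u.1) (trunc n0 u.2)) =
  phi (trunc n0 z.1) (trunc n0 z.2).
Proof.
move=> n0m; have mm : (m <= 2 ^ m)%N by rewrite ltnW// ltn_expl.
have n0n : (n0 <= m)%N by rewrite -(leq_exp2l n0 m (isT : 1 < 2)%N) (leq_trans n0m).
rewrite (walsh_psumE _ (L1_cylinder_fun phi) mm) /square_psum.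
transitivity (\sum_(a : cube m) \sum_(b : cube m) 4 ^- m * (phi (proj n0 a) (proj n0 b) *
    (dirichlet R m (trunc m z.1 + a) * dirichlet R m (trunc m z.2 + b)))).
  apply: eq_bigr => a _; apply: eq_bigr => b _; rewrite [RHS]mulrA; congr (_ * _).
  rewrite -(integ_on_cell R a b) [RHS]mulrC -(integZ _ (L1_on_cell R a b)).
  apply: eq_integ => u; rewrite /on_cell; case: eqP => [<-|]; last by rewrite !mulr0.
  case: eqP => [<-|]; last by rewrite !mulr0.
  by rewrite !proj_trunc.
transitivity (\sum_(a : cube m) 4 ^- m * (dirichlet R m (trunc m z.1 + a) *
    (2 ^+ m * phi (proj n0 a) (trunc n0 z.2)))).
  apply: eq_bigr => a _; rewrite -mulr_sumr; congr (_ * _).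
  rewrite -(proj_trunc z.2 n0n) -(sum_dirichlet_proj (phi (proj n0 a)) _ n0m mm) mulr_sumr.
  by apply: eq_bigr => b _; rewrite mulrCA.
rewrite -mulr_sumr.
transitivity (4 ^- m * (2 ^+ m * \sum_(a : cube m) phi (proj n0 a) (trunc n0 z.2) *
    dirichlet R m (trunc m z.1 + a))).
  congr (_ * _); rewrite mulr_sumr; apply: eq_bigr => a _; ring.
rewrite (sum_dirichlet_proj (phi ^~ (trunc n0 z.2)) _ n0m mm) proj_trunc//.
by rewrite [X in _ * X]mulrA -exprMn -natrM mulKf// expf_neq0.
Qed.

End Psum.

(** * The maximal inequality *)

Section Maximal.
Variable R : realType.
Local Notation plane := (walsh_group * walsh_group)%type.
Local Notation mu2 := (walsh_measure R \x walsh_measure R)%E.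
Local Notation L1 := (L1 mu2).
Local Notation integ := (integ mu2).
Implicit Types (f g : plane -> R) (z : plane).

Definition large_part (h : R) f z : R := `|f z| * (h < `|f z|)%R%:R.

Lemma large_part_ge0 h f z : 0 <= large_part h f z.
Proof. by rewrite /large_part mulr_ge0 ?ler0n. Qed.

Lemma large_part_le h f z : large_part h f z <= `|f z|.
Proof. by rewrite /large_part ler_piMr// lern1 leq_b1. Qed.

Lemma norm_le_large_part (h : R) f z : 0 <= h -> `|f z| <= large_part h f z + h.
Proof.
by rewrite /large_part => h0; case: ltP => [_|]; rewrite ?mulr1 ?mulr0 ?add0r// lerDl.
Qed.

Lemma measurable_large_part (h : R) f : measurable_fun setT f ->
  measurable_fun setT (large_part h f).
Proof.
move=> mf; apply: measurable_funM; first exact: measurableT_comp.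
exact: measurable_indicator_norm_gt.
Qed.

Lemma L1_large_part h f : L1 f -> L1 (large_part h f).
Proof.
move=> hf; apply: (L1_le _ _ (L1_norm hf)).
  by apply: measurable_large_part; exact: L1_measurable hf.
by move=> z; rewrite ger0_norm ?large_part_ge0// large_part_le.
Qed.

Definition strong_mean f n z : R :=
  2 ^- n * \sum_(m < 2 ^ n) walsh_psum m m z f ^+ 2.

Definition strong_mean_const : R := 4 * 270 * (4 * 1321).

Definition weak_type_const : R := 4 * (602 * (600 * 301)).

Lemma strong_mean_const_ge1 : 1 <= strong_mean_const.
Proof. rewrite /strong_mean_const; lra. Qed.

Lemma weak_type_const_ge1 : 1 <= weak_type_const.
Proof. rewrite /weak_type_const; lra. Qed.

Lemma exists_height (delta c : R) : 0 < delta -> exists K, c <= height delta K.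
Proof.
move=> d0; exists (Num.truncn (c / delta)).+1.
rewrite /height mulrC -ler_pdivrMr//; apply: le_trans (ltW (truncnS_gt _)) _.
by rewrite -natrX ler_nat ltnW// ltn_expl.
Qed.

(** The points at which some [n <= N] violates the bound form a cylinder set increasing with [N];
    the finite inequality bounds its measure independently of [N], and continuity from below gives
    the union. All [K] are needed since the admissible [K] depends on [N]. *)
Lemma strong_maximal f (delta lam B : R) : L1 f -> 0 < delta -> 0 < lam ->
  (forall K, \sum_(k < K) integ (large_part (height delta k / 2) f) <= B) ->
  exists2 E : set plane, measurable E /\
    (mu2 E <= (weak_type_const * (lam^-1 * (delta + 2 * B)))%:E)%E &
    forall z n, ~ E z -> strong_mean f n z <= strong_mean_const * lam ^+ 2.
Proof.
move=> hf d0 l0 hB.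
pose c N (a b : cube N) : bool := [exists n : 'I_N.+1,
  strong_mean_const * lam ^+ 2 <
  2 ^- n * \sum_(m < 2 ^ n) square_psum (@cell_integ R f n) (proj n a) (proj n b) m ^+ 2].
pose U N := [set z : plane | c N (trunc N z.1) (trunc N z.2)].
have UE N z : U N z <-> exists2 n, (n <= N)%N & strong_mean_const * lam ^+ 2 < strong_mean f n z.
  have cE n : (n <= N)%N -> strong_mean f n z = 2 ^- n * \sum_(m < 2 ^ n) square_psum
      (@cell_integ R f n) (proj n (trunc N z.1)) (proj n (trunc N z.2)) m ^+ 2.
    move=> nN; congr (_ * _); apply: eq_bigr => m _.
    by rewrite (walsh_psumE _ hf (ltnW (ltn_ord m))) !proj_trunc.
  split=> [/existsP[n hn]|[n nN hn]].
    by exists n; [rewrite -ltnS|rewrite cE// -ltnS].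
  by apply/existsP; exists (Ordinal (nN : (n < N.+1)%N)); rewrite -cE.
have mU N : measurable (U N) by exact: measurable_cylinder_set.
exists (\bigcup_N U N); last first.
  move=> z n nE; rewrite leNgt; apply/negP => h; apply: nE.
  by exists n => //; apply/UE; exists n.
split; first exact: bigcupT_measurable.
have ndU : nondecreasing_seq U.
  move=> N M NM; apply/subsetPset => z /UE[n nN h]; apply/UE; exists n => //.
  exact: leq_trans nN NM.
have cvU := @nondecreasing_cvg_mu _ _ _ mu2 U mU (bigcupT_measurable U mU) ndU.
rewrite -(cvg_lim _ cvU)//; apply: lime_le; first by apply/cvg_ex; eexists; exact: cvU.
apply: nearW => N /=.
have habs : L1 (fun z => `|f z|) := L1_norm hf.
pose F (a b : cube N) := 4 ^+ N * cell_integ (fun z => `|f z|) a b.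
pose G k (a b : cube N) := 4 ^+ N * cell_integ (large_part (height delta k / 2) f) a b.
have p4 : 0 <= 4 ^+ N :> R by rewrite exprn_ge0.
have [K hK] := exists_height (\sum_a \sum_b F a b) d0.
have F0 a b : 0 <= F a b.
  by apply: mulr_ge0 => //; apply: cell_integ_ge0 => z; rewrite normr_ge0.
have G0 k a b : 0 <= G k a b.
  by apply: mulr_ge0 => //; apply: cell_integ_ge0 => z; exact: large_part_ge0.
have h0 k : 0 <= height delta k / 2.
  by apply: mulr_ge0; [apply: mulr_ge0; [exact: ltW|rewrite exprn_ge0]|].
have FG k a b : F a b <= G k a b + height delta k / 2.
  have hg := L1_large_part (height delta k / 2) hf.
  rewrite /F /G -{2}[height delta k / 2](mulVKf (_ : 4 ^+ N != 0)) ?expf_neq0//.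
  rewrite -mulrDr ler_wpM2l// -(integ_on_cell R a b).
  rewrite [integ _ * _]mulrC -integZ; last exact: L1_on_cell.
  rewrite -integD; [|exact: L1M_on_cell|exact/L1Z/L1_on_cell].
  apply: le_integ; [exact: L1M_on_cell| |].
    by apply: L1D; [exact: L1M_on_cell|exact/L1Z/L1_on_cell].
  by move=> z; rewrite -mulrDl ler_wpM2r ?ler0n// norm_le_large_part.
have [E hE1 hE2] := finite_maximal d0 l0 F0 G0 hK FG.
rewrite (mu2_cylinder_set R (c N)) lee_fin.
apply: le_trans (_ : 4 ^- N * (weak_type_const * (lam^-1 *
    (delta * 4 ^+ N + 2 * \sum_(k < K) \sum_a \sum_b G k a b))) <= _).
  apply: ler_wpM2l; first by rewrite invr_ge0.
  rewrite /weak_type_const -[X in _ <= X]mulrA; apply: (le_trans _ hE1); apply: ler_sum => a _; apply: ler_sum => b _.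
  rewrite ler_nat; case Eab : (E a b); first exact: leq_b1.
  rewrite leqn0 eqb0; apply/existsPn => n; rewrite -leNgt.
  rewrite /strong_mean_const -[X in _ <= X]mulrA; apply: hE2; [by rewrite Eab|by rewrite -ltnS|].
  move=> a' b'; rewrite cell_cell_integ//; last by rewrite -ltnS.
  exact: norm_cell_integ.
rewrite mulrCA; apply: ler_wpM2l; first exact: le_trans ler01 weak_type_const_ge1.
rewrite mulrCA; apply: ler_wpM2l; first by rewrite invr_ge0 ltW.
have -> : \sum_(k < K) \sum_a \sum_b G k a b =
    4 ^+ N * \sum_(k < K) integ (large_part (height delta k / 2) f).
  rewrite mulr_sumr; apply: eq_bigr => k _.
  rewrite -(sum_cell_integ N (L1_large_part _ hf)) mulr_sumr; apply: eq_bigr => a _.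
  by rewrite mulr_sumr.
rewrite mulrCA -[delta * _]mulrC -mulrDr mulKf ?expf_neq0// lerD2l ler_wpM2l//.
Qed.

End Maximal.

(** * Density of cylinder functions *)

Section Density.
Variable R : realType.
Local Notation plane := (walsh_group * walsh_group)%type.
Local Notation mu2 := (walsh_measure R \x walsh_measure R)%E.
Local Notation L1 := (L1 mu2).
Local Notation integ := (integ mu2).
Implicit Types (f g : plane -> R) (z : plane).

Definition L1dist f g : R := integ (fun z => `|f z - g z|).

Definition cylinder_fun n (phi : cube n -> cube n -> R) z : R :=
  phi (trunc n z.1) (trunc n z.2).

Definition approximable f : Prop :=
  L1 f /\ forall e, 0 < e -> exists n (phi : cube n -> cube n -> R),
    L1dist f (cylinder_fun phi) <= e.

Lemma L1_cyl n (phi : cube n -> cube n -> R) : L1 (cylinder_fun phi).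
Proof. exact: L1_cylinder_fun. Qed.

Lemma L1dist_trans f g h : L1 f -> L1 g -> L1 h ->
  L1dist f h <= L1dist f g + L1dist g h.
Proof.
move=> hf hg hh; rewrite /L1dist -integD; [|exact/L1_norm/L1B|exact/L1_norm/L1B].
apply: le_integ; [exact/L1_norm/L1B|by apply: L1D; exact/L1_norm/L1B|].
by move=> z; exact: ler_distD.
Qed.

Lemma approximable_cyl n (phi : cube n -> cube n -> R) : approximable (cylinder_fun phi).
Proof.
split=> [|e e0]; first exact: L1_cyl.
exists n, phi; rewrite /L1dist (eq_integ mu2 (g := fun=> 0)) => [|z].
  by rewrite /integ Rintegral_cst// mul0r ltW.
by rewrite subrr normr0.
Qed.

(** Covers sums, differences and maxima; the last give unions of sets. Both cylinder functions are
    read at the common level [maxn n m]. *)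
Lemma approximable2 (h : R -> R -> R) f g :
  (forall a b a' b', `|h a b - h a' b'| <= `|a - a'| + `|b - b'|) ->
  L1 (fun z => h (f z) (g z)) ->
  approximable f -> approximable g -> approximable (fun z => h (f z) (g z)).
Proof.
move=> hh hfg [hf af] [hg ag]; split=> // e e0.
have e2 : 0 < e / 2 by rewrite divr_gt0.
have [n [phi hphi]] := af _ e2; have [m [psi hpsi]] := ag _ e2.
exists (maxn n m), (fun a b => h (phi (proj n a) (proj n b)) (psi (proj m a) (proj m b))).
rewrite [e]splitr; apply: le_trans (lerD hphi hpsi).
rewrite /L1dist -integD; [|exact/L1_norm/L1B/L1_cyl|exact/L1_norm/L1B/L1_cyl].
apply: le_integ; [exact/L1_norm/L1B/L1_cyl|by apply: L1D; exact/L1_norm/L1B/L1_cyl|].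
move=> z; apply: le_trans (hh _ _ _ _).
by rewrite /cylinder_fun !proj_trunc ?leq_maxl ?leq_maxr.
Qed.

Lemma approximableD f g : approximable f -> approximable g ->
  approximable (fun z => f z + g z).
Proof.
move=> af ag; apply: (approximable2 (h := +%R)) => //; last by apply: L1D; [case: af|case: ag].
by move=> a b a' b'; rewrite opprD addrACA ler_normD.
Qed.

Lemma approximableB f g : approximable f -> approximable g ->
  approximable (fun z => f z - g z).
Proof.
move=> af ag; apply: (approximable2 (h := fun a b => a - b)) => //; last first.
  by apply: L1B; [case: af|case: ag].
move=> a b a' b'; rewrite (_ : _ - _ = (a - a') - (b - b')); last ring.
exact: ler_normB.
Qed.

Lemma approximableZ c f : approximable f -> approximable (fun z => c * f z).
Proof.
move=> [hf af]; split=> [|e e0]; first exact: L1Z.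
have c1 : 0 < `|c| + 1 by rewrite ltr_wpDl.
have [n [phi hphi]] := af (e / (`|c| + 1)) (divr_gt0 e0 c1).
exists n, (fun a b => c * phi a b); rewrite /L1dist.
rewrite (eq_integ mu2 (g := fun z => `|c| * `|f z - cylinder_fun phi z|)); last first.
  by move=> z; rewrite -normrM mulrBr.
rewrite integZ; last exact/L1_norm/L1B/L1_cyl.
apply: le_trans (_ : (`|c| + 1) * (e / (`|c| + 1)) <= _); last by rewrite mulrC divfK ?gt_eqF.
by apply: ler_pM => //; [apply: integ_ge0|rewrite lerDl].
Qed.

Lemma approximable_sum n (F : nat -> plane -> R) : (forall i, approximable (F i)) ->
  approximable (fun z => \sum_(i < n) F i z).
Proof.
move=> hF; elim: n => [|n IH].
  rewrite (_ : (fun z => _) = cylinder_fun (fun _ _ : cube 0 => 0)).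
    exact: approximable_cyl.
  by apply/funext => z; rewrite big_ord0.
rewrite (_ : (fun z => _) = fun z => \sum_(i < n) F i z + F n z); first exact: approximableD.
by apply/funext => z; rewrite big_ord_recr.
Qed.

Lemma approximable_lim f : L1 f ->
  (forall e, 0 < e -> exists2 g, approximable g & L1dist f g <= e) -> approximable f.
Proof.
move=> hf lim; split=> // e e0; have e2 : 0 < e / 2 by rewrite divr_gt0.
have [g [hg ag] fg] := lim _ e2; have [n [phi hphi]] := ag _ e2.
exists n, phi; apply: le_trans (L1dist_trans hf hg (L1_cyl phi)) _.
by rewrite [e]splitr lerD.
Qed.

Definition approximable_set (A : set plane) : Prop :=
  measurable A /\ approximable (\1_A : plane -> R).

Lemma approximable_cylinder_set n (c : cube n -> cube n -> bool) :
  approximable_set [set z | c (trunc n z.1) (trunc n z.2)].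
Proof.
split; first exact: measurable_cylinder_set.
rewrite (_ : \1_ _ = cylinder_fun (fun a b => (c a b)%:R)); first exact: approximable_cyl.
apply/funext => z; rewrite indicE; congr (_%:R); congr nat_of_bool.
by apply/idP/idP; rewrite inE.
Qed.

Lemma approximable_setT : approximable_set setT.
Proof.
have := @approximable_cylinder_set 0 (fun _ _ => true).
by congr approximable_set; exact/seteqP.
Qed.

Lemma approximable_setD A B : B `<=` A -> approximable_set A -> approximable_set B ->
  approximable_set (A `\` B).
Proof.
move=> BA [mA aA] [mB aB]; split; first exact: measurableD.
rewrite (_ : \1_ _ = fun z => (\1_A z - \1_B z : R)); first exact: approximableB.
apply/funext => z; rewrite !indicE in_setD; case Bz : (z \in B).
  by rewrite andbF (mem_set (BA _ (set_mem Bz))) subrr.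
by rewrite andbT subr0.
Qed.

Lemma approximable_setC A : approximable_set A -> approximable_set (setT `\` A).
Proof. by move=> aA; apply: approximable_setD => //; exact: approximable_setT. Qed.

Lemma dist_max (a b a' b' : R) :
  `|Num.max a b - Num.max a' b'| <= `|a - a'| + `|b - b'|.
Proof.
have h := ler_norm (a - a'); have h' := ler_normr (a - a') (a' - a).
have := ler_norm (b - b'); have := ler_norm (a' - a); have := ler_norm (b' - b).
rewrite (distrC a' a) (distrC b' b) ler_norml => h1 h2 h3.
have n1 := normr_ge0 (a - a'); have n2 := normr_ge0 (b - b').
by apply/andP; split; case: (leP a b) => ?; case: (leP a' b') => ?; lra.
Qed.

Lemma approximable_setU A B : approximable_set A -> approximable_set B ->
  approximable_set (A `|` B).
Proof.
move=> [mA aA] [mB aB]; have mAB := measurableU _ _ mA mB; split=> //.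
have e : \1_(A `|` B) = (fun z => Num.max (\1_A z) (\1_B z)) :> (plane -> R).
  apply/funext => z; rewrite !indicE in_setU.
  by do 2 case: (_ \in _) => /=; rewrite ?maxxx// /Num.max ?ltr01 ?ltr10.
rewrite e; apply: approximable2 => //; first exact: dist_max.
by rewrite -e; exact: (L1_indic (mu2_fin R)).
Qed.

Lemma approximable_setI A B : approximable_set A -> approximable_set B ->
  approximable_set (A `&` B).
Proof.
move=> aA aB; rewrite -(setCK (A `&` B)) setCI -setTD.
by apply: approximable_setC; apply: approximable_setU; rewrite -setTD; exact: approximable_setC.
Qed.

Lemma approximable_bigcup (A : nat -> set plane) : (forall n, approximable_set (A n)) ->
  approximable_set (\bigcup_n A n).
Proof.
move=> aA; pose B n := \big[setU/set0]_(i < n.+1) A i.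
have aB n : approximable_set (B n).
  rewrite /B; elim: n => [|n IH]; first by rewrite big_ord_recr big_ord0 /= set0U.
  by rewrite big_ord_recr; exact: approximable_setU.
have mB n : measurable (B n) by case: (aB n).
rewrite -bigcup_bigsetU_bigcup -/B.
have mU : measurable (\bigcup_n B n) by exact: bigcupT_measurable.
split=> //; apply: approximable_lim; first exact: (L1_indic (mu2_fin R)).
move=> e e0.
have ndB : nondecreasing_seq B.
  by move=> n m nm; apply/subsetPset/subset_bigsetU; rewrite ltnS.
have := @nondecreasing_cvg_mu _ _ _ mu2 B mB mU ndB.
rewrite (integ_indic (mu2_fin R) mU) => /fine_cvg /cvgr_dist_le /(_ e e0) [n _ /(_ n (leqnn n))].
rewrite /= (integ_indic (mu2_fin R) (mB n)) /= => hn.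
exists (\1_(B n)); first by case: (aB n).
apply: le_trans hn; rewrite /L1dist.
have h1 : L1 (\1_(\bigcup_n B n)) by exact: (L1_indic (mu2_fin R)).
have h2 : L1 (\1_(B n)) by exact: (L1_indic (mu2_fin R)).
rewrite (eq_integ mu2 (g := fun z => \1_(\bigcup_n B n) z + -1 * \1_(B n) z)).
  by rewrite integD ?integZ ?mulN1r ?ler_norm//; exact: L1Z.
move=> z; rewrite mulN1r ger0_norm// subr_ge0 !indicE ler_nat.
by case Bz : (z \in B n) => //; rewrite mem_set//; exists n => //; exact/set_mem.
Qed.

(** The approximable sets are closed under complements and countable unions. They contain the
    cylinders in each variable, hence the measurable rectangles, which generate the product. *)
Lemma measurable_approximable A : measurable A -> approximable_set A.
Proof.
have slice (pr : plane -> walsh_group) :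
    (forall n (c : pred (cube n)), approximable_set [set z | c (trunc n (pr z))]) ->
    forall B, measurable B -> approximable_set [set z | B (pr z)].
  move=> prA B; rewrite measurable_walsh_boxE; move: B; apply: smallest_sub.
    split=> [|B|B]; last exact: approximable_bigcup.
      by have := approximable_setC approximable_setT; rewrite setDT.
    exact: approximable_setC.
  move=> _ [B _ [n _ <-]].
  have := prA n (fun a => `[< forall k : 'I_n, B k (a k) >]).
  congr approximable_set; apply/seteqP; split=> z /=.
    by move=> /asboolP h k kn; have := h (Ordinal kn); rewrite ffunE.
  by move=> h; apply/asboolP => k; rewrite ffunE; exact: h.
have fstA := slice fst (fun n c => approximable_cylinder_set (fun a _ => c a)).
have sndA := slice snd (fun n c => approximable_cylinder_set (fun _ b => c b)).
rewrite measurable_prod_measurableType; move: A; apply: smallest_sub.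
  split=> [|A|A]; last exact: approximable_bigcup.
    by have := approximable_setC approximable_setT; rewrite setDT.
  exact: approximable_setC.
move=> _ [A mA [B mB <-]].
exact: (approximable_setI (fstA A mA) (sndA B mB)).
Qed.

Import HBSimple.

Lemma L1_approximable f : L1 f -> approximable f.
Proof.
move=> hf; apply: approximable_lim => // e e0.
have [g [hg _]] := approximation_sfun_integrable measurableT hf.
move=> /fine_cvg /cvgr_dist_le /(_ e e0) [n _ /(_ n (leqnn n))] /=.
rewrite sub0r normrN => hn; exists (fun z => g n z).
  rewrite (funext (fimfunEord (g n))).
  pose s : seq R := finmap.enum_fset (fset_set (range (g n))).
  refine (@approximable_sum _ (fun i z => s`_i * \1_(g n @^-1` [set s`_i]) z) _) => i.
  apply: approximableZ.
  by apply: (measurable_approximable _).2; exact: measurable_funPTI.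
by apply: le_trans (ler_norm _) hn.
Qed.

End Density.

(** * Tails in L log L *)

Section Tails.
Variable R : realType.
Local Notation plane := (walsh_group * walsh_group)%type.
Local Notation mu2 := (walsh_measure R \x walsh_measure R)%E.
Local Notation L1 := (L1 mu2).
Local Notation integ := (integ mu2).
Implicit Types (f g r : plane -> R) (z : plane).

Lemma logp_ge0 (u : R) : 0 <= logp u.
Proof. by rewrite /logp; case: ltP => // u1; rewrite ln_ge0// ltW. Qed.

Lemma logpE (u : R) : logp u = ln (Num.max 1 u).
Proof. by rewrite /logp; case: ltP => [//|u1]; rewrite ?ln1. Qed.

Lemma le_logp (u v : R) : u <= v -> logp u <= logp v.
Proof.
move=> uv; rewrite !logpE ler_ln ?posrE ?lt_max ?ltr01//.
by rewrite ge_max !le_max lexx uv orbT.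
Qed.

Lemma measurable_logp : measurable_fun setT (@logp R).
Proof.
rewrite (_ : @logp R = fun u => ln (Num.max 1 u)); last by apply/funext => u; exact: logpE.
by apply: measurableT_comp; [exact: measurable_ln|exact: measurable_maxr].
Qed.

(** Integrability follows from [u <= e + u * logp u] for [u >= 0], with [e = expR 1], and the
    finiteness of the measure. *)
Lemma LlogL_L1 f : LlogL f -> L1 f /\ L1 (fun z => `|f z| * logp `|f z|).
Proof.
move=> [mf hf].
have mn : measurable_fun setT (fun z => `|f z|) by exact: measurableT_comp.
have hlog : L1 (fun z => `|f z| * logp `|f z|).
  apply/integrableP; split.
    apply/measurable_EFinP; apply: measurable_funM => //.
    exact: (measurableT_comp measurable_logp).
  apply: le_lt_trans hf; rewrite le_eqVlt; apply/orP; left; apply/eqP.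
  apply: eq_integral => z _; rewrite /= ger0_norm//.
  by apply: mulr_ge0; [exact: normr_ge0|exact: logp_ge0].
split=> //; have hc : L1 (fun=> expR 1) := L1_cst (mu2_fin R) (expR 1).
apply: (L1_le _ _ (L1D hc hlog)) => // z.
case: (leP `|f z| (expR 1)) => fe.
  by apply: le_trans fe _; rewrite lerDl; apply: mulr_ge0; [exact: normr_ge0|exact: logp_ge0].
apply: ler_wpDl; first exact: expR_ge0.
rewrite ler_peMr// -(expRK 1) logpE; apply: le_trans (_ : ln `|f z| <= _).
  by rewrite ler_ln ?posrE ?expR_gt0// ?ltW// (lt_trans _ fe)// expR_gt0.
by rewrite ler_ln ?posrE ?lt_max ?ltr01 ?le_max ?lexx ?orbT// (lt_trans _ fe)// expR_gt0.
Qed.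

Lemma count_pow2 (v : R) K : \sum_(j < K) (2 ^+ j < v)%R%:R <= 1 + (ln 2)^-1 * logp v.
Proof.
have l2 : 0 < ln (2 : R) by rewrite ln_gt0// ltr1n.
have L0 : 0 <= (ln 2)^-1 * logp v by rewrite mulr_ge0 ?logp_ge0// invr_ge0 ltW.
elim: K => [|K IH]; first by rewrite big_ord0 ler_wpDl.
rewrite big_ord_recr /=; case: ltP => vK; last by rewrite addr0.
apply: le_trans (_ : K%:R + 1 <= _).
  rewrite lerD2r -[X in _ <= X%:R](card_ord K) -sum1_card natr_sum.
  by apply: ler_sum => j _; rewrite ler_nat leq_b1.
rewrite addrC lerD2l [_^-1 * _]mulrC ler_pdivlMr// mulr_natl -lnXn//.
apply: le_trans (_ : logp (2 ^+ K) <= _); last exact/le_logp/ltW.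
by rewrite logpE ler_ln ?posrE ?lt_max ?ltr01 ?exprn_gt0// le_max lexx orbT.
Qed.

(** The first [k0] heights, among them all those below 1, are counted in full; the others dominate
    the powers of 2. *)
Lemma count_height (h : R) : 0 < h -> exists2 c, 1 <= c &
  forall v K, \sum_(k < K) (height h k < v)%R%:R <= c + (ln 2)^-1 * logp v.
Proof.
move=> h0; have [k0 hk0] := exists_height 1 h0.
exists (k0.+1)%:R => [|v K]; first by rewrite ler1n.
apply: le_trans (_ : \sum_(k < k0 + K) (height h k < v)%R%:R <= _).
  by rewrite addnC big_split_ord /= lerDl sumr_ge0.
rewrite big_split_ord /= -natr1 -addrA lerD//.
  rewrite -[X in _ <= X%:R](card_ord k0) -sum1_card natr_sum.
  by apply: ler_sum => j _; rewrite ler_nat leq_b1.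
apply: le_trans (count_pow2 v K); apply: ler_sum => j _.
rewrite ler_nat; case: (ltP _ v) => //= hv; rewrite lt0b (le_lt_trans _ hv)//.
rewrite /height exprD mulrA; apply: ler_peMl; [by rewrite exprn_ge0|exact: hk0].
Qed.

Lemma L1_count (h : R) K g : L1 g ->
  L1 (fun z => `|g z| * \sum_(k < K) (height h k < `|g z|)%R%:R).
Proof.
move=> hg; apply: (@eq_L1 _ _ _ _ (fun z => \sum_(k < K) large_part (height h k) g z)).
  by move=> z; rewrite mulr_sumr.
by apply: L1_sum => k _; exact: L1_large_part.
Qed.

Lemma sum_large_part (h : R) K g : L1 g ->
  \sum_(k < K) integ (large_part (height h k) g) =
  integ (fun z => `|g z| * \sum_(k < K) (height h k < `|g z|)%R%:R).
Proof.
move=> hg; rewrite -integ_sum => [|k _]; last exact: L1_large_part.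
by apply: eq_integ => z; rewrite mulr_sumr.
Qed.

(** If [|f + g| > h], then the larger of [|f|] and [|g|] exceeds [h / 2], and twice it bounds
    [|f + g|]. *)
Lemma large_partD (h : R) f g z :
  large_part h (fun u => f u + g u) z <= 2 * large_part (h / 2) f z + 2 * large_part (h / 2) g z.
Proof.
have h1 := large_part_ge0 (h / 2) f z; have h2 := large_part_ge0 (h / 2) g z.
rewrite {1}/large_part; case: ltP => hfg; last by rewrite mulr0; lra.
have fg := ler_normD (f z) (g z); rewrite mulr1.
move: h1 h2; rewrite /large_part; have := normr_ge0 (f z); have := normr_ge0 (g z).
by case: (ltP _ `|f z|) => h1; case: (ltP _ `|g z|) => h2; rewrite ?mulr1 ?mulr0 => *; lra.
Qed.

Lemma tail_integ (W f : plane -> R) (e : R) : L1 W -> (forall z, 0 <= W z) ->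
  measurable_fun setT f -> 0 < e ->
  exists n : nat, integ (fun z => W z * (n%:R < `|f z|)%R%:R) <= e.
Proof.
move=> hW W0 mf e0.

have mg n : measurable_fun setT (fun z => W z * (n%:R < `|f z|)%R%:R).
  apply: measurable_funM; first exact: L1_measurable hW.
  exact: measurable_indicator_norm_gt.
have cv : {ae mu2, forall z, setT z ->
    (fun n => (W z * (n%:R < `|f z|)%R%:R)%:E) @ \oo --> 0%E}.
  apply: aeW => z _; apply: cvg_near_cst; near=> n.
  rewrite ltNge (_ : _ <= _) ?mulr0//.
  near: n; exists (Num.truncn `|f z|).+1 => // m /= hm.
  by apply: le_trans (ltW (truncnS_gt _)) _; rewrite ler_nat.
have dom : {ae mu2, forall z n, setT z ->
    (`|(W z * (n%:R < `|f z|)%R%:R)%:E| <= (W z)%:E)%E}.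
  apply: aeW => z n _; rewrite /= lee_fin ger0_norm; last by rewrite mulr_ge0.
  by rewrite ler_piMr// lern1 leq_b1.
have [_ _] := @dominated_convergence _ _ _ mu2 setT measurableT
  (fun n z => (W z * (n%:R < `|f z|)%R%:R)%:E) (cst 0%E) (EFin \o W)
  (fun n => (measurable_EFinP _ _).2 (mg n)) (measurable_cst _) cv hW dom.
rewrite integral0 => /fine_cvg /cvgr_dist_le /(_ e e0) [n _ /(_ n (leqnn n))] /=.
rewrite sub0r normrN => hn; exists n.
by apply: le_trans (ler_norm _) hn.
Unshelve. all: by end_near.
Qed.

End Tails.

Section Splitting.
Variable R : realType.
Local Notation plane := (walsh_group * walsh_group)%type.
Local Notation mu2 := (walsh_measure R \x walsh_measure R)%E.
Local Notation L1 := (L1 mu2).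
Local Notation integ := (integ mu2).
Implicit Types (f g r : plane -> R) (z : plane).

Lemma dist_clip (L a x : R) : 0 <= L -> `|a| <= L ->
  `|a - Num.max (- L) (Num.min L x)| <= `|a - x| /\ `|Num.max (- L) (Num.min L x)| <= L.
Proof.
move=> L0; rewrite ler_norml => /andP[a1 a2].
have h1 := ler_norm (a - x); have h2 := ler_norm (x - a); rewrite distrC in h2.
have h3 := normr_ge0 (a - x).
by split; rewrite ler_norml; apply/andP; split; (case: (leP L x) => ?;
  [case: (leP (- L) L) => ?|case: (leP (- L) x) => ?]; lra).
Qed.

(* f is cut at a large height L; the part below is approximated in L^1 by a
   cylinder function bounded by L, for which the number of heights below the
   values of the remainder is bounded, and the part above is controlled by the
   tail of the integral of |f| (1 + logp |f|). *)
Lemma small_remainder f (delta e : R) : L1 f -> L1 (fun z => `|f z| * logp `|f z|) ->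
  0 < delta -> 0 < e ->
  exists n (phi : cube n -> cube n -> R),
    (forall K, \sum_(k < K)
       integ (large_part (height delta k / 2) (fun z => f z - cylinder_fun phi z)) <= e) /\
    integ (fun z => `|f z - cylinder_fun phi z|) <= e.
Proof.
move=> hf hlog d0 e0; have l2 : 0 < ln (2 : R) by rewrite ln_gt0// ltr1n.
(* One halving is already in [height delta k / 2], the other comes from [large_partD]. *)
have d4 : 0 < delta / 4 by rewrite divr_gt0.
have [c c1 count] := count_height d4.
pose w (v : R) := c + (ln 2)^-1 * logp v.
have w1 v : 1 <= w v.
  by apply: le_trans c1 _; rewrite lerDl mulr_ge0 ?logp_ge0// invr_ge0 ltW.
pose W z := `|f z| * w `|f z|.
have hW : L1 W.
  apply: eq_L1 (L1D (L1Z c (L1_norm hf)) (L1Z (ln 2)^-1 hlog)) => z.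
  by rewrite /W /w; ring.
have W0 z : 0 <= W z.
  by apply: mulr_ge0; [exact: normr_ge0|apply: le_trans (w1 _)].
have mf := L1_measurable hf.
have [L hL] := tail_integ hW W0 mf (divr_gt0 e0 (ltr0Sn R 3)).
pose f2 z := f z * (L%:R < `|f z|)%R%:R.
pose f1 z := f z - f2 z.
have normf2 z : `|f2 z| = large_part L%:R f z by rewrite /f2 normrM normr_nat.
have hf2 : L1 f2.
  apply: (L1_le _ _ (L1_norm hf)) => [|z]; last by rewrite normf2 large_part_le.
  by apply: measurable_funM => //; exact: measurable_indicator_norm_gt.
have hf1 : L1 f1 by exact: L1B.
have f1L z : `|f1 z| <= L%:R.
  by rewrite /f1 /f2; case: ltP => h; rewrite ?mulr1 ?mulr0 ?subrr ?normr0 ?subr0 ?ler0n.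
have w2 : 0 < w (2 * L%:R) by apply: lt_le_trans (w1 _).
(* The clipped remainder is bounded by [2 * L], so at most [w (2 * L)] heights lie below its values;
   the precision compensates for this number. *)
have [n [psi hpsi]] := (L1_approximable hf1).2 _ (divr_gt0 e0 (mulr_gt0 (ltr0Sn R 3) w2)).
pose phi (a b : cube n) := Num.max (- L%:R) (Num.min L%:R (psi a b)).
pose r1 z := f1 z - cylinder_fun phi z.
have hr1 : L1 r1 by exact/L1B/L1_cyl.
have clip z := dist_clip (cylinder_fun psi z) (ler0n R L) (f1L z).
have r1L z : `|r1 z| <= 2 * L%:R.
  apply: le_trans (ler_normB _ _) _; rewrite mulr_natl mulr2n lerD//.
  exact: (clip z).2.
have ir1 : w (2 * L%:R) * integ (fun z => `|r1 z|) <= e / 4.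
  rewrite mulrC -ler_pdivlMr// -mulrA -invfM; apply: le_trans hpsi.
  apply: le_integ; [exact: L1_norm|exact/L1_norm/L1B/L1_cyl|].
  by move=> z; exact: (clip z).1.
have r1w K : \sum_(k < K) integ (large_part (height (delta / 4) k) r1) <= e / 4.
  rewrite sum_large_part// -integZ in ir1 *; last exact: L1_norm.
  apply: le_trans ir1; apply: le_integ.
  - exact: L1_count.
  - exact/L1Z/L1_norm.
  - move=> z; rewrite mulrC; apply: ler_wpM2r; first exact: normr_ge0.
    apply: le_trans (count `|r1 z| K) _; rewrite /w lerD2l.
    by apply: ler_wpM2l; [rewrite invr_ge0 ltW|exact/le_logp/r1L].
have f2W z : `|f2 z| * w `|f2 z| <= W z * (L%:R < `|f z|)%R%:R.
  by rewrite /f2; case: ltP => _; rewrite ?mulr1// mulr0 normr0 mul0r mulr0.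
have hWL : L1 (fun z => W z * (L%:R < `|f z|)%R%:R).
  apply: (L1_le _ _ hW) => [|z].
    apply: measurable_funM; first exact: L1_measurable hW.
    exact: measurable_indicator_norm_gt.
  rewrite ger0_norm; last by apply: mulr_ge0; [exact: W0|exact: ler0n].
  by apply: ler_piMr; [exact: W0|rewrite lern1 leq_b1].
have f2w K : \sum_(k < K) integ (large_part (height (delta / 4) k) f2) <= e / 4.
  rewrite sum_large_part//; apply: le_trans hL; apply: le_integ => //.
  - exact: L1_count.
  - move=> z; apply: le_trans (f2W z); apply: ler_wpM2l; first exact: normr_ge0.
    exact: count.
have rE z : f z - cylinder_fun phi z = r1 z + f2 z by rewrite /r1 /f1; ring.
exists n, phi; split=> [K|].
  apply: le_trans (_ : \sum_(k < K) (2 * integ (large_part (height (delta / 4) k) r1) +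
      2 * integ (large_part (height (delta / 4) k) f2)) <= _).
    apply: ler_sum => k _.
    rewrite -integZ; last exact: L1_large_part.
    rewrite -integZ; last exact: L1_large_part.
    rewrite -integD; [|exact/L1Z/L1_large_part|exact/L1Z/L1_large_part].
    apply: le_integ; first by apply/L1_large_part/L1B/L1_cyl.
      by apply: L1D; exact/L1Z/L1_large_part.
    move=> z; rewrite (funext rE).
    rewrite (_ : height (delta / 4) k = height delta k / 2 / 2); last first.
      by rewrite /height; field.
    exact: large_partD.
  rewrite big_split -!mulr_sumr /=; have := r1w K; have := f2w K; lra.
apply: le_trans (_ : integ (fun z => `|r1 z| + `|f2 z|) <= _).
  apply: le_integ; [exact/L1_norm/L1B/L1_cyl|by apply: L1D; exact: L1_norm|].
  by move=> z; rewrite rE ler_normD.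
rewrite integD; [|exact: L1_norm|exact: L1_norm].
have i1 : integ (fun z => `|r1 z|) <= e / 4.
  by apply: le_trans ir1; rewrite ler_peMl//; exact: integ_ge0.
have i2 : integ (fun z => `|f2 z|) <= e / 4.
  apply: le_trans hL; apply: le_integ => //; first exact: L1_norm.
  by move=> z; apply: le_trans (f2W z); rewrite ler_peMr.
by lra.
Qed.

Lemma small_exceptional_set f (e eta : R) : LlogL f -> 0 < e -> 0 < eta ->
  exists n (phi : cube n -> cube n -> R),
  exists2 E : set plane, measurable E /\ (mu2 E <= eta%:E)%E &
    let r z := f z - cylinder_fun phi z in
    forall z, ~ E z -> (forall n, strong_mean r n z <= e) /\ r z ^+ 2 <= e.
Proof.
move=> /LlogL_L1[hf hlog] e0 eta0.
have := @strong_maximal R.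
move: (strong_mean_const_ge1 R) (weak_type_const_ge1 R).
move: (strong_mean_const R) (weak_type_const R) => S C S1 C1 maximal.
have S0 : 0 < S := lt_le_trans ltr01 S1.
have C0 : 0 < C := lt_le_trans ltr01 C1.
pose lam := Num.sqrt (e / S).
have lam0 : 0 < lam by rewrite sqrtr_gt0 divr_gt0.
have lam2 : S * lam ^+ 2 = e.
  by rewrite sqr_sqrtr ?divr_ge0 ?ltW// mulrC divfK ?gt_eqF.
(* With tail bound [B = delta], the weak type inequality gives
   [C / lam * (delta + 2 * delta) = eta / 2]. *)
pose delta := eta * lam / (6 * C).
have d0 : 0 < delta by apply: divr_gt0; apply: mulr_gt0.
have [n [phi [hB hi]]] := small_remainder hf hlog d0 d0.
pose r z := f z - cylinder_fun phi z.
have hr : L1 r by exact/L1B/L1_cyl.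
exists n, phi.
have [E [mE hE] hE'] := maximal _ _ _ _ hr d0 lam0 hB.
have mr : measurable [set z | lam < `|r z|].
  by apply: measurable_norm_gt; exact: L1_measurable hr.
exists (E `|` [set z | lam < `|r z|]).
  split; first exact: measurableU.
  apply: le_trans (measureU2 _ mE mr) _; rewrite [eta]splitr EFinD; apply: leeD.
    apply: le_trans hE _; rewrite lee_fin le_eqVlt; apply/orP; left; apply/eqP.
    by rewrite /delta; field; rewrite !gt_eqF.
  apply: le_trans (measure_norm_gt (mu2_fin R) lam0 hr) _; rewrite lee_fin.
  apply: le_trans (_ : lam^-1 * delta <= _).
    by rewrite ler_wpM2l// invr_ge0 ltW.
  rewrite (_ : lam^-1 * delta = eta / 2 * (3 * C)^-1); last first.
    by rewrite /delta; field; rewrite !gt_eqF.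
  apply: ler_piMr; first by rewrite divr_ge0 ?ltW.
  by rewrite invf_le1; lra.
move=> /= z zE; split=> [m|].
  by rewrite -lam2; apply: hE' => h; apply: zE; left.
have zr : `|r z| <= lam by rewrite leNgt; apply/negP => h; apply: zE; right.
rewrite -/(r z) -[r z ^+ 2]ger0_norm ?sqr_ge0// normrX -lam2.
apply: le_trans (_ : lam ^+ 2 <= _); first by rewrite lerXn2r ?nnegrE// ltW.
by rewrite ler_peMl ?sqr_ge0.
Qed.

End Splitting.

(** * Almost everywhere strong summability *)

Section StrongSummability.
Variable R : realType.
Local Notation plane := (walsh_group * walsh_group)%type.
Local Notation mu2 := (walsh_measure R \x walsh_measure R)%E.
Local Notation L1 := (L1 mu2).
Implicit Types (f g r : plane -> R) (z : plane) (e : R).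

Definition mean_sqr_error f n z : R :=
  n%:R^-1 * \sum_(m < n) (walsh_psum m m z f - f z) ^+ 2.

(** The range is enlarged to a power of 2 with [n < 2 ^ k <= 2 * n]. *)
Lemma sum_le_strong_mean f z e n : (forall k, strong_mean f k z <= e) -> (0 < n)%N ->
  \sum_(m < n) walsh_psum m m z f ^+ 2 <= 2 * n%:R * e.
Proof.
move=> he n0; have [h1 h2] := andP (trunc_log_bounds (isT : 1 < 2)%N n0).
set k := (trunc_log 2 n).+1 in h2.
have e0 : 0 <= e.
  apply: le_trans (he 0); apply: mulr_ge0; first by rewrite invr_ge0 exprn_ge0.
  by apply: sumr_ge0 => m _; exact: sqr_ge0.
apply: le_trans (_ : \sum_(m < 2 ^ k) walsh_psum m m z f ^+ 2 <= _).
  rewrite -(subnKC (ltnW h2)) big_split_ord /= lerDl.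
  by apply: sumr_ge0 => m _; exact: sqr_ge0.
apply: le_trans (_ : 2 ^+ k * e <= _).
  have k0 : (2 ^+ k : R) != 0 by rewrite expf_neq0.
  by rewrite -[leLHS](mulVKf k0); apply: ler_wpM2l; [rewrite exprn_ge0|exact: he].
by apply: ler_wpM2r => //; rewrite exprS ler_wpM2l// -natrX ler_nat.
Qed.

(** The error of the cylinder function vanishes for [m >= 2 ^ n0], so its square sum stays below
    [A], at most [e * n] for large [n]. The three pieces give [3 * (1 + 2 + 1) = 12]. *)
Lemma eventually_small_error f n0 (phi : cube n0 -> cube n0 -> R) z e :
  let r u := f u - cylinder_fun phi u in
  L1 f -> 0 < e -> (forall n, strong_mean r n z <= e) -> r z ^+ 2 <= e ->
  exists N, forall n, (N <= n)%N -> mean_sqr_error f n z <= 12 * e.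
Proof.
move=> r hf e0 hr hrz; have hr1 : L1 r by exact/L1B/L1_cyl.
pose a m := walsh_psum m m z (cylinder_fun phi) - cylinder_fun phi z.
have a0 m : (2 ^ n0 <= m)%N -> a m = 0.
  by move=> hm; rewrite /a [walsh_psum _ _ _ _]walsh_psum_cylinder_fun// subrr.
pose A := \sum_(m < 2 ^ n0) a m ^+ 2.
have A0 : 0 <= A by apply: sumr_ge0 => m _; exact: sqr_ge0.
have sumA n : \sum_(m < n) a m ^+ 2 <= A.
  apply: le_trans (_ : \sum_(m < 2 ^ n0 + n) a m ^+ 2 <= _).
    rewrite addnC big_split_ord /= lerDl.
    by apply: sumr_ge0 => m _; exact: sqr_ge0.
  rewrite big_split_ord /= [X in _ + X]big1 ?addr0// => m _.
  by rewrite a0 ?leq_addr// expr0n.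
have dE m : walsh_psum m m z f - f z = a m + walsh_psum m m z r - r z.
  have -> : walsh_psum m m z f = walsh_psum m m z (cylinder_fun phi) + walsh_psum m m z r.
    rewrite -walsh_psumD//; last exact: L1_cyl.
    by congr walsh_psum; apply/funext => u; rewrite addrC subrK.
  by rewrite /a /r; ring.
have sq3 (x y w : R) : (x + y - w) ^+ 2 <= 3 * x ^+ 2 + 3 * y ^+ 2 + 3 * w ^+ 2.
  have := sqr_ge0 (x - y); have := sqr_ge0 (x + w); have := sqr_ge0 (y + w).
  by rewrite !expr2; lra.
exists (Num.truncn (A / e)).+1 => n hn.
have n0' : (0 < n)%N by apply: leq_trans hn.
have nR : 0 < n%:R :> R by rewrite ltr0n.
have An : A <= e * n%:R.
  rewrite mulrC -ler_pdivrMr//; apply: le_trans (ltW (truncnS_gt _)) _.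
  by rewrite ler_nat.
rewrite /mean_sqr_error mulrC ler_pdivrMr//.
apply: le_trans (_ : \sum_(m < n) (3 * a m ^+ 2 + 3 * walsh_psum m m z r ^+ 2 + 3 * e) <= _).
  apply: ler_sum => m _; rewrite dE; apply: le_trans (sq3 _ _ _) _.
  by rewrite lerD2l ler_wpM2l.
rewrite !big_split -!mulr_sumr /= sumr_const card_ord -mulr_natr.
have := sumA n; have := sum_le_strong_mean hr n0'.
move: (\sum_(m < n) a m ^+ 2) (\sum_(m < n) walsh_psum m m z r ^+ 2) => X Y hY hX.
by lra.
Qed.

(** A fresh cylinder function is taken for each bound [i.+1%:R^-1]; the set in question lies in all
    the exceptional sets, hence in their null intersection. *)
Lemma negligible_error f e : LlogL f -> 0 < e ->
  mu2.-negligible [set z | ~ exists N, forall n, (N <= n)%N -> mean_sqr_error f n z <= e].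
Proof.
move=> hf e0; have [hL1 _] := LlogL_L1 hf.
have e12 : 0 < e / 12 by rewrite divr_gt0.
have small (i : nat) : exists E : set plane, [/\ measurable E, (mu2 E <= i.+1%:R^-1%:E)%E &
    [set z | ~ exists N, forall n, (N <= n)%N -> mean_sqr_error f n z <= e] `<=` E].
  have i0 : 0 < i.+1%:R^-1 :> R by rewrite invr_gt0.
  have [n [phi [E [mE hE] h]]] := small_exceptional_set hf e12 i0.
  exists E; split=> // z /= hz; apply: contrapT => /h[h1 h2]; apply: hz.
  have [N hN] := eventually_small_error hL1 e12 h1 h2.
  by exists N => k /hN; rewrite mulrC divfK.
pose E i := sval (cid (small i)).
have EP i := svalP (cid (small i)).
exists (\bigcap_i E i); split.
- by apply: bigcapT_measurable => i; case: (EP i).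
- apply/eqP; rewrite eq_le measure_ge0 andbT; apply/lee_addgt0Pr => d d0; rewrite add0e.
  have mE : measurable (\bigcap_i E i) by apply: bigcapT_measurable => i; case: (EP i).
  pose i := Num.truncn d^-1; have [mEi hEi _] := EP i.
  apply: le_trans (_ : mu2 (E i) <= _)%E.
    by apply: le_measure; rewrite ?inE// => z; apply.
  apply: le_trans hEi _; rewrite lee_fin -[d]invrK lef_pV2 ?posrE ?invr_gt0//.
  exact/ltW/truncnS_gt.
- by move=> z hz i _; case: (EP i) => _ _; apply.
Qed.

Lemma powR_le_sqr (p x s : R) : 0 < p -> p <= 2 -> 0 < s ->
  `|x| `^ p <= s `^ p + s `^ (p - 2) * x ^+ 2.
Proof.
move=> p0 p2 s0; case: (leP `|x| s) => xs.
  apply: ler_wpDr; first by apply: mulr_ge0; [exact: powR_ge0|exact: sqr_ge0].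
  by apply: ge0_ler_powR; rewrite ?nnegrE// ltW.
have x0 : 0 < `|x| := lt_trans s0 xs.
apply: ler_wpDl; first exact: powR_ge0.
rewrite -[x ^+ 2]ger0_norm ?sqr_ge0// normrX.
rewrite -{1}[p](subrK 2) [leLHS]powRD; last by rewrite (gt_eqF x0) implybT.
rewrite -powR_mulrn//; apply: ler_wpM2r; first exact: powR_ge0.
rewrite -[p - 2]opprB !powRN lef_pV2 ?posrE ?powR_gt0//.
by apply: ge0_ler_powR; rewrite ?nnegrE ?subr_ge0// ltW.
Qed.

Lemma strong_mean_cvg (d : nat -> R) (p : R) : 0 < p -> p <= 2 ->
  (forall e, 0 < e -> exists N, forall n, (N <= n)%N ->
    n%:R^-1 * \sum_(m < n) d m ^+ 2 <= e) ->
  (fun n => (n%:R^-1 * \sum_(m < n) `|d m| `^ p) `^ p^-1) @ \oo --> (0 : R).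
Proof.
move=> p0 p2 hd; apply/cvgr0Pnorm_le => t t0.
have tp : 0 < t `^ p / 2 by rewrite divr_gt0 ?powR_gt0.
(* Half of [t ^ p] is reserved for [s ^ p], the other half for [s ^ (p - 2)] times the mean
   square. *)
pose s := (t `^ p / 2) `^ p^-1.
have s0 : 0 < s by rewrite powR_gt0.
have sp : s `^ p = t `^ p / 2 by rewrite -powRrM mulVf ?gt_eqF// powRr1// ltW.
have q0 : 0 < s `^ (p - 2) by rewrite powR_gt0.
have [N hN] := hd _ (divr_gt0 tp q0).
(* The successor excludes [n = 0], where the mean is no genuine average. *)
exists N.+1 => // n /= Nn; have n0 : (0 < n)%N by apply: leq_trans Nn.
have nR : 0 < n%:R :> R by rewrite ltr0n.
rewrite ger0_norm ?powR_ge0//.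
have tE : t = t `^ p `^ p^-1 by rewrite -powRrM mulfV ?gt_eqF// powRr1// ltW.
rewrite [leRHS]tE.
apply: ge0_ler_powR; rewrite ?nnegrE ?invr_ge0 ?powR_ge0 ?(ltW p0)//.
  by apply: mulr_ge0; [rewrite invr_ge0|apply: sumr_ge0 => m _; exact: powR_ge0].
apply: le_trans (_ : n%:R^-1 * \sum_(m < n) (s `^ p + s `^ (p - 2) * d m ^+ 2) <= _).
  apply: ler_wpM2l; first by rewrite invr_ge0.
  by apply: ler_sum => m _; exact: powR_le_sqr.
rewrite big_split -mulr_sumr /= sumr_const card_ord -[s `^ p *+ n]mulr_natr mulrDr.
rewrite [n%:R^-1 * (_ * n%:R)]mulrC mulfK ?gt_eqF// mulrCA sp.
have := hN n (ltnW Nn); rewrite ler_pdivlMr// mulrC => h.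
by rewrite [leRHS]splitr lerD2l.
Qed.

End StrongSummability.

Unset Implicit Arguments.

Theorem theorem2 (R : realType) (f : walsh_group * walsh_group -> R) (p : R)
    (hf : LlogL f) (p_gt0 : 0 < p) (p_le2 : p <= 2) :
  {ae (walsh_measure R \x walsh_measure R)%E,
    forall z : walsh_group * walsh_group,
      (fun n : nat => (n%:R^-1 * \sum_(m < n)
          `|walsh_psum m m z f - f z| `^ p) `^ p^-1)
        @ \oo --> (0 : R)}.
Proof.
(* Countably many accuracies [j.+1%:R^-1] suffice, so the union of the exceptional null sets is
   negligible. *)
have pos j : 0 < j.+1%:R^-1 :> R by rewrite invr_gt0.
have := negligible_bigcup (fun j : nat => negligible_error hf (pos j)).
apply: negligibleS => z /= hz; apply: contrapT => hn; apply: hz.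
apply: (@strong_mean_cvg R (fun m => walsh_psum m m z f - f z) p) => // e e0; apply: contrapT => he; apply: hn.
exists (Num.truncn e^-1) => //= -[N hN]; apply: he; exists N => n /hN h.
apply: le_trans h _; rewrite -[leRHS]invrK lef_pV2 ?posrE ?invr_gt0//.
exact/ltW/truncnS_gt.
Qed.
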